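(* Suppose that $\rho=0$ or $\mu^{\otimes(m\times n)}(\mathcal T_\rho(\mathbf r,\mathbf c))=0$, and that $\nu$ is $\sigma$-finite. Suppose $\mu$ has density $p\ge0$ with respect to $\zeta$, which is either the counting measure on $\mathbb Z$ or the Lebesgue measure on $\mathbb R$. In the Lebesgue (continuous) case, suppose $\{p>0\}$ is open. Then, for $\nu$-almost all margins $(\mathbf r,\mathbf c)$ with an MLE $(\boldsymbol\alpha,\boldsymbol\beta)$ and $Y\sim\mu_{\boldsymbol\alpha\oplus\boldsymbol\beta}$, $$\sup_{\overline{\mathbf y}}p_{\overline{\mathbf y}}(\mathbf r,\mathbf c)=\Big(\sup_{\overline{\mathbf y}}q_{\overline{\mathbf y}}(\mathbf r,\mathbf c)\Big)\,\mathbb E[q_{\overline Y}(\mathbf r,\mathbf c)]^{-1}\qquad\text{with}\qquad q_{\overline{\mathbf y}}(\mathbf r,\mathbf c)=\frac{d\nu_{\overline{\mathbf y}}}{d\zeta^{\otimes(m+n-1)}}(\mathbf r,\mathbf c).$$ Furthermore, let $\delta>0$ and suppose the Radon–Nikodym derivatives of $\mu_\theta$ with respect to $\zeta$ for $\theta\in[\phi(A_\delta),\phi(B_\delta)]$ are uniformly upper bounded by some constant $M>0$. Then for $\nu$-almost all margins $(\mathbf r,\mathbf c)$ with an MLE $(\boldsymbol\alpha,\boldsymbol\beta)$, with $X\sim\lambda_{\mathbf r,\mathbf c}$ and $Y\sim\mu_{\boldsymbol\alpha\oplus\boldsymbol\beta}$, for each bounded measurable $h:\mathbb R^{(m-1)\times(n-1)}\to\mathbb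 R$, $$\mathbb E[h(\overline X)]=\mathbb E\big[p_{\overline Y}(\mathbf r,\mathbf c)\,h(\overline Y)\big]\le\Big(\sup_{\overline{\mathbf y}}p_{\overline{\mathbf y}}(\mathbf r,\mathbf c)\Big)\,\mathbb E[h(\overline Y)]$$ holds with $$\sup_{\overline{\mathbf y}}p_{\overline{\mathbf y}}(\mathbf r,\mathbf c)\le M^{m+n-1}\exp(-g^{\mathbf r,\mathbf c}(\boldsymbol\alpha,\boldsymbol\beta))\left(\int\prod_{i,j}p(\Gamma_{\mathbf r,\mathbf c}(\overline{\mathbf x})_{ij})\,\zeta^{\otimes(m-1)\times(n-1)}(d\overline{\mathbf x})\right)^{-1}.$$ Furthermore, one can take $M=1$ in the discrete case (where $\zeta$ is the counting measure on $\mathbb Z$).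
   Context: Let $\mu$ be a $\sigma$-finite Borel measure on $\mathbb R$, $A=\inf\operatorname{supp}\mu$, $B=\sup\operatorname{supp}\mu$ (possibly infinite). Let $\Theta=\{\theta\in\mathbb R:\int e^{\theta x}\mu(dx)<\infty\}$, assumed nonempty and not a singleton, with interior $\Theta^\circ$; $\psi(\theta)=\log\int e^{\theta x}\mu(dx)$; for $\theta\in\Theta^\circ$, $\mu_\theta(dx)=e^{\theta x-\psi(\theta)}\mu(dx)$. In this setting $\psi''>0$ on $\Theta^\circ$ and $\psi':\Theta^\circ\to(A,B)$ is strictly increasing with a strictly increasing inverse $\phi:(A,B)\to\Theta^\circ$. For $\delta>0$, $A_\delta=\max(A+\delta,-1/\delta)$ and $B_\delta=\min(B-\delta,1/\delta)$. An $m\times n$ margin is a pair $(\mathbf r,\mathbf c)\in\mathbb R^m\times\mathbb R^n$; when measures on margins are regarded as measures on $\mathbb R^{m+n-1}$, a margin is identified with the vector obtained by omitting $\mathbf r(m)$. For a real $m\times n$ matrix $\mathbf x$, $r(\mathbf x),c(\mathbf x)$ are its row/column sum vectors, $\pi(\mathbf x)=(r(\mathbf x),c(\mathbf x))$; for $\rho\ge0$, $\mathcal T_\rho(\mathbf r,\mathbf c)=\{\mathbf x\in\mathbb R^{m\times n}:\|r(\mathbf x)-\mathbf r\|_1\le\rho,\ \|c(\mathbf x)-\mathbf c\|_1\le\rho\}$. For $\mathbf z\in\mathbb R^{m\times n}$, $\overline{\mathbf z}$ is the $(m-1)\times(n-1)$ submatrix obtained by deleting the last row and column. For $\overline{\mathbf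 x}\in\mathbb R^{(m-1)\times(n-1)}$, $\Gamma_{\mathbf r,\mathbf c}(\overline{\mathbf x})$ is the unique $m\times n$ matrix with margin $(\mathbf r,\mathbf c)$ whose upper-left $(m-1)\times(n-1)$ block is $\overline{\mathbf x}$: its $(i,n)$ entry ($i<m$) is $\mathbf r(i)-\sum_j\overline{\mathbf x}_{ij}$, its $(m,j)$ entry ($j<n$) is $\mathbf c(j)-\sum_i\overline{\mathbf x}_{ij}$, and its $(m,n)$ entry is $\sum_{i,j}\overline{\mathbf x}_{ij}-\sum_{i<m}\mathbf r(i)+\mathbf c(n)$. $g^{\mathbf r,\mathbf c}(\boldsymbol\alpha,\boldsymbol\beta)=\langle\mathbf r,\boldsymbol\alpha\rangle+\langle\mathbf c,\boldsymbol\beta\rangle-\sum_{i,j}\psi(\boldsymbol\alpha(i)+\boldsymbol\beta(j))$; an MLE for $(\mathbf r,\mathbf c)$ is a maximizer of it over $(\boldsymbol\alpha,\boldsymbol\beta)\in\mathbb R^m\times\mathbb R^n$ with all $\boldsymbol\alpha(i)+\boldsymbol\beta(j)\in\Theta^\circ$. $Y\sim\mu_{\boldsymbol\alpha\oplus\boldsymbol\beta}$: $m\times n$ random matrix with independent entries $Y_{ij}\sim\mu_{\boldsymbol\alpha(i)+\boldsymbol\beta(j)}$. $\nu=\pi_\#(\mu^{\otimes(m\times n)})$. When $\nu$ is $\sigma$-finite, $\{\lambda_{\mathbf r,\mathbf c}\}$ is the ($\nu$-a.e. unique) disintegration of $\mu^{\otimes(m\times n)}$ with respect to $\pi$: for $\nu$-a.e.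 $\mathbf t$, $\lambda_{\mathbf t}$ is a probability measure concentrated on $\{\pi=\mathbf t\}$, with $\int h\,d\mu^{\otimes(m\times n)}=\iint h\,d\lambda_{\mathbf t}\,\nu(d\mathbf t)$ for all nonnegative measurable $h$. $\nu_{\overline{\mathbf y}}$ is the law of $(r(Y),c(Y))$ given $\overline Y=\overline{\mathbf y}$, $\nu_Y$ is the unconditional law of $(r(Y),c(Y))$, and $p_{\overline{\mathbf y}}(\cdot)$ is the Radon–Nikodym derivative of $\nu_{\overline{\mathbf y}}$ with respect to $\nu_Y$.
   Formalization: The inequality is stated for h ≥ 0 only; the bound with M (not the discrete M=1 one) needs all α(i)+β(j) in [φ(A_δ),φ(B_δ)]; sups run over ȳ with entries in supp μ, and p_ȳ, q_ȳ are suitably chosen versions of the derivatives, continuous in (α,β). *)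

(* Defs.v *)
From HB Require Import structures.
From mathcomp Require Import all_boot all_order all_algebra.
From mathcomp Require Import all_classical all_reals all_analysis.
From mathcomp Require Import measurable_realfun.
Set Implicit Arguments.
Unset Strict Implicit.
Unset Printing Implicit Defensive.
Import Order.TTheory GRing.Theory Num.Theory.
Import numFieldNormedType.Exports.
Local Open Scope classical_set_scope.
Local Open Scope ring_scope.

(* The matrices called m x n in the mathematical text are 'M[R]_(m.+1, n.+1)
   here, so that the upper-left block is 'M[R]_(m, n); vectors are row
   vectors.  A margin (r, c), as well as a pair of parameters (alpha, beta),
   is a pair in 'rV[R]_m.+1 * 'rV[R]_n.+1. *)

Definition mx_display : measure_display. Proof. exact: default_measure_display. Qed.

(* The Borel sigma-algebra on matrices: the one generated by the entries. *)
Section measurable_matrix.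
Variables (R : realType) (m n : nat).

Definition mx_entry_preimages : set (set 'M[R]_(m, n)) :=
  [set A | exists (i : 'I_m) (j : 'I_n) (B : set (measurableTypeR R)),
     measurable B /\ A = [set x : 'M[R]_(m, n) | B (x i j)]].

Let mx_set0 : <<s mx_entry_preimages >> set0.
Proof. exact: sigma_algebra0. Qed.

Let mx_setC A : <<s mx_entry_preimages >> A -> <<s mx_entry_preimages >> (~` A).
Proof. exact: sigma_algebraC. Qed.

Let mx_bigcup (F : (set 'M[R]_(m, n))^nat) :
  (forall i, <<s mx_entry_preimages >> (F i)) ->
  <<s mx_entry_preimages >> (\bigcup_i F i).
Proof. exact: sigma_algebra_bigcup. Qed.

HB.instance Definition _ := @isMeasurable.Build mx_display 'M[R]_(m, n)
  <<s mx_entry_preimages >> mx_set0 mx_setC mx_bigcup.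

End measurable_matrix.

Section product_measure_on_matrices.
Variable R : realType.
Local Notation RR := (measurableTypeR R).

Fixpoint rvprod (n : nat) :
    ('I_n -> set RR -> \bar R) -> set 'rV[R]_n -> \bar R :=
  match n with
  | 0 => fun _ => dirac (0 : 'rV[R]_0)
  | n'.+1 => fun mu =>
      pushforward (mu ord0 \x rvprod (fun j => mu (lift ord0 j)))%E
        (fun xv : RR * 'rV[R]_n' =>
           row_mx (const_mx xv.1 : 'rV[R]_1) xv.2 : 'rV[R]_n'.+1)
  end.

Fixpoint mxprod (m n : nat) :
    ('I_m -> 'I_n -> set RR -> \bar R) -> set 'M[R]_(m, n) -> \bar R :=
  match m with
  | 0 => fun _ => dirac (0 : 'M[R]_(0, n))
  | m'.+1 => fun mu =>
      pushforward (rvprod (mu ord0) \x mxprod (fun i => mu (lift ord0 i)))%E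
        (fun rx : 'rV[R]_n * 'M[R]_(m', n) =>
           col_mx rx.1 rx.2 : 'M[R]_(m'.+1, n))
  end.

End product_measure_on_matrices.

Definition is_density d (T : measurableType d) (R : realType)
    (nu mu : set T -> \bar R) (f : T -> R) : Prop :=
  [/\ measurable_fun setT f, (forall x, 0 <= f x)
    & forall E, measurable E -> nu E = (\int[mu]_(x in E) (f x)%:E)%E].

(* The counting measure on Z (as a measure on R) or the Lebesgue measure. *)
Definition zeta (R : realType) (discrete : bool) :
    set (measurableTypeR R) -> \bar R :=
  if discrete
  then fun E => counting (E `&` range (fun k : int => k%:~R : measurableTypeR R))
  else lebesgue_measure.

Section exponential_family.
Variables (R : realType) (mu : set (measurableTypeR R) -> \bar R).

Definition msupp : set R :=
  [set x | forall U : set R, open U -> U x -> (0 < mu U)%E].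

Definition Theta : set R :=
  [set theta | (\int[mu]_x (expR (theta * x))%:E < +oo)%E].

Definition psi (theta : R) : R :=
  ln (fine (\int[mu]_x (expR (theta * x))%:E)%E).

Definition tilt (theta : R) : set (measurableTypeR R) -> \bar R :=
  fun E => (\int[mu]_(x in E) (expR (theta * x - psi theta))%:E)%E.

(* The inverse of psi' : Theta° -> (A, B), with value 0 outside its domain. *)
Definition phi (x : R) : R :=
  xget 0 [set theta | interior Theta theta /\ derive1 psi theta = x].

Definition A_delta (delta : R) : R :=
  fine (maxe (ereal_inf (EFin @` msupp) + delta%:E) (- delta^-1)%:E)%E.

Definition B_delta (delta : R) : R :=
  fine (mine (ereal_sup (EFin @` msupp) - delta%:E) (delta^-1)%:E)%E.

Definition tame_interval (delta : R) : set R :=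
  `[phi (A_delta delta), phi (B_delta delta)]%classic.

End exponential_family.

Section matrices.
Variables (R : realType) (m n : nat).
Local Notation marg := ('rV[R]_m.+1 * 'rV[R]_n.+1)%type.
Implicit Types (x y : 'M[R]_(m.+1, n.+1)) (yb : 'M[R]_(m, n)) (t : marg).

Definition margin x : marg :=
  (\row_i (\sum_j x i j), \row_j (\sum_i x i j)).

Definition Trho (rho : R) t : set 'M[R]_(m.+1, n.+1) :=
  [set x | \sum_i `|(margin x).1 0 i - t.1 0 i| <= rho /\
           \sum_j `|(margin x).2 0 j - t.2 0 j| <= rho].

Definition block x : 'M[R]_(m, n) := row' ord_max (col' ord_max x).

(* The identification of a margin with a vector of length (m.+1 + n.+1).-1. *)
Definition reduced t : 'rV[R]_m * 'rV[R]_n.+1 := (col' ord_max t.1, t.2).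

Definition Gamma t yb : 'M[R]_(m.+1, n.+1) :=
  \matrix_(i, j)
    match unlift ord_max i, unlift ord_max j with
    | Some i', Some j' => yb i' j'
    | Some i', None => t.1 0 i - \sum_j0 yb i' j0
    | None, Some j' => t.2 0 j - \sum_i0 yb i0 j'
    | None, None =>
        \sum_i0 \sum_j0 yb i0 j0
        - \sum_(i0 < m) t.1 0 (lift ord_max i0) + t.2 0 ord_max
    end.

(* y with its upper-left block replaced by yb. *)
Definition splice yb y : 'M[R]_(m.+1, n.+1) :=
  \matrix_(i, j)
    match unlift ord_max i, unlift ord_max j with
    | Some i', Some j' => yb i' j'
    | _, _ => y i j
    end.

Variable mu : set (measurableTypeR R) -> \bar R.
Implicit Types ab : marg.

Definition mu_mx : set 'M[R]_(m.+1, n.+1) -> \bar R :=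
  mxprod (fun _ _ => mu).

Definition nu : set marg -> \bar R := pushforward mu_mx margin.

Definition admissible : set marg :=
  [set ab : marg | forall i j, interior (Theta mu) (ab.1 0 i + ab.2 0 j)].

Definition loglik t ab : R :=
  \sum_i t.1 0 i * ab.1 0 i + \sum_j t.2 0 j * ab.2 0 j
  - \sum_i \sum_j psi mu (ab.1 0 i + ab.2 0 j).

Definition is_MLE t ab : Prop :=
  admissible ab /\ forall ab', admissible ab' -> loglik t ab' <= loglik t ab.

Definition law_Y ab : set 'M[R]_(m.+1, n.+1) -> \bar R :=
  mxprod (fun i j => tilt mu (ab.1 0 i + ab.2 0 j)).

Definition nu_Y ab : set marg -> \bar R := pushforward (law_Y ab) margin.

(* The law of the margin of Y given that the block of Y is yb: the entries of
   Y being independent, the last row and column keep their joint law. *)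
Definition nu_bar ab yb : set marg -> \bar R :=
  pushforward (law_Y ab) (fun y => margin (splice yb y)).

Definition nu_bar_reduced ab yb : set ('rV[R]_m * 'rV[R]_n.+1) -> \bar R :=
  pushforward (nu_bar ab yb) reduced.

(* The support of the law of the block of Y, where conditioning on the block
   makes sense. *)
Definition block_supp : set 'M[R]_(m, n) :=
  [set yb : 'M[R]_(m, n) | forall i j, msupp mu (yb i j)].

(* A choice of Radon-Nikodym derivatives d(num ab yb)/d(den ab), one for each
   admissible ab and each yb in the support.  The theorem evaluates these
   functions at a point which determines ab, hence the versions have to be
   tied together for different ab: regularity in ab makes any two choices
   agree, for almost every (yb, t), simultaneously for all ab. *)
Definition is_density_family d (T : measurableType d)
    (num : marg -> 'M[R]_(m, n) -> set T -> \bar R)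
    (den : marg -> set T -> \bar R)
    (f : marg -> 'M[R]_(m, n) -> T -> R) : Prop :=
  [/\ forall ab yb, admissible ab -> block_supp yb ->
        is_density (num ab yb) (den ab) (f ab yb),
      forall ab, admissible ab ->
        measurable_fun [set: 'M[R]_(m, n) * T] (fun u => f ab u.1 u.2)
    & forall yb s, {within admissible, continuous (fun ab => f ab yb s)}].

Definition is_q_family (discrete : bool) q : Prop :=
  is_density_family nu_bar_reduced
    (fun=> rvprod (fun=> zeta discrete) \x rvprod (fun=> zeta discrete))%E q.

Definition is_p_family p : Prop := is_density_family nu_bar nu_Y p.

Definition sup_block (f : 'M[R]_(m, n) -> R) : \bar R :=
  ereal_sup [set (f yb)%:E | yb in block_supp].

Definition is_disintegration (lam : R.-ker marg ~> 'M[R]_(m.+1, n.+1)) : Prop :=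
  {ae nu, forall t, lam t setT = 1%E /\ lam t (~` [set x | margin x = t]) = 0%E}
  /\ forall h : 'M[R]_(m.+1, n.+1) -> \bar R,
       measurable_fun setT h -> (forall x, 0 <= h x)%E ->
       (\int[mu_mx]_x h x = \int[nu]_t \int[lam t]_x h x)%E.

(* E[h(X)] = E[p(Y) h(Y)] <= (sup p) E[h(Y)], where X and Y stand for the
   blocks of X ~ lam_t and Y ~ law_Y ab, and p yb for the value at t of the
   density indexed by yb; the inequality is meant for nonnegative h. *)
Definition block_comparison (lam_t : set 'M[R]_(m.+1, n.+1) -> \bar R) ab
    (p : 'M[R]_(m, n) -> R) : Prop :=
  forall h : 'M[R]_(m, n) -> R, measurable_fun setT h ->
    (exists K, forall yb, `|h yb| <= K) ->
    (\int[lam_t]_x (h (block x))%:E =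
       \int[law_Y ab]_y (p (block y) * h (block y))%:E)%E /\
    ((forall yb, 0 <= h yb) ->
     (\int[law_Y ab]_y (p (block y) * h (block y))%:E <=
       sup_block p * \int[law_Y ab]_y (h (block y))%:E)%E).

Definition sup_bound (discrete : bool) (p : R -> R) (M : R) t ab : \bar R :=
  ((M ^+ (m.+1 + n.+1 - 1) * expR (- loglik t ab))%:E *
   (\int[mxprod (fun (_ : 'I_m) (_ : 'I_n) => zeta discrete)]_xb
      (\prod_i \prod_j p (Gamma t xb i j))%:E)^-1)%E.

End matrices.

(* Main.v *)
(* Given its block, a matrix is determined by its margin: the last column and
   the last row are translates of the reduced margin, by integers in the discrete
   case.  Hence the product of copies of zeta over all entries is the product of
   zeta over reduced margins and of zeta over blocks, and every law in the theorem
   has an explicit density.  With p_theta the density of the tilted measure,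
   - q_yb is the product of p_theta over the border of [Gamma t yb];
   - the law of the margin of Y has density [exp (loglik t ab) * I t], where the
     partition function [I t], the integral of the product of the
     [p (Gamma t xb i j)] over the blocks xb, does not depend on ab.
   So p_yb = q_yb / (exp (loglik t ab) * I t), and the exceptional sets where I
   vanishes or is infinite are common to all parameters ab.  Likewise, the law of
   the block of Y given its margin has density prod p (Gamma t xb) / I t, in which
   ab has cancelled out; it agrees with the disintegration by uniqueness on a
   countable pi-system of blocks.
   Two points need care.  For every block yb of the support (and not just for
   almost every one), q_yb must vanish where I does: this uses that {p > 0} is
   open.  And q_yb <= M^(m+n+1) must hold everywhere while p_theta <= M is known
   only almost everywhere: this dictates the choice of a version of p. *)

Require Import Defs.
From mathcomp Require Import all_boot all_order all_algebra.
From mathcomp Require Import all_classical all_reals all_analysis.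
From mathcomp Require Import measurable_realfun.
From HB Require Import structures.
Set Implicit Arguments.
Unset Strict Implicit.
Unset Printing Implicit Defensive.
Import Order.TTheory GRing.Theory Num.Theory.
Import numFieldNormedType.Exports.
Local Open Scope classical_set_scope.
Local Open Scope ring_scope.

(** * Densities and product measures on matrices *)

(** The parameters in the conclusion are an MLE of the very margin [t] at which the densities are
    evaluated, so every null set of margins has to be fixed before [ab] is. The exceptional margins
    are therefore collected in [regular] and in the identification of [lam t], neither of which
    mentions a parameter; what remains is a computation valid at each such margin and for each
    admissible [ab]. Two versions of the density coexist. The families are built from [pt], because
    the bound by [M] must hold at every point and for uncountably many [theta] at once; one version
    can do this because [p_theta <= M] reads [p x <= M * expR (psi theta - theta * x)], with a
    continuous right-hand side. Positivity of the partition function is proved with [p] instead,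
    since deleting null sets may destroy the openness of the positivity set; it passes to [pt]
    because the two partition functions agree almost everywhere and a nonzero value of [pt] is a
    value of [p]. Both reference measures are treated together through a subgroup [L] of
    translations that preserve [Z] and whose complement is null: the integers or the whole line. *)

Section sigma_finite_packing.
Local Open Scope ereal_scope.
Context d (T : measurableType d) (R : realType).

Section measure.
Variables (P : {measure set T -> \bar R}) (Psf : sigma_finite setT P).

(** The proof of sigma-finiteness is an argument so that canonical inference can read it off the
    term and give this copy of [P] its structure. *)
Definition sfm_copy & sigma_finite setT P := fun A => P A.

HB.instance Definition _ := Measure.copy (sfm_copy Psf) P.
HB.instance Definition _ := Measure_isSigmaFinite.Build d T R (sfm_copy Psf) Psf.

End measure.

Lemma sfm_of_measure (P : {measure set T -> \bar R}) : sigma_finite setT P ->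
  {Q : {sigma_finite_measure set T -> \bar R} | (Q : set T -> \bar R) = P}.
Proof. by move=> Psf; exists (sfm_copy Psf). Qed.

End sigma_finite_packing.

Section density.
Local Open Scope ereal_scope.
Context d (T : measurableType d) (R : realType).

Definition dens (Z : {measure set T -> \bar R}) (f : T -> R)
  (mf : measurable_fun setT f) (f0 : forall x, (0 <= f x)%R) :=
  fun E => \int[Z]_(x in E) (f x)%:E.

Section measure.
Variables (Z : {measure set T -> \bar R}) (f : T -> R).
Variables (mf : measurable_fun setT f) (f0 : forall x, (0 <= f x)%R).

Let dens0 : dens Z mf f0 set0 = 0. Proof. exact: integral_set0. Qed.

Let dens_ge0 A : 0 <= dens Z mf f0 A.
Proof. by apply: integral_ge0 => x _; rewrite lee_fin. Qed.

Let dens_add : semi_sigma_additive (dens Z mf f0).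
Proof.
apply: semi_sigma_additive_nng_induced => [|x]; last by rewrite lee_fin.
exact/measurable_EFinP.
Qed.

HB.instance Definition _ := isMeasure.Build d T R (dens Z mf f0)
  dens0 dens_ge0 dens_add.

End measure.

Import HBNNSimple.

(** Both sides pass to the limit along increasing simple functions approximating [g]; on a simple
    function, linearity reduces the identity to level sets, where it is the definition of a
    density. *)
Lemma ge0_integral_dens (P Z : {measure set T -> \bar R}) (f : T -> R) :
  is_density P Z f -> forall g : T -> \bar R, measurable_fun setT g ->
  (forall x, 0 <= g x) -> \int[P]_x g x = \int[Z]_x (g x * (f x)%:E).
Proof.
move=> [mf f0 PZ] g mg g0.
pose g_ := nnsfun_approx measurableT mg.
have gcvg x : (g_ n x)%:E @[n --> \oo] --> g x.
  by apply: cvg_nnsfun_approx => // y _; exact: g0.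
transitivity (limn (fun n => \int[P]_x (g_ n x)%:E)).
  rewrite -monotone_convergence//.
  - by apply: eq_integral => x _; apply/esym/cvg_lim => //; exact: gcvg.
  - by move=> n; exact/measurable_EFinP/measurable_funP.
  - by move=> n y _; rewrite lee_fin.
  - by move=> y _ m n mn; rewrite lee_fin; exact/lefP/nd_nnsfun_approx.
transitivity (limn (fun n => \int[Z]_x ((g_ n x)%:E * (f x)%:E))); last first.
  rewrite -monotone_convergence//.
  - apply: eq_integral => x _; apply/cvg_lim => //.
    by apply: cvgeZr => //; exact: gcvg.
  - by move=> n; apply: emeasurable_funM; exact/measurable_EFinP.
  - by move=> n y _; rewrite -EFinM lee_fin mulr_ge0.
  - move=> y _ m n mn; rewrite -!EFinM lee_fin ler_wpM2r//.
    exact/lefP/nd_nnsfun_approx.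
congr (limn _); apply/funext => n.
transitivity (\sum_(k \in range (g_ n)) \int[P]_x (k * \1_(g_ n @^-1` [set k]) x)%:E).
  under eq_integral do rewrite fimfunE -fsumEFin//.
  rewrite ge0_integral_fsum//.
    by move=> y; exact/measurable_EFinP/measurable_funM.
  by move=> y x _; rewrite nnfun_muleindic_ge0.
under [RHS]eq_integral => x _.
  rewrite fimfunE -fsumEFin// ge0_mule_fsuml; last first.
    by move=> r; rewrite nnfun_muleindic_ge0.
  over.
rewrite ge0_integral_fsum//; last 2 first.
- move=> y; apply: emeasurable_funM; last exact/measurable_EFinP.
  exact/measurable_EFinP/measurable_funM.
- by move=> y x _; apply: mule_ge0; rewrite ?lee_fin//; exact: nnfun_muleindic_ge0.
apply: eq_fsbigr => k; rewrite inE => -[z _ <-].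
have mz : measurable (g_ n @^-1` [set g_ n z]) by exact: measurable_sfunP.
have gz0 : 0 <= (g_ n z)%:E by rewrite lee_fin.
have m1 : measurable_fun setT (fun x : T => (\1_(g_ n @^-1` [set g_ n z]) x : R)%:E).
  exact/measurable_EFinP/measurable_indic.
under eq_integral do rewrite EFinM.
rewrite (ge0_integralZl _ _ m1)//.
under [RHS]eq_integral do rewrite EFinM -muleA.
rewrite ge0_integralZl//; last 2 first.
- by apply: emeasurable_funM => //; exact/measurable_EFinP.
- by move=> ? _; rewrite -EFinM lee_fin mulr_ge0.
congr (_ * _); rewrite integral_indic// setIT PZ//.
rewrite integral_mkcond; apply: eq_integral => x _.
by rewrite patchE indicE; case: ifPn => _; rewrite ?mul1e ?mul0e.
Qed.

Lemma is_density_dens (Z : {measure set T -> \bar R}) (f : T -> R)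
    (mf : measurable_fun setT f) (f0 : forall x, (0 <= f x)%R) :
  is_density (dens Z mf f0) Z f.
Proof. by split. Qed.

End density.

Section matrix_measurability.
Context (R : realType) (m n : nat).
Local Notation RR := (measurableTypeR R).

Lemma measurable_entry (i : 'I_m) (j : 'I_n) :
  measurable_fun setT (fun x : 'M[R]_(m, n) => x i j : RR).
Proof.
move=> _ B mB; rewrite setTI; apply: sub_sigma_algebra.
by exists i, j, B.
Qed.

Lemma measurable_mx d (T : measurableType d) (f : T -> 'M[R]_(m, n)) :
  (forall i j, measurable_fun setT (fun x => f x i j : RR)) ->
  measurable_fun setT f.
Proof.
move=> mf; apply: (measurability (@mx_entry_preimages R m n)) => //.
move=> _ [_ [i [j [B [mB ->]]]] <-].
by have := mf i j measurableT B mB.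
Qed.

Definition mxrect (A : 'I_m -> 'I_n -> set RR) : set 'M[R]_(m, n) :=
  [set x | forall i j, A i j (x i j)].

Lemma measurable_mxrect A : (forall i j, measurable (A i j)) ->
  measurable (mxrect A).
Proof.
move=> mA; rewrite (_ : mxrect A = \bigcap_(ij in [set: 'I_m * 'I_n])
    (fun x : 'M[R]_(m, n) => x ij.1 ij.2) @^-1` A ij.1 ij.2).
  apply: fin_bigcap_measurable; first exact: finite_finset.
  move=> ij _; have := measurable_entry ij.1 ij.2 measurableT (mA ij.1 ij.2).
  by rewrite setTI.
apply/seteqP; split => x Ax; first by move=> [i j] _; exact: Ax.
by move=> i j; exact: (Ax (i, j)).
Qed.

Definition mxrects : set (set 'M[R]_(m, n)) :=
  [set mxrect A | A in [set A | forall i j, measurable (A i j)]].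

Lemma measurable_mxrects : @measurable _ 'M[R]_(m, n) = <<s mxrects >>.
Proof.
apply/seteqP; split; apply: smallest_sub.
- exact: smallest_sigma_algebra.
- move=> _ [i [j [B [mB ->]]]]; apply: sub_sigma_algebra.
  exists (fun i' j' => if (i' == i) && (j' == j) then B else setT).
    by move=> i' j' /=; case: ifP.
  apply/seteqP; split => x /=; first by move/(_ i j); rewrite !eqxx.
  by move=> Bx i' j'; case: ifP => // /andP[/eqP -> /eqP ->].
- exact: sigma_algebra_measurable.
- by move=> _ [A mA <-]; exact: measurable_mxrect.
Qed.

Lemma setI_closed_mxrects : setI_closed mxrects.
Proof.
move=> _ _ [A mA <-] [B mB <-]; exists (fun i j => A i j `&` B i j).
  by move=> i j; exact: measurableI.
apply/seteqP; split => x /=; first by move=> AB; split => i j; have [] := AB i j.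
by move=> [Ax Bx] i j; split; [exact: Ax|exact: Bx].
Qed.

Local Open Scope ereal_scope.

(** Each entry has its own increasing exhaustion by sets of finite measure. A given matrix has
    finitely many entries, so the largest of the indices they require serves them all. *)
Lemma mxrect_cover (mu : 'I_m -> 'I_n -> {sigma_finite_measure set RR -> \bar R}) :
  exists F : nat -> 'I_m -> 'I_n -> set RR,
    [/\ forall k i j, measurable (F k i j),
      \bigcup_k mxrect (F k) = setT &
      forall k, \prod_i \prod_j mu i j (F k i j) < +oo].
Proof.
have /choice[F FP] : forall ij : 'I_m * 'I_n, exists F : (set RR)^nat,
    [/\ setT = \bigcup_k F k, nondecreasing_seq F &
      forall k, measurable (F k) /\ mu ij.1 ij.2 (F k) < +oo].
  move=> ij; have /sigma_finiteP[F [FT nd Foo]] := sigma_finiteT (mu ij.1 ij.2).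
  by exists F.
exists (fun k i j => F (i, j) k); split.
- by move=> k i j; have [_ _ /(_ k)[]] := FP (i, j).
- apply/seteqP; split => // x _.
  have /choice[K KP] : forall ij : 'I_m * 'I_n, exists k, F ij k (x ij.1 ij.2).
    move=> ij; have [FT _ _] := FP ij.
    have : [set: RR] (x ij.1 ij.2) by [].
    by rewrite FT => -[k _ Fk]; exists k.
  exists (\max_ij K ij)%N => // i j.
  have [_ nd _] := FP (i, j).
  have /subsetPset := nd (K (i, j)) _ (@leq_bigmax _ K (i, j)).
  by apply; exact: (KP (i, j)).
- move=> k; rewrite -ge0_fin_numE; last first.
    by apply: prode_ge0 => i _; exact: prode_ge0.
  apply: prode_fin_num => i _; apply: prode_fin_num => j _.
  by rewrite ge0_fin_numE//; have [_ _ /(_ k)[]] := FP (i, j).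
Qed.

(** Rectangles form a generating pi-system, and the cover above supplies the finiteness that
    uniqueness requires. Identities between measures on matrices are mostly reduced to rectangles
    through this lemma. *)
Lemma mxrect_unique (mu : 'I_m -> 'I_n -> {sigma_finite_measure set RR -> \bar R})
    (P Q : {measure set 'M[R]_(m, n) -> \bar R}) :
  (forall A, (forall i j, measurable (A i j)) ->
     P (mxrect A) = \prod_i \prod_j mu i j (A i j)) ->
  (forall A, (forall i j, measurable (A i j)) ->
     Q (mxrect A) = \prod_i \prod_j mu i j (A i j)) ->
  forall E, measurable E -> P E = Q E.
Proof.
move=> HP HQ; have [F [mF FT Foo]] := mxrect_cover mu.
apply: (measure_unique mxrects (fun k => mxrect (F k))) => //.
- exact: measurable_mxrects.
- exact: setI_closed_mxrects.
- by move=> k; exists (F k).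
- by move=> _ [A mA <-]; rewrite HP// HQ.
- by move=> k; rewrite HP.
Qed.

End matrix_measurability.

Section product_of_sigma_finite.
Local Open Scope ereal_scope.
Context d1 d2 (T1 : measurableType d1) (T2 : measurableType d2) (R : realType).
Variables (m1 : {sigma_finite_measure set T1 -> \bar R})
          (m2 : {sigma_finite_measure set T2 -> \bar R}).

Lemma sigma_finite_product : sigma_finite setT (m1 \x m2).
Proof.
have /sigma_finiteP[F [FT ndF Foo]] := sigma_finiteT m1.
have /sigma_finiteP[G [GT ndG Goo]] := sigma_finiteT m2.
exists (fun k => F k `*` G k) => [|k].
  apply/seteqP; split => // -[x y] _.
  have : [set: T1] x by [].
  rewrite FT => -[i _ Fx]; have : [set: T2] y by [].
  rewrite GT => -[j _ Gy]; exists (maxn i j) => //; split => /=.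
    by have /subsetPset := ndF _ _ (leq_maxl i j); exact.
  by have /subsetPset := ndG _ _ (leq_maxr i j); exact.
have [mF Fk] := Foo k; have [mG Gk] := Goo k; split; first exact: measurableX.
by rewrite product_measure1E// lte_mul_pinfty// ge0_fin_numE.
Qed.

(* The canonical sigma-finite structure that the library infers on [m1 \x m2]
   is the one for subprobability factors. *)
Definition prodm : {sigma_finite_measure set (T1 * T2)%type -> \bar R} :=
  sfm_copy sigma_finite_product.

Lemma prodm_setX A1 A2 : measurable A1 -> measurable A2 ->
  prodm (A1 `*` A2) = m1 A1 * m2 A2.
Proof. exact: product_measure1E. Qed.

Lemma ge0_integral_prodm (F : T1 * T2 -> \bar R) : measurable_fun setT F ->
  (forall z, 0 <= F z) -> \int[prodm]_z F z = \int[m1]_x \int[m2]_y F (x, y).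
Proof. by move=> mF F0; exact: (fubini_tonelli1 F mF F0). Qed.

End product_of_sigma_finite.

Section push.
Local Open Scope ereal_scope.
Context d1 d2 (T1 : measurableType d1) (T2 : measurableType d2) (R : realType).

Definition push (m : {measure set T1 -> \bar R}) (f : T1 -> T2)
  (mf : measurable_fun setT f) := pushforward m f.

Section measure.
Variables (m : {measure set T1 -> \bar R}) (f : T1 -> T2).
Hypothesis mf : measurable_fun setT f.

Let push0 : push m mf set0 = 0. Proof. exact: measure0. Qed.

Let push_ge0 A : 0 <= push m mf A. Proof. exact: measure_ge0. Qed.

Let push_add : semi_sigma_additive (push m mf).
Proof.
move=> F mF tF mUF; rewrite /push /pushforward preimage_bigcup.
have mfF k : measurable (f @^-1` F k) by rewrite -[X in measurable X]setTI; exact: mf.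
apply: measure_semi_sigma_additive => //; last exact: bigcupT_measurable.
apply/trivIsetP => i j _ _ ij; rewrite -preimage_setI.
by move/trivIsetP : tF => /(_ _ _ _ _ ij) ->//; rewrite preimage_set0.
Qed.

HB.instance Definition _ := isMeasure.Build d2 T2 R (push m mf)
  push0 push_ge0 push_add.

Lemma ge0_integral_push (F : T2 -> \bar R) : measurable_fun setT F ->
  (forall y, 0 <= F y) -> \int[push m mf]_y F y = \int[m]_x F (f x).
Proof. by move=> mF F0; exact: (ge0_integral_pushforward mf m measurableT mF). Qed.

End measure.

(** A pushforward of a sigma-finite measure need not be sigma-finite; a measurable left inverse [g]
    repairs this, since the preimages under [g] of an exhaustion have the same masses as the
    original sets. *)
Lemma sigma_finite_push (m : {sigma_finite_measure set T1 -> \bar R})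
    (f : T1 -> T2) (g : T2 -> T1) (mf : measurable_fun setT f) :
  measurable_fun setT g -> cancel f g -> sigma_finite setT (push m mf).
Proof.
move=> mg fK; have [F FT Foo] := sigma_finiteT m.
exists (fun k => g @^-1` F k) => [|k].
  by rewrite -preimage_bigcup -FT preimage_setT.
have [mF Fk] := Foo k; split.
  by rewrite -[X in measurable X]setTI; exact: mg.
rewrite /push /pushforward (_ : f @^-1` _ = F k)//.
by apply/seteqP; split => x; rewrite /preimage /= fK.
Qed.

End push.

Section row_product.
Local Open Scope ereal_scope.
Context (R : realType).
Local Notation RR := (measurableTypeR R).
Implicit Type n : nat.

Definition row_cons n (xv : RR * 'rV[R]_n) : 'rV[R]_n.+1 :=
  row_mx (const_mx xv.1 : 'rV[R]_1) xv.2.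

Lemma row_cons0 n (xv : RR * 'rV[R]_n) i : row_cons xv i ord0 = xv.1.
Proof.
by rewrite /row_cons mxE; case: splitP => k //=; rewrite mxE.
Qed.

Lemma row_consS n (xv : RR * 'rV[R]_n) i j : row_cons xv i (lift ord0 j) = xv.2 i j.
Proof.
rewrite /row_cons mxE; case: splitP => k /=.
  by rewrite /bump /= add1n => kj; have := ltn_ord k; rewrite -kj.
by rewrite /bump /= => /addnI/val_inj ->.
Qed.

Lemma measurable_row_cons n : measurable_fun setT (@row_cons n).
Proof.
apply: measurable_mx => i j; case: (unliftP ord0 j) => [k|] ->.
  under eq_fun do rewrite row_consS.
  exact: (measurableT_comp (measurable_entry _ _)).
under eq_fun do rewrite row_cons0.
exact: measurable_fst.
Qed.

Definition row_uncons n (v : 'rV[R]_n.+1) : RR * 'rV[R]_n :=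
  (v ord0 ord0, \row_j v ord0 (lift ord0 j)).

Lemma measurable_row_uncons n : measurable_fun setT (@row_uncons n).
Proof.
apply: measurable_fun_pair; first exact: measurable_entry.
apply: measurable_mx => i j; under eq_fun do rewrite mxE.
exact: measurable_entry.
Qed.

Lemma row_consK n : cancel (@row_cons n) (@row_uncons n).
Proof.
move=> [x v]; rewrite /row_uncons row_cons0; congr (_, _).
by apply/rowP => j; rewrite mxE row_consS.
Qed.

(** The equality is one of set functions, not merely on measurable sets, so the bundled measure can
    replace the bare recursive product by rewriting. *)
Lemma rvprod_sfm n (mu : 'I_n -> {sigma_finite_measure set RR -> \bar R}) :
  {Q : {sigma_finite_measure set 'rV[R]_n -> \bar R} |
    (Q : set _ -> _) = rvprod (fun j => mu j)}.
Proof.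
elim: n mu => [|n IH] mu; first by exists (dirac (0%R : 'rV[R]_0)).
have [Q QE] := IH (fun j => mu (lift ord0 j)).
have := sigma_finite_push (prodm (mu ord0) Q) (@measurable_row_cons n)
  (@measurable_row_uncons n) (@row_consK n).
by move=> /sfm_of_measure[P PE]; exists P; rewrite PE /= -QE.
Qed.

Definition rvm n (mu : 'I_n -> {sigma_finite_measure set RR -> \bar R}) :=
  projT1 (rvprod_sfm mu).

Lemma rvmE n (mu : 'I_n -> {sigma_finite_measure set RR -> \bar R}) :
  (rvm mu : set _ -> _) = rvprod (fun j => mu j).
Proof. exact: (projT2 (rvprod_sfm mu)). Qed.

Lemma rvm_cons n (mu : 'I_n.+1 -> {sigma_finite_measure set RR -> \bar R}) :
  (rvm mu : set _ -> _) =
  push (prodm (mu ord0) (rvm (fun j => mu (lift ord0 j)))) (@measurable_row_cons n).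
Proof. by rewrite rvmE /= -rvmE. Qed.

Lemma ge0_integral_rvm_cons n (mu : 'I_n.+1 -> {sigma_finite_measure set RR -> \bar R})
    (F : 'rV[R]_n.+1 -> \bar R) : measurable_fun setT F -> (forall v, 0 <= F v) ->
  \int[rvm mu]_v F v = \int[mu ord0]_x \int[rvm (fun j => mu (lift ord0 j))]_v
    F (row_cons (x, v)).
Proof.
move=> mF F0; rewrite rvm_cons ge0_integral_push//.
have mFc := measurableT_comp mF (@measurable_row_cons n).
by rewrite (ge0_integral_prodm _ _ mFc) => // z; exact: F0.
Qed.

Lemma rvm_rect n (mu : 'I_n -> {sigma_finite_measure set RR -> \bar R})
    (A : 'I_1 -> 'I_n -> set RR) : (forall i j, measurable (A i j)) ->
  rvm mu (mxrect A) = \prod_j mu j (A ord0 j).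
Proof.
elim: n mu A => [|n IH] mu A mA.
  rewrite big_ord0 rvmE /= diracE mem_set// => i; by case.
rewrite rvm_cons /push /pushforward.
rewrite (_ : _ @^-1` _ = A ord0 ord0 `*` mxrect (fun i j => A i (lift ord0 j))).
  have mA' := measurable_mxrect (fun i j => mA i (lift ord0 j)).
  apply: etrans; first exact: (prodm_setX _ _ (mA ord0 ord0) mA').
  by rewrite IH// big_ord_recl.
apply/seteqP; split => [[x v]|[x v] [/= Ax Av]] /=.
  move=> xvA; split => /=; first by have := xvA ord0 ord0; rewrite row_cons0.
  by move=> i j /=; have := xvA i (lift ord0 j); rewrite row_consS.
move=> i j; rewrite (ord1 i); case: (unliftP ord0 j) => [k|] ->.
  by rewrite row_consS; exact: Av.
by rewrite row_cons0.
Qed.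

End row_product.

Section matrix_product.
Local Open Scope ereal_scope.
Context (R : realType).
Local Notation RR := (measurableTypeR R).
Implicit Types m n : nat.

Definition mx_cons m n (rx : 'rV[R]_n * 'M[R]_(m, n)) : 'M[R]_(m.+1, n) :=
  col_mx rx.1 rx.2.

Lemma mx_cons0 m n (rx : 'rV[R]_n * 'M[R]_(m, n)) j : mx_cons rx ord0 j = rx.1 ord0 j.
Proof.
by rewrite /mx_cons mxE; case: splitP => k //= _; rewrite (ord1 k).
Qed.

Lemma mx_consS m n (rx : 'rV[R]_n * 'M[R]_(m, n)) i j :
  mx_cons rx (lift ord0 i) j = rx.2 i j.
Proof.
rewrite /mx_cons mxE; case: splitP => k /=.
  by rewrite /bump /= add1n => ki; have := ltn_ord k; rewrite -ki.
by rewrite /bump /= => /addnI/val_inj ->.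
Qed.

Lemma measurable_mx_cons m n : measurable_fun setT (@mx_cons m n).
Proof.
apply: measurable_mx => i j; case: (unliftP ord0 i) => [k|] ->.
  under eq_fun do rewrite mx_consS.
  exact: (measurableT_comp (measurable_entry _ _)).
under eq_fun do rewrite mx_cons0.
exact: (measurableT_comp (measurable_entry _ _)).
Qed.

Definition mx_uncons m n (x : 'M[R]_(m.+1, n)) : 'rV[R]_n * 'M[R]_(m, n) :=
  (\row_j x ord0 j, \matrix_(i, j) x (lift ord0 i) j).

Lemma measurable_mx_uncons m n : measurable_fun setT (@mx_uncons m n).
Proof.
apply: measurable_fun_pair; apply: measurable_mx => i j;
  under eq_fun do rewrite mxE; exact: measurable_entry.
Qed.

Lemma mx_consK m n : cancel (@mx_cons m n) (@mx_uncons m n).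
Proof.
move=> [r x]; rewrite /mx_uncons; congr (_, _).
  by apply/rowP => j; rewrite mxE mx_cons0.
by apply/matrixP => i j; rewrite mxE mx_consS.
Qed.

Local Notation family m n := ('I_m -> 'I_n -> {sigma_finite_measure set RR -> \bar R}).

Lemma mxprod_sfm m n (mu : family m n) :
  {Q : {sigma_finite_measure set 'M[R]_(m, n) -> \bar R} |
    (Q : set _ -> _) = mxprod (fun i j => mu i j)}.
Proof.
elim: m mu => [|m IH] mu; first by exists (dirac (0%R : 'M[R]_(0, n))).
have [Q QE] := IH (fun i => mu (lift ord0 i)).
have := sigma_finite_push (prodm (rvm (mu ord0)) Q) (@measurable_mx_cons m n)
  (@measurable_mx_uncons m n) (@mx_consK m n).
by move=> /sfm_of_measure[P PE]; exists P; rewrite PE /= -QE -rvmE.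
Qed.

Definition mxm m n (mu : family m n) := projT1 (mxprod_sfm mu).

Lemma mxmE m n (mu : family m n) :
  (mxm mu : set _ -> _) = mxprod (fun i j => mu i j).
Proof. exact: (projT2 (mxprod_sfm mu)). Qed.

Lemma mxm_cons m n (mu : family m.+1 n) :
  (mxm mu : set _ -> _) =
  push (prodm (rvm (mu ord0)) (mxm (fun i => mu (lift ord0 i)))) (@measurable_mx_cons m n).
Proof. by rewrite mxmE /= -mxmE -rvmE. Qed.

Lemma ge0_integral_mxm_cons m n (mu : family m.+1 n)
    (F : 'M[R]_(m.+1, n) -> \bar R) : measurable_fun setT F -> (forall v, 0 <= F v) ->
  \int[mxm mu]_x F x = \int[rvm (mu ord0)]_r \int[mxm (fun i => mu (lift ord0 i))]_x
    F (mx_cons (r, x)).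
Proof.
move=> mF F0; rewrite mxm_cons ge0_integral_push//.
have mFc := measurableT_comp mF (@measurable_mx_cons m n).
by rewrite (ge0_integral_prodm _ _ mFc) => // z; exact: F0.
Qed.

Lemma mxm_rect m n (mu : family m n)
    (A : 'I_m -> 'I_n -> set RR) : (forall i j, measurable (A i j)) ->
  mxm mu (mxrect A) = \prod_i \prod_j mu i j (A i j).
Proof.
elim: m mu A => [|m IH] mu A mA.
  rewrite big_ord0 mxmE /= diracE mem_set// => i; by case: i.
rewrite mxm_cons /push /pushforward.
rewrite (_ : _ @^-1` _ = mxrect (fun=> A ord0) `*` mxrect (fun i => A (lift ord0 i))).
  have mA0 := @measurable_mxrect _ 1 n (fun=> A ord0) (fun=> mA ord0).
  have mA' := measurable_mxrect (fun i => mA (lift ord0 i)).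
  apply: etrans; first exact: (prodm_setX _ _ mA0 mA').
  by rewrite IH// rvm_rect// big_ord_recl.
apply/seteqP; split => [[x v]|[x v] [/= Ax Av]] /=.
  move=> xvA; split => /= i j /=.
    by have := xvA ord0 j; rewrite mx_cons0 (ord1 i).
  by have := xvA (lift ord0 i) j; rewrite mx_consS.
move=> i j; case: (unliftP ord0 i) => [k|] ->.
  by rewrite mx_consS; exact: Av.
by rewrite mx_cons0; exact: (Ax ord0).
Qed.

(** Row vectors are one-row matrices and so carry two recursively defined products. Their agreement
    lets facts about rows be deduced from facts about matrices. *)
Lemma mxm_row n (mu : 'I_n -> {sigma_finite_measure set RR -> \bar R}) E :
  measurable E -> mxm (fun _ : 'I_1 => mu) E = rvm mu E.
Proof.
apply: (mxrect_unique (mu := fun _ : 'I_1 => mu)) => A mA.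
  exact: mxm_rect.
by rewrite big_ord1; exact: rvm_rect.
Qed.

End matrix_product.

Section product_integrals.
Local Open Scope ereal_scope.
Context (R : realType).
Local Notation RR := (measurableTypeR R).
Local Notation family m n := ('I_m -> 'I_n -> {sigma_finite_measure set RR -> \bar R}).

Lemma ge0_integral_rvm_prod n (mu : 'I_n -> {sigma_finite_measure set RR -> \bar R})
    (g : 'I_n -> RR -> R) : (forall j, measurable_fun setT (g j)) ->
    (forall j x, (0 <= g j x)%R) ->
  \int[rvm mu]_v (\prod_j g j (v ord0 j))%:E = \prod_j \int[mu j]_x (g j x)%:E.
Proof.
elim: n mu g => [|n IH] mu g mg g0.
  rewrite big_ord0 rvmE /= integral_dirac// ?diracE.
    by rewrite big_ord0 mem_set// mul1e.
  by apply/measurable_EFinP; apply: measurable_prod => i; case: i.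
rewrite ge0_integral_rvm_cons//; last 2 first.
- apply/measurable_EFinP; apply: measurable_prod => j _.
  exact: (measurableT_comp (mg j) (measurable_entry _ _)).
- by move=> v; rewrite lee_fin prodr_ge0.
under eq_integral => x _.
  under eq_integral => v _.
    rewrite big_ord_recl row_cons0/=.
    under eq_bigr do rewrite row_consS/=.
    rewrite EFinM.
    over.
  rewrite ge0_integralZl//; last 3 first.
  - apply/measurable_EFinP; apply: measurable_prod => j _.
    exact: (measurableT_comp (mg _) (measurable_entry _ _)).
  - by move=> v _; rewrite lee_fin prodr_ge0.
  - by rewrite lee_fin.
  rewrite (IH _ (fun j => g (lift ord0 j)))//.
  over.
rewrite ge0_integralZr//; last 3 first.
- exact/measurable_EFinP.
- by move=> x _; rewrite lee_fin.
- by apply: prode_ge0 => j _; apply: integral_ge0 => x _; rewrite lee_fin.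
by rewrite big_ord_recl.
Qed.

Lemma measurable_prod_entries m n (g : 'I_m -> 'I_n -> RR -> R) :
  (forall i j, measurable_fun setT (g i j)) ->
  measurable_fun setT (fun x : 'M[R]_(m, n) => \prod_i \prod_j g i j (x i j))%R.
Proof.
move=> mg; apply: measurable_prod => i _; apply: measurable_prod => j _.
exact: (measurableT_comp (mg i j) (measurable_entry _ _)).
Qed.

Lemma ge0_integral_mxm_prod m n (mu : family m n) (g : 'I_m -> 'I_n -> RR -> R) :
    (forall i j, measurable_fun setT (g i j)) ->
    (forall i j x, (0 <= g i j x)%R) ->
  \int[mxm mu]_x (\prod_i \prod_j g i j (x i j))%:E =
  \prod_i \prod_j \int[mu i j]_x (g i j x)%:E.
Proof.
elim: m mu g => [|m IH] mu g mg g0.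
  rewrite big_ord0 mxmE /= integral_dirac// ?diracE.
    by rewrite big_ord0 mem_set// mul1e.
  by apply/measurable_EFinP; apply: measurable_prod => -[].
rewrite ge0_integral_mxm_cons//; last 2 first.
- apply/measurable_EFinP; exact: (measurable_prod_entries mg).
- by move=> v; rewrite lee_fin prodr_ge0// => i _; rewrite prodr_ge0.
under eq_integral => r _.
  under eq_integral => v _.
    rewrite big_ord_recl.
    under eq_bigr do rewrite mx_cons0/=.
    under [X in (_ * X)%R]eq_bigr => i _ do under eq_bigr do rewrite mx_consS/=.
    rewrite EFinM.
    over.
  rewrite ge0_integralZl//; last 3 first.
  - apply/measurable_EFinP; exact: (measurable_prod_entries (fun i => mg (lift ord0 i))).
  - by move=> v _; rewrite lee_fin prodr_ge0// => i _; rewrite prodr_ge0.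
  - by rewrite lee_fin prodr_ge0.
  rewrite (IH _ (fun j => g (lift ord0 j)))//.
  over.
rewrite ge0_integralZr//; last 3 first.
- apply/measurable_EFinP; apply: measurable_prod => j _.
  exact: (measurableT_comp (mg _ _) (measurable_entry _ _)).
- by move=> x _; rewrite lee_fin prodr_ge0.
- apply: prode_ge0 => i _; apply: prode_ge0 => j _.
  by apply: integral_ge0 => x _; rewrite lee_fin.
by rewrite big_ord_recl ge0_integral_rvm_prod.
Qed.

Lemma indic_mxrect m n (A : 'I_m -> 'I_n -> set RR) (x : 'M[R]_(m, n)) :
  \1_(mxrect A) x = (\prod_i \prod_j \1_(A i j) (x i j) : R)%R.
Proof.
have [Ax|nAx] := pselect (mxrect A x).
  rewrite indicE mem_set// big1// => i _; rewrite big1// => j _.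
  by rewrite indicE mem_set//; exact: Ax.
have [i [j nij]] : exists i j, ~ A i j (x i j).
  by apply: contrapT => h; apply: nAx => i j; apply: contrapT => ?; apply: h; exists i, j.
rewrite indicE memNset// (bigD1 i)//= (bigD1 j)//= [X in (X * _ * _)%R]indicE.
by rewrite memNset// !mul0r.
Qed.

(** By uniqueness on rectangles it suffices to integrate over a rectangle, whose indicator is a
    product over the entries; the integral then factors entry by entry. *)
Lemma is_density_mxm m n (mu Z : family m n) (f : 'I_m -> 'I_n -> RR -> R) :
  (forall i j, is_density (mu i j) (Z i j) (f i j)) ->
  is_density (mxm mu) (mxm Z) (fun x => \prod_i \prod_j f i j (x i j))%R.
Proof.
move=> mf.
have mf' i j : measurable_fun setT (f i j) by have [] := mf i j.
have f0 i j x : (0 <= f i j x)%R by have [_ + _] := mf i j; exact.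
have mpf := measurable_prod_entries mf'.
have pf0 x : (0 <= \prod_i \prod_j f i j (x i j))%R.
  by rewrite prodr_ge0// => i _; rewrite prodr_ge0.
split => // E mE; rewrite -[RHS]/(dens (mxm Z) mpf pf0 E).
apply: (mxrect_unique (mu := mu)) => // A mA; first exact: mxm_rect.
rewrite /= /dens integral_mkcond.
pose g i j (x : RR) := (f i j x * \1_(A i j) x)%R.
rewrite (eq_integral (fun x : 'M[R]_(m, n) => (\prod_i \prod_j g i j (x i j))%:E)); last first.
  move=> x _; rewrite patchE.
  under [in RHS]eq_bigr do rewrite big_split/=.
  rewrite big_split/= -indic_mxrect indicE.
  by case: ifPn => _; rewrite ?mulr1// mulr0.
rewrite ge0_integral_mxm_prod.
- apply: eq_bigr => i _; apply: eq_bigr => j _.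
  have [_ _ ->//] := mf i j; rewrite [RHS]integral_mkcond.
  apply: eq_integral => x _; rewrite patchE /g indicE.
  by case: ifPn => _; rewrite ?mulr1// mulr0.
- by move=> i j; apply: measurable_funM => //; exact: measurable_indic.
- by move=> i j x; rewrite mulr_ge0.
Qed.

Lemma integral_rvm_mxm n (mu : 'I_n -> {sigma_finite_measure set RR -> \bar R}) F :
  \int[rvm mu]_v F v = \int[mxm (fun _ : 'I_1 => mu)]_v F v.
Proof. by apply: eq_measure_integral => A mA _; exact: (esym (mxm_row mu mA)). Qed.

Lemma is_density_rvm n (mu Z : 'I_n -> {sigma_finite_measure set RR -> \bar R})
    (f : 'I_n -> RR -> R) :
  (forall j, is_density (mu j) (Z j) (f j)) ->
  is_density (rvm mu) (rvm Z) (fun v => \prod_j f j (v ord0 j))%R.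
Proof.
move=> mf; have [mF F0 FE] := @is_density_mxm 1 n (fun=> mu) (fun=> Z) (fun=> f) (fun=> mf).
have FF v : (\prod_(i < 1) \prod_j f j (v i j) = \prod_j f j (v ord0 j))%R.
  by rewrite big_ord1.
split.
- by move: mF; under eq_fun do rewrite FF.
- by move=> v; rewrite -FF.
- move=> E mE; rewrite -(mxm_row mu mE) FE// integral_mkcond [RHS]integral_mkcond.
  by rewrite integral_rvm_mxm; apply: eq_integral => v _; rewrite !patchE FF.
Qed.

Section translation.
Variables (Z : {sigma_finite_measure set RR -> \bar R}) (L : set RR).
Hypothesis ZL : forall a A, L a -> measurable A ->
  Z ((fun x : RR => x - a)%R @^-1` A) = Z A.

Lemma measurable_mx_sub m n (a : 'M[R]_(m, n)) :
  measurable_fun setT (fun x : 'M[R]_(m, n) => x - a)%R.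
Proof.
apply: measurable_mx => i j; under eq_fun do rewrite !mxE.
by apply: measurable_funB => //; exact: measurable_entry.
Qed.

(** Translating a rectangle translates each of its sides, and each side keeps its measure because
    the entries of [a] lie in [L]. *)
Lemma ge0_integral_mxm_shift m n (a : 'M[R]_(m, n)) (F : 'M[R]_(m, n) -> \bar R) :
  (forall i j, L (a i j)) -> measurable_fun setT F -> (forall x, 0 <= F x) ->
  \int[mxm (fun _ _ => Z)]_x F (x - a)%R = \int[mxm (fun _ _ => Z)]_x F x.
Proof.
move=> La mF F0; rewrite -(ge0_integral_push _ (measurable_mx_sub a))//.
apply: eq_measure_integral => E mE _.
apply: (mxrect_unique (mu := fun _ _ => Z)) => // A mA; last exact: mxm_rect.
rewrite /= /push /pushforward.
have -> : (fun x => x - a)%R @^-1` mxrect A =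
    mxrect (fun i j => (fun x : RR => x - a i j)%R @^-1` A i j).
  by apply/seteqP; split => x /= xA i j; have := xA i j; rewrite /= !mxE.
have mA' i j : measurable ((fun x : RR => x - a i j)%R @^-1` A i j).
  rewrite -[X in measurable X]setTI.
  have : measurable_fun setT (fun x : RR => x - a i j)%R by exact: measurable_funB.
  by move/(_ measurableT _ (mA i j)).
apply: etrans; first exact: (mxm_rect (fun _ _ => Z) mA').
apply: eq_bigr => i _; apply: eq_bigr => j _.
exact: (ZL (La i j) (mA i j)).
Qed.

Lemma ge0_integral_rvm_shift n (a : 'rV[R]_n) (F : 'rV[R]_n -> \bar R) :
  (forall i j, L (a i j)) -> measurable_fun setT F -> (forall x, 0 <= F x) ->
  \int[rvm (fun _ => Z)]_x F (x - a)%R = \int[rvm (fun _ => Z)]_x F x.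
Proof.
by move=> La mF F0; rewrite !integral_rvm_mxm; exact: ge0_integral_mxm_shift.
Qed.

End translation.

(** The other entries may have infinite mass: the product still vanishes, since [0 * +oo = 0] in the
    extended reals. *)
Lemma mxm_entry_null m n (mu : family m n) i j (N : set RR) : measurable N ->
  mu i j N = 0 -> mxm mu [set x | N (x i j)] = 0.
Proof.
move=> mN N0; pose A i' j' := if (i' == i) && (j' == j) then N else setT.
transitivity (mxm mu (mxrect A)).
  congr (mxm mu _).
  apply/seteqP; split => x /=; last by move/(_ i j); rewrite /A !eqxx.
  by move=> Nx i' j'; rewrite /A; case: ifP => // /andP[/eqP -> /eqP ->].
rewrite mxm_rect => [|i' j']; last by rewrite /A; case: ifP.
by rewrite (bigD1 i)//= (bigD1 j)//= /A !eqxx/= N0 !mul0e.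
Qed.

Lemma mxm_ae m n (mu : family m n) (P : 'I_m -> 'I_n -> set RR) :
  (forall i j, {ae mu i j, forall x, P i j x}) ->
  {ae mxm mu, forall x : 'M[R]_(m, n), forall i j, P i j (x i j)}.
Proof.
move=> H; apply: filter_forall => i; apply: filter_forall => j.
have [N [mN N0 NP]] := H i j; exists [set x : 'M[R]_(m, n) | N (x i j)]; split.
- by have := measurable_entry i j measurableT mN; rewrite setTI.
- exact: mxm_entry_null.
- by move=> x; exact: NP.
Qed.

End product_integrals.

(** * Blocks and margins as coordinates on matrices *)

Section boundary_coordinates.
Context (R : realType) (m n : nat).
Local Notation RR := (measurableTypeR R).
Local Notation blk := 'M[R]_(m, n).
Local Notation mat := 'M[R]_(m.+1, n.+1).
Local Notation marg := ('rV[R]_m.+1 * 'rV[R]_n.+1)%type.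
Local Notation red := ('rV[R]_m * 'rV[R]_n.+1)%type.

Lemma big_ord_corner (T : Type) (idx : T) (op : Monoid.com_law idx)
    (F : 'I_m.+1 -> 'I_n.+1 -> T) :
  \big[op/idx]_i \big[op/idx]_j F i j =
  op (\big[op/idx]_(i < m) \big[op/idx]_(j < n) F (lift ord_max i) (lift ord_max j))
     (op (\big[op/idx]_(i < m) F (lift ord_max i) ord_max) (\big[op/idx]_j F ord_max j)).
Proof.
rewrite (bigD1_ord ord_max)//=.
under [X in op _ X]eq_bigr do rewrite (bigD1_ord ord_max)//=.
by rewrite big_split /= [LHS]Monoid.mulmC [X in op X _ = _]Monoid.mulmC -Monoid.mulmA.
Qed.

(* The matrix with block [yb], last column [z.1] above the corner, and last
   row [z.2]. *)
Definition border (yb : blk) (z : red) : mat :=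
  \matrix_(i, j)
    match unlift ord_max i, unlift ord_max j with
    | Some i', Some j' => yb i' j'
    | Some i', None => z.1 ord0 i'
    | None, _ => z.2 ord0 j
    end.

Lemma border_block yb z i j : border yb z (lift ord_max i) (lift ord_max j) = yb i j.
Proof. by rewrite mxE !liftK. Qed.

Lemma border_col yb z i : border yb z (lift ord_max i) ord_max = z.1 ord0 i.
Proof. by rewrite mxE liftK unlift_none. Qed.

Lemma border_row yb z j : border yb z ord_max j = z.2 ord0 j.
Proof. by rewrite mxE unlift_none. Qed.

Lemma block_border yb z : block (border yb z) = yb.
Proof. by apply/matrixP => i j; rewrite !mxE !liftK. Qed.

Lemma splice_border yb yb' z : splice yb (border yb' z) = border yb z.
Proof.
by apply/matrixP => i j; rewrite !mxE; case: (unlift _ i); case: (unlift _ j).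
Qed.

Lemma measurable_border d (T : measurableType d) (f : T -> blk) (g : T -> red) :
  measurable_fun setT f -> measurable_fun setT g ->
  measurable_fun setT (fun t => border (f t) (g t)).
Proof.
move=> mf mg; apply: measurable_mx => i j.
case: (unliftP ord_max i) => [i'|] ->; last first.
  under eq_fun do rewrite border_row.
  by apply: (measurableT_comp (measurable_entry _ _)); exact: measurableT_comp mg.
case: (unliftP ord_max j) => [j'|] ->; last first.
  under eq_fun do rewrite border_col.
  by apply: (measurableT_comp (measurable_entry _ _)); exact: measurableT_comp mg.
under eq_fun do rewrite border_block.
exact: (measurableT_comp (measurable_entry _ _)).
Qed.

Definition row_sums (yb : blk) : 'rV[R]_m := \row_i \sum_j yb i j.

(** Column sums over the first [m] rows. In the last column these rows contain the entries [u],
    which the row sums have already determined. *)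
Definition border_shift (yb : blk) (u : 'rV[R]_m) : 'rV[R]_n.+1 :=
  \row_j if unlift ord_max j is Some j' then \sum_i yb i j' else \sum_i u ord0 i.

(** The border is solved in triangular order: the row sums give the last column above the corner,
    then the column sums give the last row. Hence, for a fixed block, each of the two steps is a
    translation. *)
Definition last_border (s : red) (yb : blk) : red :=
  let u := s.1 - row_sums yb in (u, s.2 - border_shift yb u).

Definition gam (s : red) (yb : blk) : mat := border yb (last_border s yb).

(** Row sums and column sums have the same total, which restores the omitted row sum. *)
Definition full_margin (s : red) : 'rV[R]_m.+1 * 'rV[R]_n.+1 :=
  (\row_i (if unlift ord_max i is Some i' then s.1 ord0 i'
           else \sum_j s.2 ord0 j - \sum_i' s.1 ord0 i'), s.2).

Lemma reduced_full_margin s : reduced (full_margin s) = s.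
Proof.
case: s => r c; rewrite /reduced /full_margin; congr (_, _).
by apply/rowP => i; rewrite !mxE liftK.
Qed.

Lemma full_marginK (t : marg) : \sum_i t.1 ord0 i = \sum_j t.2 ord0 j -> full_margin (reduced t) = t.
Proof.
case: t => r c /= rc; rewrite /full_margin /reduced /=; congr (_, _).
apply/rowP => i; rewrite !mxE; case: (unliftP ord_max i) => [i'|] ->.
  by rewrite mxE.
rewrite -rc (bigD1_ord ord_max)//=.
by under [X in _ - X]eq_bigr do rewrite mxE; rewrite addrK.
Qed.

(** No compatibility of [t] is required, because [Gamma] never reads the last row sum: its corner
    entry is computed from the other row sums and the last column sum. *)
Lemma gam_Gamma (t : marg) (yb : blk) : Gamma t yb = gam (reduced t) yb.
Proof.
apply/matrixP => i j; rewrite [LHS]mxE.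
case: (unliftP ord_max i) => [i'|] ->; case: (unliftP ord_max j) => [j'|] ->.
- by rewrite border_block.
- by rewrite border_col !mxE.
- by rewrite border_row !mxE liftK.
- rewrite border_row !mxE unlift_none /=.
  under [X in _ = _ - X]eq_bigr do rewrite !mxE.
  by rewrite sumrB opprB [RHS]addrC.
Qed.

Lemma margin_gam s yb : margin (gam s yb) = full_margin s.
Proof.
have col j : \sum_i gam s yb i j = s.2 ord0 j.
  rewrite (bigD1_ord ord_max)//= border_row !mxE.
  case: (unliftP ord_max j) => [j'|] ->.
    under eq_bigr do rewrite border_block.
    by rewrite subrK.
  under [X in _ + X]eq_bigr do rewrite border_col.
  by rewrite subrK.
have row i : \sum_j gam s yb (lift ord_max i) j = s.1 ord0 i.
  rewrite (bigD1_ord ord_max)//= border_col !mxE.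
  by under [X in _ + X]eq_bigr do rewrite border_block; rewrite subrK.
rewrite /margin /full_margin; congr (_, _); last first.
  by apply/rowP => j; rewrite !mxE col.
apply/rowP => i; rewrite !mxE; case: (unliftP ord_max i) => [i'|] ->.
  by rewrite row.
apply/esym/eqP; rewrite subr_eq; apply/eqP.
have -> : \sum_j s.2 ord0 j = \sum_i \sum_j gam s yb i j.
  by rewrite exchange_big; apply: eq_bigr => j _; rewrite col.
rewrite (bigD1_ord ord_max)//=; congr (_ + _).
by apply: eq_bigr => k _; rewrite row.
Qed.

End boundary_coordinates.

Section change_of_coordinates.
Local Open Scope ereal_scope.
Context (R : realType) (m n : nat).
Local Notation RR := (measurableTypeR R).
Local Notation sfm := {sigma_finite_measure set RR -> \bar R}.
Local Notation blk := 'M[R]_(m, n).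
Local Notation mat := 'M[R]_(m.+1, n.+1).
Local Notation red := ('rV[R]_m * 'rV[R]_n.+1)%type.

Definition block_family T (mu : 'I_m.+1 -> 'I_n.+1 -> T) (i : 'I_m) (j : 'I_n) :=
  mu (lift ord_max i) (lift ord_max j).

Definition col_family T (mu : 'I_m.+1 -> 'I_n.+1 -> T) (i : 'I_m) :=
  mu (lift ord_max i) ord_max.

Definition border_measure (mu : 'I_m.+1 -> 'I_n.+1 -> sfm) :=
  prodm (rvm (col_family mu)) (rvm (mu ord_max)).

(** Block, last column and last row are disjoint groups of entries, so the measure of a rectangle
    factors along them; uniqueness on rectangles extends this to all integrals. *)
Lemma ge0_integral_border (mu : 'I_m.+1 -> 'I_n.+1 -> sfm) (F : mat -> \bar R) :
  measurable_fun setT F -> (forall x, 0 <= F x) ->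
  \int[mxm mu]_x F x =
  \int[mxm (block_family mu)]_yb \int[border_measure mu]_z F (border yb z).
Proof.
move=> mF F0.
have mb : measurable_fun setT (fun t : blk * red => border t.1 t.2).
  exact: measurable_border.
pose P := prodm (mxm (block_family mu)) (border_measure mu).
have PE E : measurable E -> mxm mu E = push P mb E.
  apply: (mxrect_unique (mu := mu)) => A mA; first exact: mxm_rect.
  rewrite /= /push /pushforward.
  have -> : (fun t : blk * red => border t.1 t.2) @^-1` mxrect A =
      mxrect (block_family A) `*`
      (mxrect (fun=> col_family A) `*` mxrect (fun=> A ord_max)).
    apply/seteqP; split => [[yb [u w]] /= h|[yb [u w]] /= [hb [hc hr]] i j].
      split; [|split] => i j.
      - by have := h (lift ord_max i) (lift ord_max j); rewrite border_block.
      - by have := h (lift ord_max j) ord_max; rewrite border_col (ord1 i).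
      - by have := h ord_max j; rewrite border_row (ord1 i).
    case: (unliftP ord_max i) => [i'|] ->; last first.
      by rewrite border_row; exact: (hr ord0).
    case: (unliftP ord_max j) => [j'|] ->; last first.
      by rewrite border_col; exact: (hc ord0).
    by rewrite border_block; exact: hb.
  have mAb := measurable_mxrect (fun i j => mA (lift ord_max i) (lift ord_max j)).
  have mAc := @measurable_mxrect _ 1 m (fun=> col_family A) (fun _ i => mA _ _).
  have mAr := @measurable_mxrect _ 1 n.+1 (fun=> A ord_max) (fun _ j => mA _ _).
  apply: etrans; first exact: (prodm_setX _ _ mAb (measurableX mAc mAr)).
  rewrite big_ord_corner mxm_rect; last by move=> i j; exact: mA.
  congr (_ * _); apply: etrans; first exact: (prodm_setX _ _ mAc mAr).
  by rewrite !rvm_rect// => i j; exact: mA.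
rewrite (eq_measure_integral (push P mb)); last by move=> E mE _; exact: PE.
rewrite ge0_integral_push// ge0_integral_prodm//.
exact: (measurableT_comp mF mb).
Qed.

Variables (Z : sfm) (L : set RR).
Hypotheses (L0 : L 0%R) (LB : forall a b : RR, L a -> L b -> L (a - b)%R).
Hypothesis ZL : forall a A, L a -> measurable A ->
  Z ((fun x : RR => x - a)%R @^-1` A) = Z A.
Hypothesis LZ : {ae Z, forall x, L x}.

Let LD a b : L a -> L b -> L (a + b)%R.
Proof. by move=> La Lb; rewrite -[b]opprK -[X in (a - X)%R]sub0r; apply/LB/LB. Qed.

Lemma lattice_sum (I : finType) (f : I -> R) : (forall i, L (f i)) -> L (\sum_i f i)%R.
Proof. by move=> Lf; elim/big_ind : _ => //; exact: LD. Qed.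

Definition red_measure := prodm (rvm (fun _ : 'I_m => Z)) (rvm (fun _ : 'I_n.+1 => Z)).

Lemma measurable_last_border d (T : measurableType d) (s : T -> red) (yb : T -> blk) :
  measurable_fun setT s -> measurable_fun setT yb ->
  measurable_fun setT (fun t => last_border (s t) (yb t)).
Proof.
move=> ms my.
have me i j : measurable_fun setT (fun t => yb t i j : RR).
  exact: (measurableT_comp (measurable_entry _ _) my).
have m1 i j : measurable_fun setT (fun t => (s t).1 i j : RR).
  by apply: (measurableT_comp (measurable_entry _ _)); exact: measurableT_comp ms.
have m2 i j : measurable_fun setT (fun t => (s t).2 i j : RR).
  by apply: (measurableT_comp (measurable_entry _ _)); exact: measurableT_comp ms.
have mu i : measurable_fun setT (fun t => ((s t).1 - row_sums (yb t))%R ord0 i : RR).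
  under eq_fun do rewrite !mxE.
  by apply: measurable_funB; [exact: m1|apply: measurable_sum => j; exact: me].
apply: measurable_fun_pair.
  by apply: measurable_mx => i j; rewrite (ord1 i); exact: mu.
apply: measurable_mx => i j; rewrite (ord1 i).
under eq_fun do rewrite [X in X _ _]/= mxE [X in (_ + X)%R]mxE [in X in (_ + X)%R]mxE.
apply: measurable_funB; first exact: m2.
by case: unlift => [j'|]; apply: measurable_sum => k; [exact: me|exact: mu].
Qed.

Lemma measurable_gam d (T : measurableType d) (s : T -> red) (yb : T -> blk) :
  measurable_fun setT s -> measurable_fun setT yb ->
  measurable_fun setT (fun t => gam (s t) (yb t)).
Proof. by move=> ms my; apply: measurable_border => //; exact: measurable_last_border. Qed.

(* For a fixed block, the margin is a translate of the border. *)
Lemma ge0_integral_last_border (yb : blk) (H : red -> \bar R) :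
  (forall i j, L (yb i j)) -> measurable_fun setT H -> (forall z, 0 <= H z) ->
  \int[red_measure]_z H z = \int[red_measure]_s H (last_border s yb).
Proof.
move=> Ly mH H0.
have mHb : measurable_fun setT (fun s => H (last_border s yb)).
  by apply: (measurableT_comp mH); exact: measurable_last_border.
have Hb0 s : 0 <= H (last_border s yb) by [].
rewrite (ge0_integral_prodm _ _ mH H0) (ge0_integral_prodm _ _ mHb Hb0).
pose K u := \int[rvm (fun _ : 'I_n.+1 => Z)]_w H (u, w).
have mK : measurable_fun setT K by exact: measurable_fun_fubini_tonelli_F.
have K0 u : 0 <= K u by apply: integral_ge0.
have Lr i j : L (row_sums yb i j) by rewrite mxE; exact: lattice_sum.
(* The outer variable is translated by the row sums of the block; the inner one is translated below,
   for each fixed value [u] of the outer one. *)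
rewrite -(ge0_integral_rvm_shift ZL Lr mK K0).
rewrite !integral_rvm_mxm; apply: ge0_ae_eq_integral => //.
- by apply: (measurableT_comp mK); exact: measurable_mx_sub.
- exact: (measurable_fun_fubini_tonelli_F (fun s => H (last_border s yb))).
- by move=> u _; apply: integral_ge0.
(* The shift at the corner involves the sum of the entries of [u], which lies in [L] only for almost
   every [u]; the inner integrals are therefore compared almost everywhere. *)
have : {ae mxm (fun _ : 'I_1 => fun _ : 'I_m => Z),
    forall u : 'rV[R]_m, forall i j, L (u i j)}.
  exact: (@mxm_ae _ _ _ _ (fun _ _ => L) (fun _ _ => LZ)).
apply: filterS => u Lu _; rewrite /K /last_border /=.
apply/esym; apply: (@ge0_integral_rvm_shift _ _ _ ZL _ (border_shift yb (u - row_sums yb)%R)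
  (fun w => H ((u - row_sums yb)%R, w))) => //.
- move=> i j; rewrite mxE; case: unlift => [j'|]; first exact: lattice_sum.
  by apply: lattice_sum => k; rewrite mxE [X in (_ + X)%R]mxE; exact: LB.
- exact: (measurableT_comp mH).
Qed.

(** For almost every block the entries lie in [L], and the inner integral over borders becomes one
    over reduced margins; Tonelli then puts the margin outside. *)
Lemma ge0_integral_gam (F : mat -> \bar R) :
  measurable_fun setT F -> (forall x, 0 <= F x) ->
  \int[mxm (fun _ _ => Z)]_x F x =
  \int[red_measure]_s \int[mxm (fun _ _ => Z)]_yb F (gam s yb).
Proof.
move=> mF F0; rewrite ge0_integral_border//.
have mFb : measurable_fun setT (fun t : blk * red => F (border t.1 t.2)).
  by apply: (measurableT_comp mF); exact: measurable_border.
have mFg : measurable_fun setT (fun t : blk * red => F (gam t.2 t.1)).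
  by apply: (measurableT_comp mF); exact: measurable_gam.
have Fg0 (t : blk * red) : 0 <= F (gam t.2 t.1) by [].
apply: (etrans _ (fubini_tonelli (m1 := mxm (fun _ _ => Z)) (m2 := red_measure) _ mFg Fg0)).
apply: ge0_ae_eq_integral => //.
- exact: (measurable_fun_fubini_tonelli_F _ mFb).
- exact: (measurable_fun_fubini_tonelli_F _ mFg).
- by move=> u _; apply: integral_ge0.
- by move=> u _; apply: integral_ge0.
have : {ae mxm (fun _ : 'I_m => fun _ : 'I_n => Z),
    forall yb : blk, forall i j, L (yb i j)}.
  exact: (@mxm_ae _ _ _ _ (fun _ _ => L) (fun _ _ => LZ)).
apply: filterS => yb Ly _.
apply: (ge0_integral_last_border (H := fun z => F (border yb z)) Ly) => //.
by apply: (measurableT_comp mF); exact: measurable_border.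
Qed.

End change_of_coordinates.

(** * The reference measures *)

Section reference_measure.
Local Open Scope ereal_scope.
Context (R : realType).
Local Notation RR := (measurableTypeR R).

Lemma counting_card_eq (A B : set RR) : (A #= B)%card ->
  counting A = counting B :> \bar R.
Proof.
move=> AB; rewrite /counting (eq_finite_set AB).
case: asboolP => // fB.
have fA : finite_set A by rewrite (eq_finite_set AB).
by congr (_%:R%:E); apply/fcard_eq.
Qed.

Definition integers : set RR := range (fun k : int => k%:~R : RR).

Lemma measurable_integers : measurable integers.
Proof.
apply: countable_measurable; first exact: measurable_set1.
exact: (card_le_trans (card_image_le _ _) (countableP _)).
Qed.

Definition lattice (discrete : bool) : set RR := if discrete then integers else setT.

Lemma measurable_lattice discrete : measurable (lattice discrete).
Proof. by case: discrete => /=; [exact: measurable_integers|exact: measurableT]. Qed.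

Lemma lattice0 discrete : lattice discrete 0%R.
Proof. by case: discrete => //=; exists 0%R. Qed.

Lemma latticeB discrete (a b : RR) : lattice discrete a -> lattice discrete b ->
  lattice discrete (a - b)%R.
Proof.
by case: discrete => //= -[k _ <-] [l _ <-]; exists (k - l)%R; rewrite // intrB.
Qed.

Lemma sigma_finite_counting_integers :
  sigma_finite setT (mrestr (@counting RR R) measurable_integers).
Proof.
(* The exhausting sets must cover the whole line: [F k] contains every non-integer, which has no
   mass, and the integers of absolute value less than [k]. *)
pose F k : set RR := [set x | integers x -> x \in [seq (i%:~R : RR) | i : int <-
  [seq (j%:Z) | j <- iota 0 k] ++ [seq - (j%:Z) | j <- iota 0 k]]%R].
exists F => [|k].
  apply/seteqP; split => // x _.
  have [[i _ <-]|nx] := pselect (integers x); last by exists 0%N.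
  exists `|i|%N.+1 => // _; apply: map_f; rewrite mem_cat; apply/orP.
  case: i => i; [left|right]; apply/mapP.
    by exists i => //; rewrite mem_iota /= add0n.
  by exists i.+1; rewrite ?NegzE// mem_iota /= add0n.
have fF : finite_set (F k `&` integers).
  by apply: (@sub_finite_set _ _ [set` [seq (i%:~R : RR) | i : int <-
  [seq (j%:Z) | j <- iota 0 k] ++ [seq - (j%:Z) | j <- iota 0 k]]%R]) => // x [Fx /Fx].
split; last by rewrite /mrestr /counting asboolT// ltry.
rewrite (_ : F k = (F k `&` integers) `|` ~` integers); last first.
  apply/seteqP; split => x /=; first by have [|] := pselect (integers x); [left|right].
  by case=> [[]//|nx /nx].
apply: measurableU; last exact: (measurableC measurable_integers).
by apply: countable_measurable; [exact: measurable_set1|exact: finite_set_countable].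
Qed.

Lemma zeta_sfm discrete :
  {Q : {sigma_finite_measure set RR -> \bar R} | (Q : set _ -> _) = zeta discrete}.
Proof.
case: discrete; last by exists (@lebesgue_measure R).
have [Q QE] := sfm_of_measure sigma_finite_counting_integers.
by exists Q; rewrite QE.
Qed.

Definition zetam discrete := projT1 (zeta_sfm discrete).

Lemma zetamE discrete : (zetam discrete : set _ -> _) = zeta discrete.
Proof. exact: (projT2 (zeta_sfm discrete)). Qed.

(** Translation by an integer permutes the integers, which preserves cardinals. In the Lebesgue
    case, the translated measure agrees with Lebesgue measure on half-open intervals, which
    determine it. *)
Lemma zetam_shift discrete (a : RR) (A : set RR) : lattice discrete a -> measurable A ->
  zetam discrete ((fun x : RR => x - a)%R @^-1` A) = zetam discrete A.
Proof.
rewrite zetamE; case: discrete => /= [[k _ ka] _|_ mA].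
  apply: counting_card_eq; rewrite card_eq_sym.
  have -> : A `&` integers = (fun x : RR => x - a)%R @`
      ((fun x : RR => x - a)%R @^-1` A `&` integers).
    apply/seteqP; split => [x [Ax [l _ lx]]|_ [x [/= Ax [l _ lx]] <-]]; last first.
      by split => //; exists (l - k)%R => //; rewrite intrB ka lx.
    exists (x + a)%R; last by rewrite addrK.
    by rewrite /= addrK; split => //; exists (l + k)%R => //; rewrite intrD ka lx.
  by apply: inj_card_eq => x y _ _ /addIr.
have mf : @measurable_fun _ _ RR RR setT (fun x : RR => x - a)%R by exact: measurable_funB.
transitivity (push lebesgue_measure mf A); first by [].
apply/esym; rewrite /zeta; refine (@lebesgue_measure_unique R (push lebesgue_measure mf) _ A mA) => _ [[b c] _ <-].
rewrite /= /push /pushforward.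
have -> : (fun x : RR => x - a)%R @^-1` `]b, c] = `](b + a)%R, (c + a)%R]%classic.
  by apply/seteqP; split => x /=; rewrite !in_itv /= ltrBrDr lerBlDr.
by rewrite !lebesgue_measure_itv /= !lte_fin ltrD2r -!EFinB opprD addrACA subrr addr0.
Qed.

Lemma zetam_lattice discrete : {ae zetam discrete, forall x, lattice discrete x}.
Proof.
exists (~` lattice discrete); split => //; first exact: (measurableC (measurable_lattice _)).
rewrite zetamE; case: discrete => /=; last by rewrite setCT measure0.
by rewrite setICl /counting asboolT// fset_set0.
Qed.

Lemma zetam_set1 (x : RR) : integers x -> zetam true [set x] = 1.
Proof.
move=> Zx; rewrite zetamE /zeta setIidl; last by move=> _ ->.
by rewrite /counting asboolT// fset_set1 finmap.cardfs1.
Qed.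

Lemma zetam_open (U : set R) : open U -> U !=set0 -> 0 < zetam false U.
Proof.
move=> oU [x Ux]; rewrite zetamE /=.
have := open_itvoo_subset oU Ux => -[e /= e0 eU].
have e2 : (0 < e / 2)%R by rewrite divr_gt0.
have h : `](x - e / 2)%R, (x + e / 2)%R[%classic `<=` U.
  apply: eU => //=; rewrite sub0r normrN gtr0_norm//.
  by rewrite ltr_pdivrMr// ltr_pMr// ltr1n.
apply: (@lt_le_trans _ _ (lebesgue_measure `](x - e / 2)%R, (x + e / 2)%R[%classic)); last first.
  by apply: le_measure; rewrite ?inE//; exact: open_measurable.
have xe : (x - e / 2 < x + e / 2)%R by rewrite ltrBlDr -addrA ltrDl addr_gt0.
by rewrite lebesgue_measure_itv /= lte_fin xe -EFinB lte_fin subr_gt0.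
Qed.

End reference_measure.

(** * Exponential tilts and the choice of the density *)

Section exponential_tilt.
Local Open Scope ereal_scope.
Context (R : realType).
Local Notation RR := (measurableTypeR R).

(** An exhaustion for [Z] is cut at the levels [f <= k], where the new mass is at most [k] times the
    old one. *)
Lemma sigma_finite_dens d (T : measurableType d)
    (Z : {sigma_finite_measure set T -> \bar R}) (f : T -> R)
    (mf : measurable_fun setT f) (f0 : forall x, (0 <= f x)%R) :
  sigma_finite setT (dens Z mf f0).
Proof.
have /sigma_finiteP[F [FT ndF Foo]] := sigma_finiteT Z.
have mG k : measurable [set x | (f x <= k%:R)%R].
  by rewrite -[X in measurable X]setTI; apply: measurable_fun_le => //; exact: measurable_cst.
exists (fun k => F k `&` [set x | (f x <= k%:R)%R]) => [|k].
  apply/seteqP; split => // x _; have : [set: T] x by [].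
  rewrite FT => -[i _ Fx]; exists (maxn i (Num.truncn (f x)).+1) => //; split.
    by have /subsetPset := ndF _ _ (leq_maxl i (Num.truncn (f x)).+1); exact.
  by apply/ltW; apply: (lt_le_trans (truncnS_gt _)); rewrite ler_nat leq_maxr.
have [mF Fk] := Foo k; split; first exact: measurableI.
rewrite /dens; apply: (@le_lt_trans _ _ (k%:R%:E * Z (F k `&` [set x | (f x <= k%:R)%R]))).
  rewrite -integral_cst//; last exact: measurableI.
  apply: ge0_le_integral => //; first exact: measurableI.
  - by move=> x _; rewrite lee_fin.
  - exact/measurable_EFinP/measurable_funTS.
  - by move=> x [].
rewrite lte_mul_pinfty ?lee_fin//.
by apply: le_lt_trans Fk; apply: le_measure; rewrite ?inE//; exact: measurableI.
Qed.

Lemma ge0_integral_eq0_ae d (T : measurableType d) (P : {measure set T -> \bar R})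
    (f : T -> \bar R) : measurable_fun setT f -> (forall x, 0 <= f x) ->
  \int[P]_x f x = 0 -> {ae P, forall x, f x = 0}.
Proof.
move=> mf f0 If; have : \int[P]_x `|f x| = 0.
  by under eq_integral => x _ do rewrite gee0_abs//.
by move/(ae_eq_integral_abs P measurableT mf); apply: filterS => x; exact.
Qed.

Lemma integral_gt0 d (T : measurableType d) (P : {measure set T -> \bar R}) (E : set T)
    (f : T -> \bar R) : measurable E -> measurable_fun setT f -> (forall x, 0 <= f x) ->
  (forall x, E x -> 0 < f x) -> 0 < P E -> 0 < \int[P]_x f x.
Proof.
move=> mE mf f0 fE PE; rewrite lt_neqAle integral_ge0// andbT eq_sym.
apply/negP => /eqP /(ge0_integral_eq0_ae mf f0) [N [mN N0 NP]].
suff : P E <= 0 by rewrite leNgt PE.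
rewrite -N0; apply: le_measure; rewrite ?inE// => x Ex; apply: NP => /= fx.
by have := fE x Ex; rewrite fx ltxx.
Qed.

Variable mu : {sigma_finite_measure set RR -> \bar R}.

Definition etilt (theta : R) (x : RR) : R := expR (theta * x - psi mu theta).

Lemma measurable_etilt theta : measurable_fun setT (etilt theta).
Proof.
apply: measurableT_comp; first exact: measurable_expR.
by apply: measurable_funB => //; exact: measurable_funM.
Qed.

Lemma etilt_ge0 theta x : (0 <= etilt theta x)%R. Proof. exact: expR_ge0. Qed.

(** Sigma-finiteness holds for every real [theta], also outside [Theta] where [psi] takes a default
    value, so the family is total in [theta]. *)
Definition tiltm theta := sfm_copy (sigma_finite_dens mu (measurable_etilt theta) (etilt_ge0 theta)).

Lemma tiltmE theta : (tiltm theta : set _ -> _) = tilt mu theta.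
Proof. by []. Qed.

Lemma is_density_tilt theta : is_density (tilt mu theta) mu (etilt theta).
Proof. by split; [exact: measurable_etilt|exact: etilt_ge0|]. Qed.

Let measurable_expM theta : measurable_fun setT (fun x : RR => (expR (theta * x))%:E).
Proof.
apply/measurable_EFinP; apply: measurableT_comp; first exact: measurable_expR.
exact: measurable_funM.
Qed.

Lemma laplace_gt0 theta : mu setT != 0 -> 0 < \int[mu]_x (expR (theta * x))%:E.
Proof.
move=> mu0; have muT : 0 < mu setT by rewrite lt0e mu0/=.
apply: (integral_gt0 measurableT _ _ _ muT) => // x _.
by rewrite lte_fin expR_gt0.
Qed.

Lemma tilt_setT theta : Theta mu theta -> mu setT != 0 -> tilt mu theta setT = 1.
Proof.
move=> Tt mu0; rewrite /tilt.
under eq_integral do rewrite expRD mulrC EFinM.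
rewrite ge0_integralZl ?lee_fin ?expR_ge0//.
have L0 := laplace_gt0 theta mu0; rewrite expRN lnK; last first.
  by rewrite posrE fine_gt0// L0.
have Lfin : \int[mu]_x (expR (theta * x))%:E \is a fin_num by rewrite ge0_fin_numE// ltW.
rewrite -[X in _ * X]fineK// -EFinM mulVf//.
by rewrite gt_eqF// fine_gt0// L0.
Qed.

(** Unlike the equality, this bound includes the zero measure, all of whose tilts vanish. *)
Lemma tilt_setT_le1 theta : Theta mu theta -> tilt mu theta setT <= 1.
Proof.
move=> Tt; have [mu0|mu0] := eqVneq (mu setT) 0; last by rewrite tilt_setT.
have [m1 _ _] := is_density_tilt theta.
by rewrite /tilt null_set_integral//; exact/measurable_EFinP.
Qed.

(** Dominated convergence: for [t] between [u] and [v], [expR (t * x)] is at most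
    [expR (u * x) + expR (v * x)], whichever the sign of [x]. This yields the regularity in [ab]
    demanded of density families. *)
Lemma psi_continuous theta : interior (Theta mu) theta -> {for theta, continuous (psi mu)}.
Proof.
(* For the zero measure [psi] is constant, whereas continuity of the logarithm at the Laplace
   transform requires a positive value. *)
have [mu0|mu0] := eqVneq (mu setT) 0.
  move=> _; have -> : psi mu = cst (psi mu 0%R); last exact: cst_continuous.
  apply/funext => t; rewrite /psi; congr (ln (fine _)).
  by rewrite !null_set_integral.
move=> [e /= e0 eT].
have e2 : (0 < e / 2)%R by rewrite divr_gt0.
(* Half the radius keeps both endpoints inside the ball contained in [Theta], so the dominating
   function is integrable. *)
pose u := (theta - e / 2)%R; pose v := (theta + e / 2)%R.
have Tu : Theta mu u.
  apply: eT; rewrite /ball_/= /u opprB addrC subrK gtr0_norm//.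
  by rewrite ltr_pdivrMr// ltr_pMr// ltr1n.
have Tv : Theta mu v.
  apply: eT; rewrite /ball_/= /v opprD addrA subrr sub0r normrN gtr0_norm//.
  by rewrite ltr_pdivrMr// ltr_pMr// ltr1n.
pose g (x : RR) := (expR (u * x) + expR (v * x))%R.
have iexp t : Theta mu t -> mu.-integrable setT (EFin \o (fun x : RR => expR (t * x))).
  move=> Tt; apply/integrableP; split; first exact: measurable_expM.
  rewrite (eq_integral (fun x : RR => (expR (t * x))%:E)) => [//|x _].
  by rewrite /= ger0_norm ?expR_ge0.
have ig : mu.-integrable setT (EFin \o g).
  have := integrableD measurableT (iexp _ Tu) (iexp _ Tv).
  by apply: eq_integrable.
have gub t x : (u < t < v)%R -> (expR (t * x) <= g x)%R.
  move=> /andP[ut tv]; have [x0|x0] := lerP 0%R x.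
    rewrite (@le_trans _ _ (expR (v * x)))// ?lerDr ?expR_ge0//.
    by rewrite ler_expR ler_wpM2r// ltW.
  rewrite (@le_trans _ _ (expR (u * x)))// ?lerDl ?expR_ge0//.
  by rewrite ler_expR ler_wnM2r// ltW.
have ltuv : (u < theta < v)%R by rewrite /u /v ltrBlDr !ltrDl e2.
have cL : {for theta, continuous (fun t : R => \int[mu]_(x in setT) expR (t * x))%R}.
  have := @continuity_under_integral R _ RR mu (fun t x => expR (t * x)) setT measurableT u v.
  move=> /(_ _ _ g ig); apply.
  - move=> t /=; rewrite in_itv/= => tuv; apply: (le_integrable measurableT _ _ ig) => [|x _].
      exact: measurable_expM.
    by rewrite /= lee_fin !ger0_norm ?expR_ge0 ?addr_ge0 ?expR_ge0//; exact: gub.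
  - apply: aeW => x _ t _ /=.
    apply: continuous_comp; last exact: continuous_expR.
    by apply: (@continuousM _ R (id) (cst x)); [exact: cvg_id|exact: cst_continuous].
  - move=> t; rewrite /= in_itv/= => tuv; apply: aeW => x _.
    by rewrite ger0_norm ?expR_ge0//; exact: gub.
  - by rewrite inE /= in_itv.
have L0 : (0 < \int[mu]_(x in setT) expR (theta * x))%R.
  have T0 : Theta mu theta by apply: eT; rewrite /ball_ /= subrr normr0.
  by rewrite /Rintegral fine_gt0// laplace_gt0.
have := continuous_comp cL (continuous_ln L0).
exact.
Qed.

End exponential_tilt.

Lemma ae_forall_count d (T : measurableType d) (R : realType) (P : {measure set T -> \bar R})
    (I : countType) (Q : I -> T -> Prop) :
  (forall i, {ae P, forall x, Q i x}) -> {ae P, forall x, forall i, Q i x}.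
Proof.
move=> H; have : {ae P, forall x, forall k, if unpickle k is Some i then Q i x else True}.
  by apply/ae_foralln => k; case: (unpickle k) => [i|]; [exact: H|exact: aeW].
by apply: filterS => x Hx i; have := Hx (pickle i); rewrite pickleK.
Qed.

(** * Supports and a pointwise version of the density *)

Section density_version.
Context (R : realType).
Local Notation RR := (measurableTypeR R).
Variables (mu : {sigma_finite_measure set RR -> \bar R}) (discrete : bool) (p : R -> R).
Hypothesis hp : is_density mu (@zeta R discrete) p.
Hypothesis hopen : ~~ discrete -> open [set x | 0 < p x].
Local Notation Z := (zetam R discrete).

Let mp : @measurable_fun _ _ RR RR setT p. Proof. by have [] := hp. Qed.
Let p0 x : 0 <= p x. Proof. by have [_ + _] := hp; exact. Qed.
Let muE E : measurable E -> mu E = (\int[Z]_(x in E) (p x)%:E)%E.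
Proof. by rewrite zetamE; have [_ _] := hp; apply. Qed.

Let measurable_gt c : measurable [set x : RR | c < p x].
Proof.
have -> : [set x : RR | c < p x] = p @^-1` `]c, +oo[.
  by apply/seteqP; split => x; rewrite /= in_itv/= andbT.
by rewrite -[X in measurable X]setTI; apply: mp => //; exact: measurable_itv.
Qed.

Lemma msupp_meets x (U : set R) : msupp mu x -> open U -> U x ->
  exists y, [/\ U y, lattice discrete y & 0 < p y].
Proof.
move=> sx oU Ux; apply: contrapT => h.
have mU : measurable (U : set RR) by exact: open_measurable.
have := sx U oU Ux; rewrite muE//= (_ : integral _ _ _ = 0%E) ?ltxx//.
rewrite integral_mkcond; rewrite -[RHS](@integral0 _ _ R Z setT).
apply: ae_eq_integral => //.
  by apply/(measurable_restrict _ _ _) => //; exact/measurable_EFinP/measurable_funTS.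
apply: filterS (zetam_lattice R discrete) => y Ly _ /=.
rewrite patchE; case: ifPn => //; rewrite inE => Uy.
congr (_%:E); apply/eqP; rewrite eq_le p0 andbT leNgt; apply/negP => py.
by apply: h; exists y.
Qed.

(** The point [x] is arbitrary: if it is not an integer, the gap between consecutive integers around
    it contains none, and the last clause is vacuous. Applied to a support point, this forces the
    point to be an integer. *)
Lemma integers_isolated (x : R) : exists U : set R,
  [/\ open U, U x & forall y, integers y -> U y -> y = x].
Proof.
have [xf|xf] := eqVneq x (Num.floor x)%:~R.
  exists `]x - 1, x + 1[%classic; split; first exact: itv_open.
    by rewrite /= in_itv/= ltrDl ltr01 ltrBlDr ltrDl ltr01.
  move=> _ [k _ <-]; rewrite /= in_itv/= xf => /andP[].
  rewrite -[1]/(1%:~R) -intrB -intrD !ltr_int ltrBlDr !ltzD1 => h1 h2; congr (_%:~R).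
  by apply/eqP; rewrite eq_le h1 h2.
exists `](Num.floor x)%:~R, (Num.floor x + 1)%:~R[%classic; split; first exact: itv_open.
  by rewrite /= in_itv/= floorD1_gt lt_neqAle eq_sym xf floor_le.
move=> _ [k _ <-]; rewrite /= in_itv/= !ltr_int => /andP[h1].
by rewrite ltzD1 leNgt h1.
Qed.

Lemma msupp_discrete x : discrete -> msupp mu x -> lattice discrete x /\ 0 < p x.
Proof.
move=> hd sx; have [U [oU Ux Uy]] := integers_isolated x.
have [y [yU Ly py]] := msupp_meets sx oU Ux.
have Zy : integers y by move: Ly; rewrite hd.
by rewrite -(Uy y Zy yU).
Qed.

Lemma msupp_lattice x : msupp mu x -> lattice discrete x.
Proof.
have [d sx|nd _] := boolP discrete; last by rewrite /lattice.
by have [] := msupp_discrete d sx; rewrite d.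
Qed.

(** In the discrete case [x] is itself an atom of mass [p x]. In the Lebesgue case the openness of
    the positivity set makes its intersection with [U] a nonempty open set, hence of positive
    Lebesgue measure. *)
Lemma pos_msupp x : lattice discrete x -> 0 < p x -> msupp mu x.
Proof.
move=> Lx px U oU Ux.
have mU : measurable (U : set RR) by exact: open_measurable.
have mpU : measurable_fun setT (fun x : RR => (p x)%:E) by exact/measurable_EFinP.
have [d|nd] := boolP discrete.
  have m1 : measurable ([set x] : set RR) by exact: measurable_set1.
  have mu1 : (0 < mu [set x])%E.
    rewrite muE//.
    rewrite (eq_integral (fun=> (p x)%:E)); last by move=> y; rewrite inE => ->.
    rewrite integral_cst//.
    by move: Lx; rewrite d /= => Lx; rewrite zetam_set1// mule1 lte_fin.
  apply: (lt_le_trans mu1); apply: le_measure; rewrite ?inE//.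
  by move=> _ ->.
have oV : open (U `&` [set x | 0 < p x]) by apply: openI => //; exact: hopen.
have mV : measurable (U `&` [set x | 0 < p x] : set RR) by exact: open_measurable.
apply: (@lt_le_trans _ _ (mu (U `&` [set x | 0 < p x]))); last first.
  by apply: le_measure; rewrite ?inE//; exact: subIsetl.
rewrite muE// integral_mkcond.
apply: (integral_gt0 mV).
- by apply/(measurable_restrict _ _ _) => //; exact: measurable_funTS.
- by move=> y; rewrite patchE; case: ifPn => // _; rewrite lee_fin.
- by move=> y Vy; rewrite patchE mem_set// lte_fin; case: Vy.
- by move: nd => /negbTE ->; apply: zetam_open => //; exists x.
Qed.

Lemma ae_msupp : {ae mu, forall x, msupp mu x}.
Proof.
have mlt := measurable_gt 0.
have mG : measurable (lattice discrete `&` [set x : RR | 0 < p x]).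
  by apply: measurableI => //; exact: measurable_lattice.
exists (~` (lattice discrete `&` [set x : RR | 0 < p x])); split.
- exact: measurableC.
- rewrite muE; last exact: measurableC.
  rewrite integral_mkcond; rewrite -[RHS](@integral0 _ _ R Z setT).
  apply: ae_eq_integral => //.
    by apply/(measurable_restrict _ _ _) => //; [exact: measurableC|exact/measurable_EFinP/measurable_funTS].
  apply: filterS (zetam_lattice R discrete) => y Ly _ /=.
  rewrite patchE; case: ifPn => //; rewrite inE => ny.
  congr (_%:E); apply/eqP; rewrite eq_le p0 andbT leNgt; apply/negP => py.
  by apply: ny.
- by apply: subsetC => x [Lx px]; exact: pos_msupp.
Qed.

(* [pt] is [p] set to [0] on the union of the null sets
   [{x in ]a, b[ | c < p x}] with [a, b, c] rational. *)
Lemma good_version : exists pt : R -> R,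
  [/\ @measurable_fun _ _ RR RR setT pt,
      forall x, pt x = 0 \/ (pt x = p x /\ lattice discrete x),
      {ae Z, forall x, pt x = p x} &
      forall G : R -> R, continuous G -> (forall x, 0 <= G x) ->
        {ae Z, forall x, p x <= G x} -> forall x, pt x <= G x].
Proof.
pose S (abc : rat * rat * rat) : set RR :=
  `]ratr abc.1.1, ratr abc.1.2[%classic `&` [set x : RR | ratr abc.2 < p x].
have mS abc : measurable (S abc).
  by apply: measurableI; [exact: measurable_itv|exact: measurable_gt].
pose N0 abc : set RR := if Z (S abc) == 0%E then S abc else set0.
have mN0 abc : measurable (N0 abc) by rewrite /N0; case: ifP.
have ZN0 abc : Z (N0 abc) = 0%E.
  by rewrite /N0; case: ifP => [/eqP//|_]; exact: measure0.
(* Points off the lattice are deleted too, so that in the discrete case a nonzero value of [pt]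
   occurs only at an atom of [zeta]. *)
pose N := \bigcup_abc N0 abc `|` ~` lattice discrete.
have mN : measurable N.
  apply: measurableU; last by apply: measurableC; exact: measurable_lattice.
  exact: countable_bigcupT_measurable.
have ZN : {ae Z, forall x, ~ N x}.
  have H : {ae Z, forall x, forall abc, ~ N0 abc x}.
    by apply: ae_forall_count => abc; exists (N0 abc); split => [//||x /= /contrapT//]; exact: ZN0.
  by apply: filterS2 H (zetam_lattice R discrete) => x Hx Lx [[abc _ /Hx]|].
exists (fun x => p x * \1_(~` N) x); split.
- by apply: measurable_funM => //; apply: measurable_indic; exact: measurableC.
- move=> x; rewrite indicE; case: (boolP (x \in ~` N)); last by rewrite mulr0; left.
  rewrite inE => nNx; rewrite mulr1; right; split => //.
  by apply: contrapT => nL; apply: nNx; right.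
- by apply: filterS ZN => x nNx; rewrite indicE mem_set// mulr1.
- move=> G cG G0 pG x; rewrite indicE; case: (boolP (x \in ~` N)); last by rewrite mulr0.
  rewrite inE mulr1 => nNx; rewrite leNgt; apply/negP => Gp.
  have Lx : lattice discrete x by apply: contrapT => nL; apply: nNx; right.
  (* If the bound failed at [x], a rational [c] would separate [G x] from [p x], and by continuity
     [G] stays below [c] on a rational interval around [x]. There [p > c] holds only on a null set,
     so [x] would have been deleted. *)
  have [c /andP[Gc cp]] : exists c : rat, G x < ratr c < p x.
    by have [c] := rat_in_itvoo Gp; rewrite in_itv/=; exists c.
  have [e /= e0 eG] : nbhs x [set y | G y < ratr c] by exact: (cvgr_lt _ (cG x) _ Gc).
  have [a] : exists a : rat, ratr a \in `]x - e, x[.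
    by apply: rat_in_itvoo; rewrite ltrBlDr ltrDl.
  rewrite in_itv /= => /andP[xea ax].
  have [b] : exists b : rat, ratr b \in `]x, x + e[ by apply: rat_in_itvoo; rewrite ltrDl.
  rewrite in_itv /= => /andP[xb bxe].
  have S0 : Z (S (a, b, c)) = 0%E.
    have [M [mM ZM pGM]] := pG.
    apply/eqP; rewrite -measure_le0 -ZM; apply: le_measure; rewrite ?inE//.
    move=> y [/=]; rewrite in_itv /= => /andP[ay yb] cpy; apply: pGM => /= /(lt_le_trans cpy).
    apply/negP; rewrite -leNgt; apply/ltW/eG => /=.
    rewrite ltr_norml; apply/andP; split.
      by rewrite ltrBrDl ltrBlDr; exact: lt_trans bxe.
    by rewrite ltrBlDl -ltrBlDr; exact: lt_trans ay.
  apply: nNx; left; exists (a, b, c) => //; rewrite /N0 S0 eqxx; split => //=.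
  by rewrite in_itv/= ax.
Qed.

End density_version.

(** * Positivity of the partition function *)

Lemma prode_gt0 (R : realType) (I : Type) (r : seq I) (F : I -> \bar R) :
  (forall i, 0 < F i)%E -> (0 < \prod_(i <- r) F i)%E.
Proof.
by move=> F0; elim/big_ind : _ => // x y; exact: mule_gt0.
Qed.

Section partition_function_positive.
Context (R : realType) (m n : nat).
Local Notation RR := (measurableTypeR R).
Local Notation blk := 'M[R]_(m, n).
Local Notation red := ('rV[R]_m * 'rV[R]_n.+1)%type.

Lemma continuous_gam (s : red) i j : continuous (fun yb : blk => gam s yb i j : R).
Proof.
have csum (I : finType) (F : I -> blk -> R) : (forall k, continuous (F k)) ->
    continuous (fun x => \sum_k F k x).
  by move=> cF; apply: continuous_big => //; exact: add_continuous.
have ccol i' : continuous (fun yb : blk => (s.1 - row_sums yb) ord0 i' : R).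
  under eq_fun do rewrite !mxE.
  move=> yb; apply: (@cvgB _ _ _ _ (nbhs_filter yb)); first exact: cvg_cst.
  by apply: (csum _ (fun k (x : blk) => x i' k)) => k; exact: coord_continuous.
case: (unliftP ord_max i) => [i'|] ->; last first.
  under eq_fun do rewrite border_row [X in X _ _]/= mxE [X in _ + X]mxE [in X in _ + X]mxE.
  move=> yb; apply: (@cvgB _ _ _ _ (nbhs_filter yb)); first exact: cvg_cst.
  case: unlift => [j'|].
    by apply: (csum _ (fun k (x : blk) => x k j')) => k; exact: coord_continuous.
  exact: (csum _ (fun k (x : blk) => (s.1 - row_sums x) ord0 k) ccol).
case: (unliftP ord_max j) => [j'|] ->; last first.
  by under eq_fun do rewrite border_col; exact: ccol.
by under eq_fun do rewrite border_block; exact: coord_continuous.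
Qed.

Variables (mu : {sigma_finite_measure set RR -> \bar R}) (discrete : bool) (p : R -> R).
Hypothesis hp : is_density mu (@zeta R discrete) p.
Hypothesis hopen : ~~ discrete -> open [set x | 0 < p x].
Local Notation Z := (zetam R discrete).

(** A support point of the discrete measure has [p > 0] in every entry, and the singleton block has
    mass one. In the Lebesgue case [p] may vanish at the entries of [yb]: the block is first moved
    to a nearby [yc] with positive entries, keeping the border positive, and then enlarged to an
    open box. *)
Lemma partition_gt0 (s : red) (yb : blk) : block_supp mu yb ->
  (forall i, 0 < p (gam s yb (lift ord_max i) ord_max)) ->
  (forall j, 0 < p (gam s yb ord_max j)) ->
  (0 < \int[mxm (fun _ _ => Z)]_xb (\prod_i \prod_j p (gam s xb i j))%:E)%E.
Proof.
move=> hy pc pr.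
have [mp p0 _] := hp.
have mf : measurable_fun setT (fun xb : blk => (\prod_i \prod_j p (gam s xb i j))%:E).
  apply/measurable_EFinP.
  apply: (measurableT_comp (measurable_prod_entries (fun _ _ => mp))).
  exact: measurable_gam.
have f0 (xb : blk) : (0 <= (\prod_i \prod_j p (gam s xb i j))%:E)%E.
  by rewrite lee_fin prodr_ge0// => i _; rewrite prodr_ge0.
have /orP[d|nd] := orbN discrete.
  have mE : measurable (mxrect (fun i j => [set yb i j] : set RR)).
    by apply: measurable_mxrect => i j; exact: measurable_set1.
  have PE : (0 < mxm (fun _ _ => Z) (mxrect (fun i j => [set yb i j] : set RR)))%E.
    rewrite mxm_rect => [|i j]; last exact: measurable_set1.
    rewrite big1 ?lte01// => i _; rewrite big1// => j _.
    have := msupp_lattice hp (hy i j); move: d; case: (discrete) => //= _ Zy.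
    exact: zetam_set1.
  refine (@integral_gt0 R _ _ (mxm (fun (_ : 'I_m) (_ : 'I_n) => Z)) _ _ mE mf f0 _ PE) => xb Exb.
    have -> : xb = yb by apply/matrixP => i j; exact: Exb.
    rewrite lte_fin prodr_gt0// => i _; rewrite prodr_gt0// => j _.
    case: (unliftP ord_max i) => [i'|] ->; last exact: pr.
    case: (unliftP ord_max j) => [j'|] ->; last exact: pc.
    by rewrite border_block; have [] := msupp_discrete hp d (hy i' j').
have oO := hopen nd.
pose O : set R := [set x | 0 < p x].
have nO x : O x -> nbhs x O by move=> Ox; exact: open_nbhs_nbhs.
have ng (xb : blk) i j : O (gam s xb i j) -> \forall y \near xb, O (gam s y i j).
  by move=> Oi; exact: (continuous_gam (nO _ Oi)).
have [P Pyb PV] : nbhs yb [set y : blk | (forall i, O (gam s y (lift ord_max i) ord_max)) /\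
    (forall j, O (gam s y ord_max j))].
  have h1 := filter_forall (nbhs_filter yb) (fun i => ng yb _ _ (pc i)).
  have h2 := filter_forall (nbhs_filter yb) (fun j => ng yb _ _ (pr j)).
  exact: filterS2 h1 h2.
(* Neighbourhoods of matrices are products of neighbourhoods of the entries, so each entry can be
   moved separately within [P i j] to a point where [p] is positive. *)
have /choice[y1 Hy1] : forall ij : 'I_m * 'I_n, exists y, P ij.1 ij.2 y /\ O y.
  move=> [i j] /=; have oP : open (interior (P i j)) by exact: open_interior.
  have [y [Py _ py]] := msupp_meets hp (hy i j) oP (Pyb i j).
  by exists y; split => //; exact: interior_subset.
pose yc : blk := \matrix_(i, j) y1 (i, j).
have Oyc i j : O (gam s yc i j).
  have [Oc Or] : [set y : blk | (forall i, O (gam s y (lift ord_max i) ord_max)) /\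
    (forall j, O (gam s y ord_max j))] yc.
    by apply: PV => k l; rewrite mxE; have [] := Hy1 (k, l).
  case: (unliftP ord_max i) => [i'|] ->; last exact: Or.
  case: (unliftP ord_max j) => [j'|] ->; last exact: Oc.
  by rewrite border_block mxE; have [] := Hy1 (i', j').
have [Q Qyc QV] : nbhs yc [set y : blk | forall i j, O (gam s y i j)].
  have h := filter_forall (nbhs_filter yc) (fun ij : 'I_m.+1 * 'I_n.+1 => ng yc ij.1 ij.2 (Oyc _ _)).
  by apply: filterS h => y Oy i j; exact: (Oy (i, j)).
have oQ i j : open (interior (Q i j)) by exact: open_interior.
have mQ i j : measurable (interior (Q i j) : set RR) by exact: open_measurable.
have mE := measurable_mxrect mQ.
have PE : (0 < mxm (fun _ _ => Z) (mxrect (fun i j => interior (Q i j) : set RR)))%E.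
  rewrite mxm_rect// prode_gt0// => i; rewrite prode_gt0// => j.
  move: nd => /negbTE ->; apply: zetam_open => //.
  by exists (yc i j); exact: Qyc.
refine (@integral_gt0 R _ _ (mxm (fun (_ : 'I_m) (_ : 'I_n) => Z)) _ _ mE mf f0 _ PE) => xb Exb.
  rewrite lte_fin prodr_gt0// => i _; rewrite prodr_gt0// => j _.
  by apply: QV => k l; exact: interior_subset (Exb k l).
Qed.

End partition_function_positive.

(** * Densities of the margins *)

Section density_calculus.
Local Open Scope ereal_scope.
Context (R : realType).
Local Notation RR := (measurableTypeR R).

Lemma is_density_trans d (T : measurableType d) (P Q Z : {measure set T -> \bar R})
    (f g : T -> R) : is_density P Z f -> is_density Q P g ->
  is_density Q Z (fun x => f x * g x)%R.
Proof.
move=> df [mg g0 QE]; have [mf f0 PE] := df; split => [|x|E mE].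
- exact: measurable_funM.
- by rewrite mulr_ge0.
rewrite QE// integral_mkcond (ge0_integral_dens df); last 2 first.
- by apply/(measurable_restrict _ _ _) => //; exact/measurable_EFinP/measurable_funTS.
- by move=> x; rewrite patchE; case: ifPn => // _; rewrite lee_fin.
rewrite [RHS]integral_mkcond; apply: eq_integral => x _.
by rewrite !patchE; case: ifPn => // _; rewrite ?mul0e// -EFinM mulrC.
Qed.

Lemma is_density_ae d (T : measurableType d) (P Z : {measure set T -> \bar R})
    (f g : T -> R) : measurable_fun setT g -> (forall x, (0 <= g x)%R) ->
  {ae Z, forall x, g x = f x} -> is_density P Z f -> is_density P Z g.
Proof.
move=> mg g0 gf [mf f0 PE]; split => // E mE; rewrite PE//.
apply: ae_eq_integral => //; [exact/measurable_EFinP/measurable_funTS..|].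
by apply: filterS gf => x -> _.
Qed.

Lemma is_density_prodm d1 d2 (T1 : measurableType d1) (T2 : measurableType d2)
    (P1 Z1 : {sigma_finite_measure set T1 -> \bar R})
    (P2 Z2 : {sigma_finite_measure set T2 -> \bar R}) (f1 : T1 -> R) (f2 : T2 -> R)
    (H : T1 * T2 -> \bar R) : is_density P1 Z1 f1 -> is_density P2 Z2 f2 ->
  measurable_fun setT H -> (forall z, 0 <= H z) ->
  \int[prodm P1 P2]_z H z = \int[prodm Z1 Z2]_z (H z * (f1 z.1 * f2 z.2)%:E).
Proof.
move=> d1' d2' mH H0; have [mf1 f10 _] := d1'; have [mf2 f20 _] := d2'.
have mHx x : measurable_fun setT (fun y => H (x, y)) by exact: (measurableT_comp mH).
have mf12 : measurable_fun setT (fun z : T1 * T2 => (f1 z.1 * f2 z.2)%:E).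
  apply/measurable_EFinP; apply: measurable_funM.
    exact: (measurableT_comp mf1).
  exact: (measurableT_comp mf2).
have mHf : measurable_fun setT (fun z => H z * (f1 z.1 * f2 z.2)%:E).
  exact: emeasurable_funM.
rewrite !ge0_integral_prodm//; last first.
  by move=> z; rewrite mule_ge0// lee_fin mulr_ge0.
rewrite (ge0_integral_dens d1'); last 2 first.
- exact: (measurable_fun_fubini_tonelli_F _ mH).
- by move=> x; exact: integral_ge0.
apply: eq_integral => x _; rewrite (ge0_integral_dens d2')//.
rewrite -ge0_integralZr ?lee_fin//; last 2 first.
- by apply: emeasurable_funM => //; exact/measurable_EFinP.
- by move=> y _; rewrite mule_ge0// lee_fin.
by apply: eq_integral => y _ /=; rewrite -muleA -EFinM mulrC.
Qed.

End density_calculus.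

Section margin_measurability.
Context (R : realType) (m n : nat).
Local Notation RR := (measurableTypeR R).
Local Notation marg := ('rV[R]_m.+1 * 'rV[R]_n.+1)%type.

Lemma measurable_margin : measurable_fun setT (@margin R m n).
Proof.
apply: measurable_fun_pair; apply: measurable_mx => i j; under eq_fun do rewrite mxE;
  by apply: measurable_sum => k; exact: measurable_entry.
Qed.

Lemma measurable_reduced : measurable_fun setT (@reduced R m n).
Proof.
apply: measurable_fun_pair => //; apply: measurable_mx => i j; under eq_fun do rewrite mxE.
exact: (measurableT_comp (measurable_entry _ _)).
Qed.

Lemma measurable_full_margin : measurable_fun setT (@full_margin R m n).
Proof.
apply: measurable_fun_pair => //; apply: measurable_mx => i j; under eq_fun do rewrite mxE.
case: unlift => [i'|]; first exact: (measurableT_comp (measurable_entry _ _)).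
apply: measurable_funB; apply: measurable_sum => k;
  exact: (measurableT_comp (measurable_entry _ _)).
Qed.

Lemma measurable_block : measurable_fun setT (@block R m n).
Proof.
apply: measurable_mx => i j; under eq_fun do rewrite !mxE.
exact: measurable_entry.
Qed.

Lemma measurable_splice yb : measurable_fun setT (@splice R m n yb).
Proof.
apply: measurable_mx => i j; under eq_fun do rewrite mxE.
case: unlift => [i'|]; last exact: measurable_entry.
by case: unlift => [j'|]; [exact: measurable_cst|exact: measurable_entry].
Qed.

Lemma measurable_loglik mu (ab : marg) : measurable_fun setT (fun t => loglik mu t ab).
Proof.
apply: measurable_funB => //; apply: measurable_funD; apply: measurable_sum => k;
  apply: measurable_funM => //; exact: (measurableT_comp (measurable_entry _ _)).
Qed.

(** The margin is a sufficient statistic: the logarithm of the product of all tilting factors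
    depends on [x] only through its margin. This is what makes [ab] cancel under conditioning. *)
Lemma loglik_margin mu (x : 'M[R]_(m.+1, n.+1)) (ab : marg) :
  loglik mu (margin x) ab =
  \sum_i \sum_j ((ab.1 ord0 i + ab.2 ord0 j) * x i j - psi mu (ab.1 ord0 i + ab.2 ord0 j)).
Proof.
rewrite /loglik; under [RHS]eq_bigr do rewrite sumrB; rewrite sumrB; congr (_ - _).
under [RHS]eq_bigr => i _ do under eq_bigr => j _ do rewrite mulrDl.
under [RHS]eq_bigr do rewrite big_split /=; rewrite big_split /=; congr (_ + _).
  by apply: eq_bigr => i _; rewrite mxE mulr_suml; apply: eq_bigr => j _; rewrite mulrC.
rewrite exchange_big; apply: eq_bigr => j _; rewrite mxE mulr_suml.
by apply: eq_bigr => i _; rewrite mulrC.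
Qed.

End margin_measurability.

Section margin_densities.
Context (R : realType) (m n : nat).
Local Notation RR := (measurableTypeR R).
Local Notation blk := 'M[R]_(m, n).
Local Notation mat := 'M[R]_(m.+1, n.+1).
Local Notation red := ('rV[R]_m * 'rV[R]_n.+1)%type.
Local Notation marg := ('rV[R]_m.+1 * 'rV[R]_n.+1)%type.
Variables (mu : {sigma_finite_measure set RR -> \bar R}) (discrete : bool) (p : R -> R).
Hypothesis hp : is_density mu (@zeta R discrete) p.
Local Notation Z := (zetam R discrete).
Local Notation ZB := (mxm (fun (_ : 'I_m) (_ : 'I_n) => Z)).
Local Notation S := (red_measure m n Z).

Let mp : @measurable_fun _ _ RR RR setT p. Proof. by have [] := hp. Qed.
Let p0 x : 0 <= p x. Proof. by have [_ + _] := hp; exact. Qed.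
Let hpZ : is_density mu Z p. Proof. by rewrite zetamE. Qed.

Definition theta_at (ab : marg) (i : 'I_m.+1) (j : 'I_n.+1) : R :=
  ab.1 ord0 i + ab.2 ord0 j.

Definition tilted (theta : R) (x : RR) : R := p x * etilt mu theta x.

Lemma is_density_tilted theta : is_density (tiltm mu theta) Z (tilted theta).
Proof.
exact: (@is_density_trans R _ RR mu (tiltm mu theta) Z p _ hpZ (is_density_tilt mu theta)).
Qed.

Lemma measurable_tilted theta : @measurable_fun _ _ RR RR setT (tilted theta).
Proof. by have [] := is_density_tilted theta. Qed.

Lemma tilted_ge0 theta x : 0 <= tilted theta x.
Proof. by have [_ + _] := is_density_tilted theta; exact. Qed.

Definition weight (x : mat) : R := \prod_i \prod_j p (x i j).

Definition partition (s : red) : \bar R := (\int[ZB]_yb (weight (gam s yb))%:E)%E.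

Lemma weight_ge0 x : 0 <= weight x.
Proof. by rewrite prodr_ge0// => i _; rewrite prodr_ge0. Qed.

Lemma measurable_weight : measurable_fun setT (weight : mat -> RR).
Proof. exact: (measurable_prod_entries (fun _ _ => mp)). Qed.

Lemma prod_tilted (ab : marg) (x : mat) :
  \prod_i \prod_j tilted (theta_at ab i j) (x i j) =
  weight x * expR (loglik mu (margin x) ab).
Proof.
rewrite loglik_margin expR_sum /weight -big_split; apply: eq_bigr => i _ /=.
by rewrite expR_sum -big_split.
Qed.

Local Open Scope ereal_scope.

Lemma measurable_weight_gam : measurable_fun setT
  (fun u : red * blk => (weight (gam u.1 u.2))%:E).
Proof.
by apply/measurable_EFinP; apply: (measurableT_comp measurable_weight); exact: measurable_gam.
Qed.

Lemma measurable_partition : measurable_fun setT partition.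
Proof.
apply: (measurable_fun_fubini_tonelli_F (m2 := ZB) _ measurable_weight_gam) => u.
by rewrite lee_fin weight_ge0.
Qed.

Lemma partition_ge0 s : 0 <= partition s.
Proof. by apply: integral_ge0 => yb _; rewrite lee_fin weight_ge0. Qed.

Lemma ge0_integral_density_gam (mus : 'I_m.+1 -> 'I_n.+1 -> {sigma_finite_measure set RR -> \bar R})
    (g : 'I_m.+1 -> 'I_n.+1 -> RR -> R) (F : mat -> \bar R) :
  (forall i j, is_density (mus i j) Z (g i j)) ->
  measurable_fun setT F -> (forall x, 0 <= F x) ->
  \int[mxm mus]_x F x = \int[S]_s \int[ZB]_yb
    (F (gam s yb) * (\prod_i \prod_j g i j (gam s yb i j))%:E).
Proof.
move=> dg mF F0; have dm := is_density_mxm dg; have [mg g0 _] := dm.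
rewrite (ge0_integral_dens dm)// (ge0_integral_gam (@lattice0 R discrete)
  (@latticeB R discrete) (@zetam_shift R discrete) (zetam_lattice R discrete))//.
- by apply: emeasurable_funM => //; exact/measurable_EFinP.
- by move=> x; rewrite mule_ge0// lee_fin.
Qed.

(** The margin is constant along [gam s], so the factor [c] leaves the integral over blocks and the
    partition function remains. It is used with [c = 1] for [nu] and with the exponential of the
    log-likelihood for [nu_Y]. *)
Lemma ge0_integral_margin_density
    (mus : 'I_m.+1 -> 'I_n.+1 -> {sigma_finite_measure set RR -> \bar R})
    (g : 'I_m.+1 -> 'I_n.+1 -> RR -> R) (G : marg -> \bar R) (c : red -> R) :
  (forall i j, is_density (mus i j) Z (g i j)) ->
  (forall x : mat, (\prod_i \prod_j g i j (x i j) = weight x * c (reduced (margin x)))%R) ->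
  (forall s, 0 <= c s)%R ->
  measurable_fun setT G -> (forall t, 0 <= G t) ->
  \int[pushforward (mxm mus) (@margin R m n)]_t G t =
  \int[S]_s (G (full_margin s) * (partition s * (c s)%:E)).
Proof.
move=> dg gc c0 mG G0.
rewrite (ge0_integral_push _ (@measurable_margin R m n))//.
rewrite (ge0_integral_density_gam dg); last 2 first.
- exact: (measurableT_comp mG (@measurable_margin R m n)).
- by [].
apply: eq_integral => s _.
under eq_integral do rewrite margin_gam gc margin_gam reduced_full_margin EFinM.
rewrite ge0_integralZl//; last 2 first.
- apply/measurable_EFinP; apply: measurable_funM => //.
  by apply: (measurableT_comp measurable_weight); exact: measurable_gam.
- by move=> yb _; rewrite -EFinM lee_fin mulr_ge0// weight_ge0.
congr (_ * _); rewrite ge0_integralZr ?lee_fin//.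
- by apply/measurable_EFinP; apply: (measurableT_comp measurable_weight); exact: measurable_gam.
- by move=> yb _; rewrite lee_fin weight_ge0.
Qed.

Lemma ge0_integral_nu (G : marg -> \bar R) :
  measurable_fun setT G -> (forall t, 0 <= G t) ->
  \int[nu mu]_t G t = \int[S]_s (G (full_margin s) * partition s).
Proof.
move=> mG G0; rewrite /nu /mu_mx -(mxmE (fun _ _ => mu)).
rewrite (@ge0_integral_margin_density _ (fun _ _ => p) _ (fun=> 1%R))//.
  by apply: eq_integral => s _; rewrite mule1.
by move=> x; rewrite mulr1.
Qed.

Definition lawm (ab : marg) := mxm (fun i j => tiltm mu (theta_at ab i j)).

Lemma lawmE (ab : marg) : law_Y mu ab = lawm ab.
Proof. by rewrite /lawm mxmE. Qed.

Lemma ge0_integral_nu_Y (ab : marg) (G : marg -> \bar R) :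
  measurable_fun setT G -> (forall t, 0 <= G t) ->
  \int[nu_Y mu ab]_t G t = \int[S]_s (G (full_margin s) *
    (partition s * (expR (loglik mu (full_margin s) ab))%:E)).
Proof.
move=> mG G0; rewrite /nu_Y lawmE.
rewrite (@ge0_integral_margin_density _ (fun i j => tilted (theta_at ab i j)) _
  (fun s => expR (loglik mu (full_margin s) ab)))//.
- by move=> i j; exact: is_density_tilted.
- move=> x; rewrite prod_tilted full_marginK//.
  rewrite /=; under eq_bigr do rewrite mxE; rewrite exchange_big.
  by apply: eq_bigr => j _; rewrite mxE.
Qed.

(** Since the tilts are probabilities, the border, independent of the block, integrates to one. *)
Lemma ge0_integral_lawm_block (ab : marg) (h : blk -> \bar R) :
  (forall i j, tilt mu (theta_at ab i j) setT = 1) ->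
  measurable_fun setT h -> (forall yb, 0 <= h yb) ->
  \int[law_Y mu ab]_y h (block y) = \int[ZB]_yb (h yb *
    (\prod_i \prod_j block_family (fun i j => tilted (theta_at ab i j)) i j (yb i j))%:E).
Proof.
move=> mass mh h0; rewrite lawmE ge0_integral_border//; last first.
  exact: (measurableT_comp mh (@measurable_block R m n)).
have mass_border : border_measure (fun i j => tiltm mu (theta_at ab i j)) setT = 1.
  rewrite -setXTT; apply: etrans; first exact: prodm_setX.
  have rT k (ms : 'I_k -> {sigma_finite_measure set RR -> \bar R}) :
      (forall j, ms j setT = 1) -> rvm ms setT = 1.
    move=> ms1; rewrite (_ : setT = mxrect (fun _ _ => setT)); last exact/esym/seteqP.
    by rewrite rvm_rect// big1.
  by rewrite !rT ?mule1// => j; exact: mass.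
rewrite -(@ge0_integral_dens _ _ _ (mxm (block_family (fun i j => tiltm mu (theta_at ab i j)))))//.
  apply: eq_integral => yb _.
  under eq_integral do rewrite block_border.
  by rewrite integral_cst//; apply: etrans (mule1 _); congr (_ * _); exact: mass_border.
by apply: is_density_mxm => i j; exact: is_density_tilted.
Qed.

End margin_densities.

(** * The law of the margin given the block *)

Section density_families.
Context (R : realType) (m n : nat).
Local Notation RR := (measurableTypeR R).
Local Notation blk := 'M[R]_(m, n).
Local Notation mat := 'M[R]_(m.+1, n.+1).
Local Notation red := ('rV[R]_m * 'rV[R]_n.+1)%type.
Local Notation marg := ('rV[R]_m.+1 * 'rV[R]_n.+1)%type.
Variables (mu : {sigma_finite_measure set RR -> \bar R}) (discrete : bool) (p : R -> R).
Hypothesis hp : is_density mu (@zeta R discrete) p.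
Local Notation Z := (zetam R discrete).
Local Notation S := (red_measure m n Z).
Local Notation tilted := (tilted mu p).

Let mp : @measurable_fun _ _ RR RR setT p. Proof. by have [] := hp. Qed.
Let p0 x : 0 <= p x. Proof. by have [_ + _] := hp; exact. Qed.

(* The border of [Y] is independent of its block. *)
Definition qdens (ab : marg) (yb : blk) (s : red) : R :=
  (\prod_i tilted (theta_at ab (lift ord_max i) ord_max) (gam s yb (lift ord_max i) ord_max)) *
  (\prod_j tilted (theta_at ab ord_max j) (gam s yb ord_max j)).

Lemma qdens_ge0 ab yb s : 0 <= qdens ab yb s.
Proof. by rewrite mulr_ge0// prodr_ge0// => i _; exact: (tilted_ge0 hp). Qed.

Lemma measurable_qdens ab d (T : measurableType d) (yb : T -> blk) (s : T -> red) :
  measurable_fun setT yb -> measurable_fun setT s ->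
  measurable_fun setT (fun t => qdens ab (yb t) (s t)).
Proof.
move=> my ms; have mg := measurable_gam ms my.
apply: measurable_funM; apply: measurable_prod => i _;
  apply: (measurableT_comp (measurable_tilted hp _));
  exact: (measurableT_comp (measurable_entry _ _) mg).
Qed.

Lemma prod_tilted_border (ab : marg) (s : red) (yb : blk) :
  \prod_i \prod_j tilted (theta_at ab i j) (gam s yb i j) =
  (\prod_i \prod_j block_family (fun i j => tilted (theta_at ab i j)) i j (yb i j)) *
  qdens ab yb s.
Proof.
rewrite big_ord_corner; congr (_ * _).
by apply: eq_bigr => i _; apply: eq_bigr => j _; rewrite border_block.
Qed.

Local Open Scope ereal_scope.

(** [splice] overwrites the random block, which integrates out to one; what remains is the
    independent border, and with the block fixed at [yb] it is a translate of the reduced margin. *)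
Lemma ge0_integral_nu_bar (ab : marg) (yb : blk) (G : marg -> \bar R) :
  admissible mu ab -> block_supp mu yb ->
  measurable_fun setT G -> (forall t, 0 <= G t) ->
  \int[nu_bar mu ab yb]_t G t = \int[S]_s (G (full_margin s) * (qdens ab yb s)%:E).
Proof.
move=> hab hy mG G0.
have mms : measurable_fun setT (fun y : mat => margin (splice yb y)).
  exact: (measurableT_comp (@measurable_margin R m n) (measurable_splice yb)).
rewrite /nu_bar lawmE (ge0_integral_push _ mms)//.
rewrite ge0_integral_border//; last exact: (measurableT_comp mG mms).
under eq_integral => yb' _ do under eq_integral do rewrite splice_border.
rewrite integral_cst//.
have mass : mxm (block_family (fun i j => tiltm mu (theta_at ab i j))) setT = 1.
  rewrite (_ : setT = mxrect (fun _ _ => setT)); last exact/esym/seteqP.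
  rewrite mxm_rect// big1// => i _; rewrite big1// => j _.
  apply: tilt_setT; first by apply: interior_subset; exact: hab.
  (* An entry of [yb] in the support shows that [mu] is not zero; if the block has no entry, the
     product is empty and no mass has to be computed. *)
  apply/negP => /eqP mu0; have := hy i j setT openT I.
  by rewrite mu0 ltxx.
rewrite [X in _ * X]mass mule1.
have dc := @is_density_rvm _ _ _ (fun=> Z) _
  (fun i => is_density_tilted hp (theta_at ab (lift ord_max i) ord_max)).
have dr := @is_density_rvm _ _ _ (fun=> Z) _
  (fun j => is_density_tilted hp (theta_at ab ord_max j)).
have mH : measurable_fun setT (fun z : red => G (margin (border yb z))).
  apply: (measurableT_comp mG); apply: (measurableT_comp (@measurable_margin R m n)).
  exact: measurable_border.
have [mc c0 _] := dc; have [mr r0 _] := dr.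
have H0 (z : red) : 0 <= G (margin (border yb z)) by [].
apply: etrans; first exact: (is_density_prodm dc dr mH H0).
(* The translation formula is needed for this particular block, not for almost every one; membership
   in the support is what places its entries in the lattice. *)
have Ly i j : lattice discrete (yb i j) by apply: (msupp_lattice hp); exact: hy.
have mHg : measurable_fun setT (fun z : red => G (margin (border yb z)) *
    ((\prod_i tilted (theta_at ab (lift ord_max i) ord_max) (z.1 ord0 i)) *
     (\prod_j tilted (theta_at ab ord_max j) (z.2 ord0 j)))%:E).
  apply: emeasurable_funM => //; apply/measurable_EFinP; apply: measurable_funM.
    exact: (measurableT_comp mc).
  exact: (measurableT_comp mr).
apply: etrans; first apply: (ge0_integral_last_border (@lattice0 R discrete)
  (@latticeB R discrete) (@zetam_shift R discrete) (zetam_lattice R discrete) Ly mHg).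
  by move=> z; rewrite mule_ge0// lee_fin mulr_ge0.
apply: eq_integral => s _; rewrite /= -[border yb (last_border s yb)]/(gam s yb) margin_gam.
congr (_ * (_ * _)%:E); apply: eq_bigr => i _.
  by rewrite /gam border_col.
by rewrite /gam border_row.
Qed.

Lemma nu_bar_setE (ab : marg) (yb : blk) E : admissible mu ab -> block_supp mu yb ->
  measurable E -> nu_bar mu ab yb E =
  \int[S]_s ((\1_E (full_margin s))%:E * (qdens ab yb s)%:E).
Proof.
move=> hab hy mE; rewrite -(@ge0_integral_nu_bar _ _ (fun t => (\1_E t)%:E))//; last first.
  by apply/measurable_EFinP; exact: measurable_indic.
have mms : measurable_fun setT (fun y : mat => margin (splice yb y)).
  exact: (measurableT_comp (@measurable_margin R m n) (measurable_splice yb)).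
rewrite /nu_bar lawmE; apply: etrans; last first.
  exact/esym/(integral_indic (push (lawm mu ab) mms) measurableT mE).
by rewrite setIT.
Qed.

Lemma qdens_is_density ab yb : admissible mu ab -> block_supp mu yb ->
  is_density (nu_bar_reduced mu ab yb)
    (rvprod (fun=> zeta discrete) \x rvprod (fun=> zeta discrete)) (qdens ab yb).
Proof.
move=> hab hy; split.
- exact: measurable_qdens.
- exact: qdens_ge0.
- move=> E mE; rewrite /nu_bar_reduced /pushforward nu_bar_setE//; last first.
    by rewrite -[X in measurable X]setTI; exact: (@measurable_reduced R m n).
  rewrite -(zetamE R discrete) -2!(rvmE (fun=> Z)) [RHS]integral_mkcond.
  apply: eq_integral => s _; rewrite patchE indicE.
  have -> : (full_margin s \in @reduced R m n @^-1` E) = (s \in E).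
    by apply/idP/idP; rewrite !inE /preimage /= reduced_full_margin.
  by case: ifPn => _; rewrite ?mul1e ?mul0e.
Qed.

Lemma continuous_theta_at i j : continuous (fun ab : marg => theta_at ab i j).
Proof.
move=> ab; apply: (@cvgD _ _ _ _ (nbhs_filter ab)).
  apply: (@cvg_comp _ _ _ (fun ab : marg => ab.1) (fun x => x ord0 i)); first exact: cvg_fst.
  exact: coord_continuous.
apply: (@cvg_comp _ _ _ (fun ab : marg => ab.2) (fun x => x ord0 j)); first exact: cvg_snd.
exact: coord_continuous.
Qed.

Lemma continuous_psi_theta_at ab i j : admissible mu ab ->
  {for ab, continuous (fun ab : marg => psi mu (theta_at ab i j))}.
Proof.
move=> hab; apply: (@continuous_comp _ _ _ (fun ab : marg => theta_at ab i j) (psi mu)).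
  exact: continuous_theta_at.
by apply: psi_continuous; exact: hab.
Qed.

Lemma continuous_tilted_theta_at ab i j x : admissible mu ab ->
  {for ab, continuous (fun ab : marg => tilted (theta_at ab i j) x)}.
Proof.
move=> hab; apply: (@cvgM _ _ _ (nbhs_filter ab)); first exact: cvg_cst.
apply: (@cvg_comp _ _ _ (fun ab : marg => theta_at ab i j * x - psi mu (theta_at ab i j))%R expR).
  apply: (@cvgB _ _ _ _ (nbhs_filter ab)).
    apply: (@cvgM _ _ _ (nbhs_filter ab)); last exact: cvg_cst.
    exact: continuous_theta_at.
  exact: continuous_psi_theta_at.
exact: continuous_expR.
Qed.

Lemma continuous_qdens ab yb s : admissible mu ab ->
  {for ab, continuous (fun ab => qdens ab yb s)}.
Proof.
move=> hab; apply: (@cvgM _ _ _ (nbhs_filter ab));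
  apply: cvg_big; first [exact: mul_continuous | exact: (nbhs_filter ab) |
    by move=> i _; exact: continuous_tilted_theta_at].
Qed.

Lemma is_q_family_qdens : is_q_family mu discrete qdens.
Proof.
split.
- by move=> ab yb hab hy; exact: qdens_is_density.
- by move=> ab _; exact: measurable_qdens.
- move=> yb s; apply: continuous_in_subspaceT => ab /set_mem hab.
  exact: continuous_qdens.
Qed.

End density_families.

(** * Densities relative to the law of the margin *)

Section conditional_density_family.
Context (R : realType) (m n : nat).
Local Notation RR := (measurableTypeR R).
Local Notation blk := 'M[R]_(m, n).
Local Notation mat := 'M[R]_(m.+1, n.+1).
Local Notation red := ('rV[R]_m * 'rV[R]_n.+1)%type.
Local Notation marg := ('rV[R]_m.+1 * 'rV[R]_n.+1)%type.
Variables (mu : {sigma_finite_measure set RR -> \bar R}) (discrete : bool) (p pt : R -> R).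
Hypothesis hp : is_density mu (@zeta R discrete) p.
Hypothesis hopen : ~~ discrete -> open [set x | 0 < p x].
Hypothesis hpt : is_density mu (@zeta R discrete) pt.
Hypothesis ptp : forall x, pt x = 0 \/ (pt x = p x /\ lattice discrete x).
Local Notation Z := (zetam R discrete).
Hypothesis pt_ae : {ae Z, forall x, pt x = p x}.
Local Notation ZB := (mxm (fun (_ : 'I_m) (_ : 'I_n) => Z)).
Local Notation S := (red_measure m n Z).
Local Notation part := (@partition R m n discrete pt).

(* [expR (loglik mu t ab) * part (reduced t)] is the density of [nu_Y]; the value
   is 0 where [part] is infinite. *)
Definition pdens (ab : marg) (yb : blk) (t : marg) : R :=
  qdens mu pt ab yb (reduced t) * (expR (- loglik mu t ab) * (fine (part (reduced t)))^-1).

Local Open Scope ereal_scope.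

(** The weights of [pt] and [p] differ on a null set of matrices. In the coordinates [gam], the
    integral of their distance vanishes, so for almost every [s] they agree at almost every
    block. *)
Lemma partition_version : {ae S, forall s, part s = partition discrete p s}.
Proof.
pose D (x : mat) : R := (`|weight pt x - weight p x|)%R.
have mw : measurable_fun setT (weight p : mat -> RR) := measurable_weight hp.
have D0 x : (0 <= D x)%R by exact: normr_ge0.
have mwt : measurable_fun setT (weight pt : mat -> RR) := measurable_weight hpt.
have mD : measurable_fun setT (D : mat -> RR).
  by apply: measurableT_comp => //; exact: measurable_funB.
have mDE : measurable_fun setT (fun x : mat => (D x)%:E) by exact/measurable_EFinP.
have ID : \int[mxm (fun (_ : 'I_m.+1) (_ : 'I_n.+1) => Z)]_x (D x)%:E = 0.
  rewrite -[RHS](@integral0 _ _ R (mxm (fun (_ : 'I_m.+1) (_ : 'I_n.+1) => Z)) setT).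
  apply: ae_eq_integral => //.
  have := @mxm_ae _ _ _ (fun (_ : 'I_m.+1) (_ : 'I_n.+1) => Z)
    (fun _ _ x => pt x = p x) (fun _ _ => pt_ae).
  apply: filterS => x xE _; rewrite /D.
  have -> : weight pt x = weight p x.
    by apply: eq_bigr => i _; apply: eq_bigr => j _; exact: xE.
  by rewrite subrr normr0.
have mDg : measurable_fun setT (fun u : red * blk => (D (gam u.1 u.2))%:E).
  by apply/measurable_EFinP; apply: (measurableT_comp mD); exact: measurable_gam.
rewrite (ge0_integral_gam (@lattice0 R discrete)
  (@latticeB R discrete) (@zetam_shift R discrete) (zetam_lattice R discrete)) in ID => //.
have mI : measurable_fun setT (fun s : red => \int[ZB]_yb (D (gam s yb))%:E).
  by apply: (measurable_fun_fubini_tonelli_F (m2 := ZB) _ mDg) => u; rewrite lee_fin; exact: D0.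
have I0 (s : red) : 0 <= \int[ZB]_yb (D (gam s yb))%:E.
  by apply: integral_ge0 => yb _; rewrite lee_fin; exact: D0.
have := ge0_integral_eq0_ae mI I0 ID.
apply: filterS => s Is0.
have mgs : measurable_fun setT (fun yb : blk => gam s yb) by exact: measurable_gam.
have mDs : measurable_fun setT (fun yb : blk => (D (gam s yb))%:E).
  by apply/measurable_EFinP; exact: (measurableT_comp mD).
have Ds0 (yb : blk) : 0 <= (D (gam s yb))%:E by rewrite lee_fin; exact: D0.
have := ge0_integral_eq0_ae mDs Ds0 Is0.
move=> DE; apply: ae_eq_integral => //.
- by apply/measurable_EFinP; exact: (measurableT_comp mwt).
- by apply/measurable_EFinP; exact: (measurableT_comp mw).
apply: filterS DE => yb [/eqP]; rewrite normr_eq0 subr_eq0 => /eqP e _.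
by rewrite e.
Qed.

(** The total mass of [law_Y], at most one, is the integral of the partition function against a
    positive factor. A single admissible parameter suffices, as [part] does not depend on it. *)
Lemma partition_lty (ab : marg) : admissible mu ab -> {ae S, forall s, part s < +oo}.
Proof.
move=> hab.
have lT : law_Y mu ab setT < +oo.
  rewrite lawmE (_ : setT = mxrect (fun _ _ => setT)); last exact/esym/seteqP.
  rewrite mxm_rect// -ge0_fin_numE; last first.
    by apply: prode_ge0 => i _; apply: prode_ge0.
  apply: prode_fin_num => i _; apply: prode_fin_num => j _.
  rewrite ge0_fin_numE//; apply: le_lt_trans (ltry 1).
  by apply: tilt_setT_le1; apply: interior_subset; exact: hab.
have := @ge0_integral_nu_Y R m n mu discrete pt hpt ab (cst 1) (measurable_cst _) (fun=> lee01).
rewrite /nu_Y lawmE.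
rewrite (@ge0_integral_push _ _ _ _ _ (lawm mu ab) _ (@measurable_margin R m n))//.
rewrite integral_cst// mul1e => lTE.
pose K (s : red) := cst 1 (full_margin s) * (part s * (expR (loglik mu (full_margin s) ab))%:E).
have K0 s : 0 <= K s.
  by rewrite mule_ge0// mule_ge0 ?lee_fin ?expR_ge0//; exact: (partition_ge0 hpt).
have mK : measurable_fun setT K.
  apply: emeasurable_funM => //; apply: emeasurable_funM; first exact: (measurable_partition hpt).
  apply/measurable_EFinP; apply: measurableT_comp; first exact: measurable_expR.
  exact: (measurableT_comp (measurable_loglik mu ab) (@measurable_full_margin R m n)).
have iK : S.-integrable setT K.
  apply/integrableP; split => //.
  rewrite (eq_integral K) => [|s _]; last by rewrite gee0_abs.
  by rewrite -lTE; move: lT; rewrite lawmE.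
have := integrable_ae measurableT iK; rewrite /K.
apply: filterS => s /(_ I).
rewrite mul1e; have := partition_ge0 hpt s; case: (part s) => // [r _ _|_].
  exact: ltry.
by rewrite gt0_mulye// lte_fin expR_gt0.
Qed.

(** Only the exceptional set of [partition_version] is used, so [ab] and [yb] may be quantified
    after it. A nonzero [qdens] makes [pt], hence [p], positive along the border, and the positivity
    argument runs for [p], whose positivity set is open. *)
Lemma partition_gt0_version : {ae S, forall s, forall ab yb,
  block_supp mu yb -> qdens mu pt ab yb s != 0%R -> 0 < part s}.
Proof.
apply: filterS partition_version => s -> ab yb hy.
rewrite mulf_eq0 negb_or => /andP[/prodf_neq0 qc /prodf_neq0 qr].
have pos th x : tilted mu pt th x != 0%R -> (0 < p x)%R.
  rewrite /tilted mulf_eq0 negb_or => /andP[ptx _].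
  have [e|[e _]] := ptp x; first by rewrite e eqxx in ptx.
  by have [_ p0 _] := hp; rewrite lt_neqAle eq_sym -e ptx e p0.
apply: (partition_gt0 hp hopen hy) => i.
  exact: (pos _ _ (qc i _)).
exact: (pos _ _ (qr i _)).
Qed.

(** Division by the partition function is undone where [qdens] is nonzero; elsewhere both sides are
    zero, whatever the value of [part]. *)
Lemma pdens_full_margin (ab : marg) (yb : blk) (s : red) : part s < +oo ->
  (qdens mu pt ab yb s != 0%R -> 0 < part s) ->
  (pdens ab yb (full_margin s))%:E * (part s * (expR (loglik mu (full_margin s) ab))%:E) =
  (qdens mu pt ab yb s)%:E.
Proof.
move=> fin pos; have [q0|q0] := eqVneq (qdens mu pt ab yb s) 0%R.
  by rewrite /pdens reduced_full_margin q0 mul0r mul0e.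
have pgt0 := pos q0; have pfin : part s \is a fin_num by rewrite ge0_fin_numE// ltW.
rewrite -[part s]fineK// -!EFinM /pdens reduced_full_margin; congr (_%:E).
rewrite expRN; have := expR_gt0 (loglik mu (full_margin s) ab) => e0.
have f0 : (0 < fine (part s))%R by rewrite fine_gt0// pgt0.
by rewrite -mulrA -invfM [(fine _ * _)%R]mulrC mulVf ?mulr1// mulf_neq0 ?gt_eqF.
Qed.

Lemma pdens_ge0 ab yb t : (0 <= pdens ab yb t)%R.
Proof.
apply: mulr_ge0; first exact: (qdens_ge0 hpt).
by rewrite mulr_ge0 ?expR_ge0// invr_ge0 fine_ge0//; exact: (partition_ge0 hpt).
Qed.

Lemma measurable_pdens ab d (T : measurableType d) (yb : T -> blk) (t : T -> marg) :
  measurable_fun setT yb -> measurable_fun setT t ->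
  measurable_fun setT (fun u => pdens ab (yb u) (t u)).
Proof.
move=> my mt.
have mr : measurable_fun setT (fun u => reduced (t u)).
  exact: (measurableT_comp (@measurable_reduced R m n)).
apply: measurable_funM; first exact: (measurable_qdens hpt).
apply: measurable_funM.
  apply: measurableT_comp; first exact: measurable_expR.
  apply: measurableT_comp => //.
  exact: (measurableT_comp (measurable_loglik mu ab)).
under eq_fun do rewrite -powR_inv1 ?fine_ge0 ?(partition_ge0 hpt)//.
apply: (@measurableT_comp _ _ _ _ _ _ (fun x : R => x `^ (-1))%R); first exact: measurable_powR.
apply: (measurableT_comp (@fine_measurable R setT measurableT)).
exact: (measurableT_comp (measurable_partition hpt)).
Qed.

Lemma pdens_is_density ab yb : admissible mu ab -> block_supp mu yb ->
  is_density (nu_bar mu ab yb) (nu_Y mu ab) (pdens ab yb).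
Proof.
move=> hab hy; have mpd : measurable_fun setT (pdens ab yb) by exact: measurable_pdens.
split => // [t|E mE]; first exact: pdens_ge0.
apply: etrans; first exact: (nu_bar_setE hpt hab hy mE).
have nuYE : nu_Y mu ab = push (lawm mu ab) (@measurable_margin R m n) by rewrite /nu_Y lawmE.
have -> : \int[nu_Y mu ab]_(t in E) (pdens ab yb t)%:E =
    \int[nu_Y mu ab]_t (\1_E t * pdens ab yb t)%:E.
  rewrite nuYE integral_mkcond; apply: eq_integral => t _.
  by rewrite patchE indicE; case: ifPn => _; rewrite ?mul1r ?mul0r.
rewrite (ge0_integral_nu_Y hpt); last 2 first.
- by apply/measurable_EFinP; apply: measurable_funM => //; exact: measurable_indic.
- by move=> t; rewrite lee_fin mulr_ge0// pdens_ge0.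
have mfm := @measurable_full_margin R m n.
have m1 : measurable_fun setT (fun s : red => \1_E (full_margin s) : R).
  by apply: (measurableT_comp _ mfm); exact: measurable_indic.
apply: ae_eq_integral => //.
- apply: emeasurable_funM; first exact/measurable_EFinP.
  by apply/measurable_EFinP; exact: (measurable_qdens hpt).
- apply: emeasurable_funM.
    apply/measurable_EFinP; apply: measurable_funM; first exact: m1.
    exact: (measurableT_comp mpd mfm).
  apply: emeasurable_funM; first exact: (measurable_partition hpt).
  apply/measurable_EFinP; apply: measurableT_comp; first exact: measurable_expR.
  exact: (measurableT_comp (measurable_loglik mu ab) mfm).
apply: filterS2 (partition_lty hab) partition_gt0_version => s fin pos _.
rewrite [(\1_E _ * _)%:E]EFinM -muleA pdens_full_margin//; exact: pos.
Qed.

Lemma continuous_loglik (ab t : marg) : admissible mu ab ->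
  {for ab, continuous (fun ab : marg => loglik mu t ab)}.
Proof.
move=> hab.
have nf := nbhs_filter ab.
have csum (I : finType) (F : I -> marg -> R) : (forall k, {for ab, continuous (F k)}) ->
    {for ab, continuous (fun x => \sum_k F k x)%R}.
  move=> cF; apply: cvg_big => [|k _]; first exact: add_continuous.
  exact: cF.
apply: (@cvgB _ _ _ _ nf).
  apply: (@cvgD _ _ _ _ nf).
    apply: (csum _ (fun k (x : marg) => t.1 ord0 k * x.1 ord0 k)%R) => k.
    apply: (@cvgM _ _ _ nf); first exact: cvg_cst.
    apply: (@cvg_comp _ _ _ (fun ab : marg => ab.1) (fun x => x ord0 k)); first exact: cvg_fst.
    exact: coord_continuous.
  apply: (csum _ (fun k (x : marg) => t.2 ord0 k * x.2 ord0 k)%R) => k.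
  apply: (@cvgM _ _ _ nf); first exact: cvg_cst.
  apply: (@cvg_comp _ _ _ (fun ab : marg => ab.2) (fun x => x ord0 k)); first exact: cvg_snd.
  exact: coord_continuous.
apply: (csum _ (fun i (x : marg) => \sum_j psi mu (x.1 ord0 i + x.2 ord0 j))%R) => i.
apply: (csum _ (fun j (x : marg) => psi mu (x.1 ord0 i + x.2 ord0 j))%R) => j.
exact: continuous_psi_theta_at.
Qed.

Lemma is_p_family_pdens : is_p_family mu pdens.
Proof.
split.
- by move=> ab yb hab hy; exact: pdens_is_density.
- by move=> ab _; exact: measurable_pdens.
- move=> yb t; apply: continuous_in_subspaceT => ab /set_mem hab.
  apply: (@cvgM _ _ _ (nbhs_filter ab)); first exact: continuous_qdens.
  apply: (@cvgM _ _ _ (nbhs_filter ab)); last exact: cvg_cst.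
  apply: (@cvg_comp _ _ _ (fun ab : marg => - loglik mu t ab)%R expR); last exact: continuous_expR.
  by apply: cvgN; exact: continuous_loglik.
Qed.

End conditional_density_family.

(** * Null sets of margins *)

Section almost_every_margin.
Context (R : realType) (m n : nat).
Local Notation RR := (measurableTypeR R).
Local Notation blk := 'M[R]_(m, n).
Local Notation mat := 'M[R]_(m.+1, n.+1).
Local Notation red := ('rV[R]_m * 'rV[R]_n.+1)%type.
Local Notation marg := ('rV[R]_m.+1 * 'rV[R]_n.+1)%type.
Variables (mu : {sigma_finite_measure set RR -> \bar R}) (discrete : bool) (p pt : R -> R).
Hypothesis hp : is_density mu (@zeta R discrete) p.
Hypothesis hopen : ~~ discrete -> open [set x | 0 < p x].
Hypothesis hpt : is_density mu (@zeta R discrete) pt.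
Hypothesis ptp : forall x, pt x = 0 \/ (pt x = p x /\ lattice discrete x).
Local Notation Z := (zetam R discrete).
Hypothesis pt_ae : {ae Z, forall x, pt x = p x}.
Hypothesis pt_le : forall G : R -> R, continuous G -> (forall x, 0 <= G x) ->
  {ae Z, forall x, p x <= G x} -> forall x, pt x <= G x.
Local Notation ZB := (mxm (fun (_ : 'I_m) (_ : 'I_n) => Z)).
Local Notation S := (red_measure m n Z).
Local Notation part := (@partition R m n discrete pt).

Local Open Scope ereal_scope.

Definition nu_measure : {measure set marg -> \bar R} :=
  push (mxm (fun (_ : 'I_m.+1) (_ : 'I_n.+1) => mu)) (@measurable_margin R m n).

Lemma nu_measureE : nu mu = (nu_measure : set marg -> \bar R).
Proof. by rewrite /nu /mu_mx -(mxmE (fun _ _ => mu)). Qed.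

Lemma nu_reduced (N : set red) : measurable N ->
  nu_measure (@reduced R m n @^-1` N) = \int[S]_s ((\1_N s)%:E * part s).
Proof.
move=> mN; have mrN : measurable (@reduced R m n @^-1` N).
  by rewrite -[X in measurable X]setTI; exact: (@measurable_reduced R m n).
transitivity (\int[nu_measure]_t (\1_(@reduced R m n @^-1` N) t)%:E).
  by rewrite integral_indic// setIT.
rewrite -nu_measureE (ge0_integral_nu hpt)//; last first.
  by apply/measurable_EFinP; exact: measurable_indic.
apply: eq_integral => s _; congr (_%:E * _); rewrite !indicE; congr ((nat_of_bool _)%:R)%R.
by apply/idP/idP; rewrite !inE /preimage /= reduced_full_margin.
Qed.

(** The law of the reduced margin under [nu] has density [part], so null sets of [S] pull back to
    null sets of [nu]. *)
Lemma ae_nu_reduced (P : red -> Prop) : {ae S, forall s, P s} ->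
  {ae nu mu, forall t : marg, P (reduced t)}.
Proof.
move=> [N [mN SN PN]]; exists (@reduced R m n @^-1` N); split.
- by rewrite -[X in measurable X]setTI; exact: (@measurable_reduced R m n).
- rewrite nu_measureE nu_reduced// -[RHS](@integral0 _ _ R S setT).
  apply: ae_eq_integral => //.
    apply: emeasurable_funM; last exact: (measurable_partition hpt).
    by apply/measurable_EFinP; exact: measurable_indic.
  by exists N; split => // s /= h; apply: contrapT => Ns; apply: h => _; rewrite indicE memNset// mul0e.
- by move=> t Pt; apply: PN => Ps; apply: Pt.
Qed.

(** The partition function may vanish on a large set for [S], but being the density itself, it gives
    that set no [nu]-mass. *)
Lemma ae_nu_partition_gt0 : {ae nu mu, forall t : marg, 0 < part (reduced t)}.
Proof.
pose N : set red := [set s | part s <= 0].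
have mN : measurable N.
  have -> : N = part @^-1` `]-oo, 0] by apply/seteqP; split => s; rewrite /= in_itv.
  rewrite -[X in measurable X]setTI; apply: (measurable_partition hpt) => //.
  exact: emeasurable_itv.
exists (@reduced R m n @^-1` N); split.
- by rewrite -[X in measurable X]setTI; exact: (@measurable_reduced R m n).
- rewrite nu_measureE nu_reduced// integral0_eq// => s _; rewrite indicE.
  have [|] := boolP (s \in N); last by rewrite mul0e.
  by rewrite inE /N /= => s0; rewrite mul1e; apply/eqP; rewrite eq_le s0 (partition_ge0 hpt).
- by move=> t /negP; rewrite -leNgt.
Qed.

Lemma measurable_eq_marg d (T : measurableType d) (f g : T -> marg) :
  measurable_fun setT f -> measurable_fun setT g -> measurable [set t | f t = g t].
Proof.
move=> mf mg.
rewrite (_ : [set t | f t = g t] =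
    (\bigcap_(i in [set: 'I_m.+1]) [set t | (f t).1 ord0 i = (g t).1 ord0 i]) `&`
    (\bigcap_(j in [set: 'I_n.+1]) [set t | (f t).2 ord0 j = (g t).2 ord0 j])).
  have meq (u v : T -> R) : measurable_fun setT u -> measurable_fun setT v ->
      measurable [set t | u t = v t].
    move=> mu' mv; rewrite (_ : [set t | u t = v t] = (fun t => u t - v t)%R @^-1` [set 0%R]).
      by rewrite -[X in measurable X]setTI; exact: (measurable_funB mu' mv).
    apply/seteqP; split => t /= => [->|/eqP]; first by rewrite subrr.
    by rewrite subr_eq0 => /eqP.
  by apply: measurableI; apply: fin_bigcap_measurable => [|i _]; try exact: finite_finset;
    apply: meq; apply: (measurableT_comp (measurable_entry _ _));
    (exact: (measurableT_comp _ mf) || exact: (measurableT_comp _ mg)).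
apply/seteqP; split => [t /= fg|t /= [h1 h2]]; first by split => i _ /=; rewrite fg.
rewrite [f t]surjective_pairing [g t]surjective_pairing; congr (_, _).
  by apply/rowP => i; exact: (h1 i I).
by apply/rowP => i; exact: (h2 i I).
Qed.

Lemma full_margin_margin (x : mat) : full_margin (reduced (margin x)) = margin x.
Proof.
rewrite full_marginK//=; under eq_bigr do rewrite mxE.
by rewrite exchange_big; apply: eq_bigr => j _; rewrite mxE.
Qed.

Lemma ae_nu_full_margin : {ae nu mu, forall t : marg, full_margin (reduced t) = t}.
Proof.
exists (~` [set t : marg | full_margin (reduced t) = t]); split => //.
- apply: measurableC; apply: measurable_eq_marg => //.
  exact: (measurableT_comp (@measurable_full_margin R m n) (@measurable_reduced R m n)).
- rewrite nu_measureE; transitivity (mxm (fun (_ : 'I_m.+1) (_ : 'I_n.+1) => mu) (@margin R m n @^-1`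
    ~` [set t : marg | full_margin (reduced t) = t])); first by [].
  rewrite (_ : _ @^-1` _ = set0) ?measure0//.
  apply/seteqP; split => // x; apply; exact: full_margin_margin.
Qed.

(** The third clause is there because the bound of the theorem is stated with [p] while the
    densities use [pt]; the last one because densities are computed at reduced margins but evaluated
    at full ones. *)
Definition regular (t : marg) := [/\ 0 < part (reduced t), part (reduced t) < +oo,
  part (reduced t) = partition discrete p (reduced t) & full_margin (reduced t) = t].

Lemma ae_nu_regular : {ae nu mu, forall t : marg, (exists ab : marg, admissible mu ab) -> regular t}.
Proof.
have [[ab hab]|nab] := pselect (exists ab : marg, admissible mu ab); last first.
  exists set0; split => //; first by rewrite nu_measureE measure0.
  by move=> t /= h; apply: h => /nab.
have h1 := ae_nu_partition_gt0.
have h2 := ae_nu_reduced (partition_lty hpt hab).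
have h3 := ae_nu_reduced (@partition_version R m n mu discrete p pt hp hpt pt_ae).
have h4 := ae_nu_full_margin.
move: h1 h2 h3 h4; rewrite nu_measureE => h1 h2 h3 h4.
apply: filterS2 (filterI h1 h2) (filterI h3 h4) => t [? ?] [? ?] _.
by split.
Qed.

(** The matrices have at least one entry, so [nu] is zero whenever [mu] is, and any property then
    holds almost everywhere. *)
Lemma mu_neq0_ae (P : marg -> Prop) : (mu setT != 0 -> {ae nu mu, forall t, P t}) ->
  {ae nu mu, forall t, P t}.
Proof.
have [mu0 _|_] := eqVneq (mu setT) 0; last exact.
exists setT; split => //; rewrite nu_measureE.
transitivity (mxm (fun (_ : 'I_m.+1) (_ : 'I_n.+1) => mu) setT); first by [].
rewrite (_ : setT = mxrect (fun _ _ => setT)); last exact/esym/seteqP.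
rewrite (mxm_rect (fun _ _ => mu))// big_ord_recl big_ord_recl mu0 !mul0e//.
Qed.

End almost_every_margin.

(** * Identities at a regular margin *)

Section regular_margins.
Context (R : realType) (m n : nat).
Local Notation RR := (measurableTypeR R).
Local Notation blk := 'M[R]_(m, n).
Local Notation mat := 'M[R]_(m.+1, n.+1).
Local Notation red := ('rV[R]_m * 'rV[R]_n.+1)%type.
Local Notation marg := ('rV[R]_m.+1 * 'rV[R]_n.+1)%type.
Variables (mu : {sigma_finite_measure set RR -> \bar R}) (discrete : bool) (p pt : R -> R).
Hypothesis hp : is_density mu (@zeta R discrete) p.
Hypothesis hopen : ~~ discrete -> open [set x | 0 < p x].
Hypothesis hpt : is_density mu (@zeta R discrete) pt.
Local Notation Z := (zetam R discrete).
Local Notation ZB := (mxm (fun (_ : 'I_m) (_ : 'I_n) => Z)).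
Local Notation part := (@partition R m n discrete pt).
Local Notation pdens := (pdens mu discrete pt).
Local Notation qdens := (qdens mu pt).

Variables (t ab : marg).
Hypotheses (reg : regular discrete p pt t) (hab : admissible mu ab).
Hypothesis mu0 : (mu setT != 0)%E.

Let mass i j : tilt mu (theta_at ab i j) setT = 1%E.
Proof. by apply: tilt_setT => //; apply: interior_subset; exact: hab. Qed.

Let part_fin : (fine (part (reduced t)))%:E = part (reduced t).
Proof. by have [p0 poo _ _] := reg; rewrite fineK// ge0_fin_numE// ltW. Qed.

Let fpart_gt0 : 0 < fine (part (reduced t)).
Proof. by have [p0 poo _ _] := reg; rewrite fine_gt0// p0. Qed.

(** Bayes' formula: the density of the block times the conditional density of the margin is the
    joint density, and on the fibre of [t] the latter is the weight times a constant. *)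
Lemma prod_tilted_qdens (yb : blk) :
  (\prod_i \prod_j block_family (fun i j => tilted mu pt (theta_at ab i j)) i j (yb i j)) *
  qdens ab yb (reduced t) = weight pt (gam (reduced t) yb) * expR (loglik mu t ab).
Proof.
have [_ _ _ ft] := reg.
by rewrite -prod_tilted_border prod_tilted margin_gam ft.
Qed.

Lemma pdensE (yb : blk) : pdens ab yb t =
  expR (- loglik mu t ab) / fine (part (reduced t)) * qdens ab yb (reduced t).
Proof. by rewrite /pdens mulrC. Qed.

Local Open Scope ereal_scope.

Let measurable_gam_t : measurable_fun setT (fun yb : blk => gam (reduced t) yb).
Proof. exact: measurable_gam. Qed.

Let measurable_weight_t :
  measurable_fun setT (fun yb : blk => (weight pt (gam (reduced t) yb))%:E).
Proof.
apply/measurable_EFinP; exact: (measurableT_comp (measurable_weight hpt) measurable_gam_t).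
Qed.

(** Law of total probability: averaging the conditional density over the block yields the density of
    the law of the margin at [t]. *)
Lemma integral_qdens_law : \int[law_Y mu ab]_y (qdens ab (block y) (reduced t))%:E =
  (fine (part (reduced t)) * expR (loglik mu t ab))%:E.
Proof.
rewrite (ge0_integral_lawm_block hpt (h := fun yb => (qdens ab yb (reduced t))%:E) mass).
- under eq_integral do rewrite -EFinM mulrC prod_tilted_qdens EFinM.
  rewrite ge0_integralZr ?lee_fin ?expR_ge0//; last first.
    by move=> yb _; rewrite lee_fin (weight_ge0 hpt).
  by rewrite -[X in X * _]part_fin -EFinM.
- by apply/measurable_EFinP; exact: (measurable_qdens hpt).
- by move=> yb; rewrite lee_fin (qdens_ge0 hpt).
Qed.

Lemma sup_block_pdens : sup_block mu (fun yb => pdens ab yb t) =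
  sup_block mu (fun yb => qdens ab yb (reduced t)) *
  (\int[law_Y mu ab]_y (qdens ab (block y) (reduced t))%:E)^-1.
Proof.
rewrite integral_qdens_law.
have e0 := expR_gt0 (loglik mu t ab).
(* The expectation is a positive real, so its extended inverse is the ordinary one and
   multiplication by it commutes with the supremum. *)
rewrite inver ifF; last by rewrite gt_eqF// mulr_gt0.
have c0 : (0 < (fine (part (reduced t)) * expR (loglik mu t ab))^-1)%R.
  by rewrite invr_gt0 mulr_gt0.
rewrite muleC -(ereal_sup_pZl _ c0) /sup_block; congr ereal_sup.
rewrite image_comp; apply: eq_imagel => yb _ /=; rewrite pdensE -EFinM.
by rewrite expRN invfM mulrC [(_^-1 / _)%R]mulrC mulrC.
Qed.

Lemma integral_pdens_law (h : blk -> \bar R) : measurable_fun setT h ->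
  (forall yb, 0 <= h yb) ->
  \int[law_Y mu ab]_y ((pdens ab (block y) t)%:E * h (block y)) =
  \int[ZB]_yb (h yb * (weight pt (gam (reduced t) yb) / fine (part (reduced t)))%:E).
Proof.
move=> mh h0; rewrite (ge0_integral_lawm_block hpt (h := fun yb => (pdens ab yb t)%:E * h yb) mass).
- apply: eq_integral => yb _; rewrite muleAC muleC; congr (_ * _).
  rewrite -EFinM; congr (_%:E).
  rewrite pdensE mulrC mulrCA prod_tilted_qdens expRN.
  by rewrite mulrCA mulrAC mulVf ?mul1r// gt_eqF ?expR_gt0.
- apply: emeasurable_funM => //; apply/measurable_EFinP.
  by apply: (measurable_pdens hpt).
- by move=> yb; rewrite mule_ge0// lee_fin; exact: (pdens_ge0 hpt).
Qed.

(** Over an empty set of blocks the supremum would be [-oo]; a point of the support makes it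
    nonnegative. *)
Lemma block_supp_neq0 : exists yb : blk, block_supp mu yb.
Proof.
suff [x sx] : exists x, msupp mu x by exists (const_mx x) => i j; rewrite mxE.
have [N [mN muN sN]] := ae_msupp hp hopen.
apply: contrapT => nx; move/negP : mu0; apply; apply/eqP.
apply/eqP; rewrite -measure_le0 -muN; apply: le_measure; rewrite ?inE//.
by move=> x _; apply: sN => sx; apply: nx; exists x.
Qed.

Lemma ae_law_block_supp : {ae law_Y mu ab, forall y : mat, block_supp mu (block y)}.
Proof.
rewrite lawmE.
have tl i j : {ae tiltm mu (theta_at ab i j), forall x, msupp mu x}.
  have [N [mN muN sN]] := ae_msupp hp hopen; exists N; split => //.
  rewrite tiltmE /tilt; apply: null_set_integral => //.
  by apply/measurable_EFinP; apply: measurable_funTS; exact: measurable_etilt.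
have := @mxm_ae _ _ _ (fun i j => tiltm mu (theta_at ab i j)) (fun _ _ => msupp mu) tl.
by apply: filterS => y hy i j; rewrite !mxE; exact: hy.
Qed.

(** The supremum ranges over the support only, so the pointwise bound is available almost
    everywhere: the law of [Y] puts its block in the support. *)
Lemma integral_pdens_law_le (h : blk -> \bar R) : measurable_fun setT h ->
  (forall yb, 0 <= h yb) ->
  \int[law_Y mu ab]_y ((pdens ab (block y) t)%:E * h (block y)) <=
  sup_block mu (fun yb => pdens ab yb t) * \int[law_Y mu ab]_y h (block y).
Proof.
move=> mh h0.
have mhb : measurable_fun setT (fun y : mat => h (block y)).
  exact: (measurableT_comp mh (@measurable_block R m n)).
have sup0 : 0 <= sup_block mu (fun yb => pdens ab yb t).
  have [yb hy] := block_supp_neq0.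
  apply: (@le_trans _ _ (pdens ab yb t)%:E); first by rewrite lee_fin (pdens_ge0 hpt).
  by apply: ereal_sup_ubound; exists yb.
have := ae_law_block_supp; rewrite lawmE => aes.
rewrite -ge0_integralZl//.
apply: ae_ge0_le_integral => //.
- by move=> y _; rewrite mule_ge0// lee_fin (pdens_ge0 hpt).
- apply: emeasurable_funM => //; apply/measurable_EFinP.
  by apply: (measurable_pdens hpt) => //; exact: measurable_block.
- by move=> y _; rewrite mule_ge0.
- exact: measurable_funeM.
- apply: filterS aes => y hy _; apply: lee_wpmul2r => //.
  by apply: ereal_sup_ubound; exists (block y).
Qed.

Lemma sup_block_pdens_le (M : R) :
  (forall i j x, (tilted mu pt (theta_at ab i j) x <= M)%R) ->
  sup_block mu (fun yb => pdens ab yb t) <= sup_bound mu discrete p M t ab.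
Proof.
move=> hM; have [_ _ pE _] := reg.
have -> : sup_bound mu discrete p M t ab =
    (M ^+ (m + n.+1) * (expR (- loglik mu t ab) / fine (part (reduced t))))%:E.
  (* The exponent counts the border entries: [m] in the last column above the corner and [n.+1] in
     the last row. *)
  rewrite /sup_bound addSn subSS subn0.
  rewrite -(zetamE R discrete) -(mxmE (fun (_ : 'I_m) (_ : 'I_n) => Z)).
  under eq_integral do under eq_bigr do under eq_bigr do rewrite gam_Gamma.
  rewrite -[X in _ * X^-1]/(partition discrete p (reduced t)) -pE -part_fin.
  by rewrite inver ifF ?gt_eqF// -EFinM mulrA.
apply: ge_ereal_sup => _ [yb hy <-]; rewrite lee_fin pdensE mulrC.
have c0 : (0 <= expR (- loglik mu t ab) / fine (part (reduced t)))%R.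
  by rewrite divr_ge0// ?expR_ge0// ltW.
apply: ler_wpM2r => //; rewrite exprD.
have t0 := tilted_ge0 hpt.
apply: ler_pM; rewrite ?prodr_ge0//.
  rewrite -[X in (_ <= M ^+ X)%R]card_ord -prodr_const.
  by apply: ler_prod => i _; rewrite t0 hM.
rewrite -[X in (_ <= M ^+ X)%R]card_ord -prodr_const.
by apply: ler_prod => i _; rewrite t0 hM.
Qed.

End regular_margins.

(** * Comparison with the disintegration *)

Section rational_rectangles.
Context (R : realType) (m n : nat).
Local Notation RR := (measurableTypeR R).
Local Notation blk := 'M[R]_(m, n).

(** Lower orthants with rational corners: a countable generating pi-system, so that an
    almost-everywhere identity for each of them holds for all of them off one null set. *)
Definition rat_rect (q : 'M[rat]_(m, n)) : set blk :=
  mxrect (fun i j => `]-oo, ratr (q i j)[%classic).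

Definition rat_rects : set (set blk) := range rat_rect.

Lemma measurable_rat_rect q : measurable (rat_rect q).
Proof. by apply: measurable_mxrect => i j; exact: measurable_itv. Qed.

Lemma setI_closed_rat_rects : setI_closed rat_rects.
Proof.
move=> _ _ [q _ <-] [r _ <-]; exists (\matrix_(i, j) Num.min (q i j) (r i j)) => //.
apply/seteqP; split => [x /= h|x /= [h1 h2] i j].
  by split => i j; have := h i j; rewrite mxE /= !in_itv /= => /lt_le_trans; apply;
    rewrite ler_rat ge_min lexx ?orbT.
have := h1 i j; have := h2 i j; rewrite mxE /= !in_itv /= /Num.min.
by case: ifP.
Qed.

Definition rat_rect_nat (k : nat) : set blk := rat_rect (const_mx k%:R).

Lemma entry_lt_nat (x : blk) : exists k : nat, forall i j, x i j < k%:R.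
Proof.
exists (\max_i \max_j (Num.truncn (x i j)).+1)%N => i j.
apply: (lt_le_trans (truncnS_gt _)); rewrite ler_nat.
apply: leq_trans (@leq_bigmax _ (fun i => \max_j (Num.truncn (x i j)).+1)%N i).
exact: (@leq_bigmax _ (fun j => (Num.truncn (x i j)).+1) j).
Qed.

Lemma rat_rect_cover : \bigcup_k rat_rect_nat k = setT.
Proof.
apply/seteqP; split => // x _; have [k xk] := entry_lt_nat x.
by exists k => // i j; rewrite /= in_itv /= mxE ratr_nat.
Qed.

Lemma measurable_rat_rects : @measurable _ blk = <<s rat_rects >>.
Proof.
apply/seteqP; split; apply: smallest_sub; last 2 first.
- exact: sigma_algebra_measurable.
- by move=> _ [q _ <-]; exact: measurable_rat_rect.
- exact: smallest_sigma_algebra.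
move=> _ [i [j [B [mB ->]]]].
(* The sets whose preimage under the entry is generated form a sigma-algebra, so only the rays
   []-oo, a[] have to be checked. *)
pose pre := [set B : set RR | <<s rat_rects >> [set x : blk | B (x i j)]].
have : (@RGenInftyO.G R).-sigma.-measurable B by rewrite -RGenInftyO.measurableE.
suff : <<s @RGenInftyO.G R >> `<=` pre by apply.
apply: smallest_sub.
  split.
  - exact: sigma_algebra0.
  - by move=> C preC; exact: (sigma_algebraCD preC).
  - by move=> F preF; exact: sigma_algebra_bigcup.
move=> _ [a ->]; rewrite /pre /=.
(* The half-space where the entry [(i, j)] is below [a] is the union of the orthants with a rational
   [q < a] at [(i, j)] and a natural number [k] elsewhere. Pairs are coded by integers; other codes
   give the empty set. *)
pose F N : set blk := if unpickle N is Some (q, k) then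
  if ratr q < a then rat_rect (\matrix_(i', j')
    if (i' == i) && (j' == j) then q else (k : nat)%:R) else set0 else set0.
have -> : [set x : blk | `]-oo, a[%classic (x i j)] = \bigcup_N F N.
  apply/seteqP; split => [x|x [N _]]; rewrite /= in_itv /=.
    move=> xa; have [q] := rat_in_itvoo xa; rewrite in_itv /= => /andP[xq qa].
    have [k xk] := entry_lt_nat x.
    exists (pickle (q, k)); first exact: I.
    rewrite /F pickleK qa => i' j'.
    rewrite /= in_itv /= mxE; case: ifP => [/andP[/eqP -> /eqP ->]//|_].
    by rewrite ratr_nat.
  rewrite /F; case: unpickle => // -[q k]; case: ifP => // qa /(_ i j).
  by rewrite /= in_itv /= mxE !eqxx /= => /lt_trans; apply.
apply: sigma_algebra_bigcup => N; rewrite /F.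
case: unpickle => [[q k]|]; last exact: sigma_algebra0.
case: ifP => _; last exact: sigma_algebra0.
by apply: sub_sigma_algebra; eexists.
Qed.

Lemma rat_rects_unique (P Q : {measure set blk -> \bar R}) :
  (forall k, P (rat_rect_nat k) < +oo)%E ->
  (forall q, P (rat_rect q) = Q (rat_rect q)) -> forall A, measurable A -> P A = Q A.
Proof.
move=> Poo PQ A; apply: (measure_unique rat_rects rat_rect_nat) => //.
- exact: measurable_rat_rects.
- exact: setI_closed_rat_rects.
- by move=> k; exists (const_mx k%:R).
- exact: rat_rect_cover.
- by move=> _ [q _ <-]; exact: PQ.
Qed.

End rational_rectangles.

Section disintegration.
Context (R : realType) (m n : nat).
Local Notation RR := (measurableTypeR R).
Local Notation blk := 'M[R]_(m, n).
Local Notation mat := 'M[R]_(m.+1, n.+1).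
Local Notation red := ('rV[R]_m * 'rV[R]_n.+1)%type.
Local Notation marg := ('rV[R]_m.+1 * 'rV[R]_n.+1)%type.
Variables (mu : {sigma_finite_measure set RR -> \bar R}) (discrete : bool) (pt : R -> R).
Hypothesis hpt : is_density mu (@zeta R discrete) pt.
Hypothesis hnu : sigma_finite setT (@nu R m n mu).
Local Notation Z := (zetam R discrete).
Local Notation ZB := (mxm (fun (_ : 'I_m) (_ : 'I_n) => Z)).
Local Notation S := (red_measure m n Z).
Local Notation part := (@partition R m n discrete pt).
Local Notation nu_measure := (nu_measure m n mu).
Variable lam : R.-ker marg ~> mat.
Hypothesis hlam : is_disintegration mu lam.

(** Where the partition function is 0 or infinite, [fine] returns 0 and so does its inverse: the
    density is then identically zero. Thus [block_law s] has mass at most one for every [s]. *)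
Definition block_density (s : red) (yb : blk) : R :=
  weight pt (gam s yb) / fine (part s).

Lemma block_density_ge0 s yb : 0 <= block_density s yb.
Proof.
by rewrite divr_ge0 ?(weight_ge0 hpt)// fine_ge0// (partition_ge0 hpt).
Qed.

Lemma measurable_block_density d (T : measurableType d) (s : T -> red) (yb : T -> blk) :
  measurable_fun setT s -> measurable_fun setT yb ->
  @measurable_fun _ _ T RR setT (fun t => block_density (s t) (yb t)).
Proof.
move=> ms my; apply: measurable_funM.
  by apply: (measurableT_comp (measurable_weight hpt)); exact: measurable_gam.
under eq_fun do rewrite -powR_inv1 ?fine_ge0 ?(partition_ge0 hpt)//.
apply: (@measurableT_comp _ _ _ _ _ _ (fun x : R => x `^ (-1))%R); first exact: measurable_powR.
apply: (measurableT_comp (@fine_measurable R setT measurableT)).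
exact: (measurableT_comp (measurable_partition hpt)).
Qed.

Local Open Scope ereal_scope.

Definition block_law (s : red) : {measure set blk -> \bar R} :=
  dens ZB (measurable_block_density (measurable_cst s) (@measurable_id _ blk setT))
    (block_density_ge0 s).

Lemma block_lawE s A : measurable A ->
  block_law s A = \int[ZB]_yb (\1_A yb * block_density s yb)%:E.
Proof.
move=> mA; transitivity (\int[ZB]_(yb in A) (block_density s yb)%:E); first by [].
rewrite integral_mkcond; apply: eq_integral => yb _; rewrite patchE indicE.
by case: ifPn => _; rewrite ?mul1r ?mul0r.
Qed.

Lemma measurable_block_law A : measurable A -> measurable_fun setT (fun s => block_law s A).
Proof.
move=> mA; under eq_fun do rewrite block_lawE//.
have mf : measurable_fun setT (fun u : red * blk => (\1_A u.2 * block_density u.1 u.2)%:E).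
  apply/measurable_EFinP; apply: measurable_funM; last exact: measurable_block_density.
  by apply: measurableT_comp => //; exact: measurable_indic.
apply: (measurable_fun_fubini_tonelli_F (m2 := ZB) _ mf) => u.
by rewrite lee_fin mulr_ge0// block_density_ge0.
Qed.

Let measurable_weight_gam s : measurable_fun setT (fun yb : blk => (weight pt (gam s yb))%:E).
Proof.
apply/measurable_EFinP; apply: (measurableT_comp (measurable_weight hpt)).
exact: measurable_gam.
Qed.

Lemma block_law_le1 s A : measurable A -> block_law s A <= 1.
Proof.
move=> mA; apply: (@le_trans _ _ (block_law s setT)).
  by apply: le_measure; rewrite ?inE.
rewrite block_lawE//.
under eq_integral do rewrite indicT mul1r EFinM.
rewrite ge0_integralZr//; last 2 first.
- by move=> yb _; rewrite lee_fin (weight_ge0 hpt).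
- by rewrite lee_fin invr_ge0 fine_ge0// (partition_ge0 hpt).
rewrite -/(part s); have := partition_ge0 hpt s; case: (part s) => [r| |]//= r0.
  rewrite -EFinM lee_fin; have [->|rn0] := eqVneq r 0%R; first by rewrite mul0r.
  by rewrite mulfV.
by rewrite invr0 mule0.
Qed.

Lemma block_law_partition s A : measurable A -> part s < +oo ->
  block_law s A * part s = \int[ZB]_yb (\1_A yb * weight pt (gam s yb))%:E.
Proof.
move=> mA soo; rewrite block_lawE//.
have m1w : measurable_fun setT (fun yb : blk => (\1_A yb * weight pt (gam s yb))%:E).
  apply/measurable_EFinP; apply: measurable_funM; first exact: measurable_indic.
  by apply: (measurableT_comp (measurable_weight hpt)); exact: measurable_gam.
have w0 (yb : blk) : 0 <= (\1_A yb * weight pt (gam s yb))%:E.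
  by rewrite lee_fin mulr_ge0// (weight_ge0 hpt).
under eq_integral do rewrite /block_density mulrA EFinM.
rewrite ge0_integralZr//; last by rewrite lee_fin invr_ge0 fine_ge0// (partition_ge0 hpt).
have sfin : part s \is a fin_num by rewrite ge0_fin_numE ?(partition_ge0 hpt).
(* With [part s = 0] the right-hand side is zero too, being dominated by the partition function. *)
have [s0|s0] := eqVneq (part s) 0.
  rewrite s0 mule0; apply/esym/eqP; rewrite eq_le integral_ge0// andbT -s0.
  apply: ge0_le_integral => // yb _; rewrite lee_fin.
  by rewrite ler_piMl ?(weight_ge0 hpt)// indicE; case: (_ \in _).
have e1 : ((fine (part s))^-1)%:E * part s = 1.
  by rewrite -[X in _ * X]fineK// -EFinM mulVf// fine_eq0.
by rewrite -muleA e1 mule1.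
Qed.

(** The disintegration identity is tested on the indicator of the margin in [E] and the block in
    [A]; since [lam t] lives on the matrices of margin [t], the first indicator is constant under
    it. *)
Lemma integral_lam_block (A : set blk) (E : set marg) : measurable A -> measurable E ->
  \int[nu mu]_t ((\1_E t)%:E * lam t (@block R m n @^-1` A)) =
  \int[S]_s ((\1_E (full_margin s))%:E * \int[ZB]_yb (\1_A yb * weight pt (gam s yb))%:E).
Proof.
move=> mA mE.
have mbA : measurable (@block R m n @^-1` A).
  by rewrite -[X in measurable X]setTI; exact: (@measurable_block R m n).
have mmg := @measurable_margin R m n.
pose h (x : mat) : \bar R := (\1_E (margin x) * \1_(@block R m n @^-1` A) x)%:E.
have mh : measurable_fun setT h.
  apply/measurable_EFinP; apply: measurable_funM; last exact: measurable_indic.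
  by apply: (measurableT_comp _ mmg); exact: measurable_indic.
have h0 x : 0 <= h x by rewrite lee_fin mulr_ge0.
have [lam1 lam2] := hlam.
have := lam2 h mh h0; rewrite /mu_mx -(mxmE (fun _ _ => mu)).
have hpZ : is_density mu Z pt by rewrite zetamE.
rewrite (ge0_integral_density_gam (fun _ _ => hpZ) mh h0) => lamE.
transitivity (\int[nu mu]_t \int[lam t]_x h x).
  rewrite nu_measureE; apply: ae_eq_integral => //.
  - apply: emeasurable_funM; last exact: measurable_kernel.
    by apply/measurable_EFinP; exact: measurable_indic.
  - apply: measurable_fun_integral_kernel => //.
    by move=> U mU; exact: measurable_kernel.
  move: lam1; rewrite nu_measureE; apply: filterS => t [lamT lamN] _.
  have mN : measurable (~` [set x : mat | margin x = t]).
    by apply: measurableC; apply: measurable_eq_marg.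
  rewrite -[X in lam t X]setIT -(integral_indic (lam t) measurableT mbA).
  have m1 : measurable_fun setT (fun x : mat => (\1_(@block R m n @^-1` A) x : R)%:E).
    by apply/measurable_EFinP; exact: measurable_indic.
  have i0 : 0 <= (\1_E t : R)%:E by rewrite lee_fin.
  rewrite -(ge0_integralZl (lam t) measurableT m1 _ i0); last by move=> x _; rewrite lee_fin.
  apply: ae_eq_integral => //; first exact: emeasurable_funM.
  exists (~` [set x : mat | margin x = t]); split => // x /= hx.
  by apply: contra_not hx => xt _; rewrite /h xt EFinM.
rewrite -lamE; apply: eq_integral => s _.
rewrite -ge0_integralZl ?lee_fin//.
- apply: eq_integral => yb _; rewrite /h margin_gam -!EFinM mulrA; congr (_ * _ * _)%:E.
  rewrite !indicE; congr ((nat_of_bool _)%:R)%R.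
  by apply/idP/idP; rewrite !inE /preimage /= block_border.
- apply/measurable_EFinP; apply: measurable_funM; first exact: measurable_indic.
  by apply: (measurableT_comp (measurable_weight hpt)); exact: measurable_gam.
- by move=> yb _; rewrite lee_fin mulr_ge0// (weight_ge0 hpt).
Qed.

(** The two functions of [t] have equal integrals over every measurable [E]. Sigma-finiteness of
    [nu] cuts the margins into pieces of finite measure, on which [block_law], bounded by one, is
    integrable; on each piece the functions then agree almost everywhere. *)
Lemma ae_lam_block (A : set blk) : measurable A -> (exists ab : marg, admissible mu ab) ->
  {ae nu mu, forall t, block_law (reduced t) A = lam t (@block R m n @^-1` A)}.
Proof.
move=> mA [ab hab].
have mbA : measurable (@block R m n @^-1` A).
  by rewrite -[X in measurable X]setTI; exact: (@measurable_block R m n).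
have mbl : measurable_fun setT (fun t : marg => block_law (reduced t) A).
  exact: (measurableT_comp (measurable_block_law mA) (@measurable_reduced R m n)).
have mlA : measurable_fun setT (fun t : marg => lam t (@block R m n @^-1` A)).
  exact: measurable_kernel.
have eqE E : measurable E ->
    \int[nu mu]_(t in E) block_law (reduced t) A =
    \int[nu mu]_(t in E) lam t (@block R m n @^-1` A).
  move=> mE.
  have indE (f : marg -> \bar R) : \int[nu mu]_(t in E) f t = \int[nu mu]_t ((\1_E t)%:E * f t).
    rewrite nu_measureE integral_mkcond; apply: eq_integral => t _.
    by rewrite patchE indicE; case: ifPn => _; rewrite ?mul1e ?mul0e.
  rewrite !indE integral_lam_block// (ge0_integral_nu hpt).
  - apply: ae_eq_integral => //.
    + apply: emeasurable_funM; last exact: (measurable_partition hpt).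
      have mG : measurable_fun setT (fun t : marg => (\1_E t)%:E * block_law (reduced t) A).
        by apply: emeasurable_funM => //; apply/measurable_EFinP; exact: measurable_indic.
      exact: (measurableT_comp mG (@measurable_full_margin R m n)).
    + apply: emeasurable_funM.
        have mfm := @measurable_full_margin R m n.
        have m1 : measurable_fun setT (fun s : red => \1_E (full_margin s) : R).
          by apply: (measurableT_comp _ mfm); exact: measurable_indic.
        exact/measurable_EFinP.
      have mf : measurable_fun setT
          (fun u : red * blk => (\1_A u.2 * weight pt (gam u.1 u.2))%:E).
        apply/measurable_EFinP; apply: measurable_funM.
          by apply: measurableT_comp => //; exact: measurable_indic.
        by apply: (measurableT_comp (measurable_weight hpt)); exact: measurable_gam.
      apply: (measurable_fun_fubini_tonelli_F (m2 := ZB) _ mf) => u.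
      by rewrite lee_fin mulr_ge0// (weight_ge0 hpt).
    + apply: filterS (partition_lty hpt hab) => s soo _ /=.
      by rewrite reduced_full_margin -muleA block_law_partition.
  - by apply: emeasurable_funM => //; apply/measurable_EFinP; exact: measurable_indic.
  - by move=> t; rewrite mule_ge0.
have [F FT Foo] := hnu.
have : {ae nu mu, forall t k, F k t -> block_law (reduced t) A = lam t (@block R m n @^-1` A)}.
  rewrite nu_measureE; apply/ae_foralln => k; have [mF Fk] := Foo k.
  rewrite nu_measureE in Fk; apply: integral_ae_eq => //.
  - apply/integrableP; split; first exact: measurable_funTS.
    apply: (@le_lt_trans _ _ (\int[nu_measure]_(t in F k) (cst 1 t))); last by rewrite integral_cst// mul1e.
    apply: ge0_le_integral => //.
    + by apply: measurableT_comp => //; exact: measurable_funTS.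
    + by move=> t _; rewrite gee0_abs// block_law_le1.
  - exact: measurable_funTS.
  - by move=> E EF mE; rewrite -nu_measureE; exact: eqE.
rewrite nu_measureE; apply: filterS => t Ht.
have : [set: marg] t by [].
by rewrite FT => -[k _ /Ht].
Qed.

Lemma ae_lam_block_law : (exists ab : marg, admissible mu ab) ->
  {ae nu mu, forall t A, measurable A -> lam t (@block R m n @^-1` A) = block_law (reduced t) A}.
Proof.
move=> hab; have [lam1 _] := hlam.
have : {ae nu mu, forall t (q : 'M[rat]_(m, n)),
    block_law (reduced t) (@rat_rect R m n q) = lam t (@block R m n @^-1` @rat_rect R m n q)}.
  rewrite nu_measureE; apply: ae_forall_count => q.
  by rewrite -nu_measureE; apply: ae_lam_block => //; exact: measurable_rat_rect.
move: lam1; rewrite nu_measureE; apply: filterS2 => t [lamT _] Ht A mA.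
have mq q : measurable (@block R m n @^-1` @rat_rect R m n q).
  rewrite -[X in measurable X]setTI; apply: (@measurable_block R m n) => //.
  exact: measurable_rat_rect.
refine (@rat_rects_unique R m n (push (lam t) (@measurable_block R m n))
  (block_law (reduced t)) _ _ A mA) => [k|q]; last exact/esym/Ht.
apply: (@le_lt_trans _ _ (lam t setT)); last by rewrite lamT ltry.
have : lam t (@block R m n @^-1` rat_rect_nat k) <= lam t setT.
  by apply: le_measure; rewrite ?inE//; exact: mq.
exact.
Qed.

Lemma integral_lam_block_law (t : marg) (h : blk -> \bar R) :
  (forall A, measurable A -> lam t (@block R m n @^-1` A) = block_law (reduced t) A) ->
  measurable_fun setT h -> (forall yb, 0 <= h yb) ->
  \int[lam t]_x h (block x) = \int[ZB]_yb (h yb * (block_density (reduced t) yb)%:E).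
Proof.
move=> Ht mh h0.
rewrite -(ge0_integral_push _ (@measurable_block R m n))//.
rewrite (eq_measure_integral (block_law (reduced t))); last by move=> A mA _; exact: Ht.
by rewrite (ge0_integral_dens (is_density_dens _ _ _)).
Qed.

End disintegration.

(** * Uniform bounds and conclusion *)

Section tilted_bounds.
Context (R : realType).
Local Notation RR := (measurableTypeR R).
Variables (mu : {sigma_finite_measure set RR -> \bar R}) (discrete : bool) (p pt : R -> R).
Hypothesis hp : is_density mu (@zeta R discrete) p.
Hypothesis hpt : is_density mu (@zeta R discrete) pt.
Hypothesis ptp : forall x, pt x = 0 \/ (pt x = p x /\ lattice discrete x).
Local Notation Z := (zetam R discrete).
Hypothesis pt_le : forall G : R -> R, continuous G -> (forall x, 0 <= G x) ->
  {ae Z, forall x, p x <= G x} -> forall x, pt x <= G x.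

(** The bounded density [f] agrees almost everywhere with the tilt of [p], whose mass is finite.
    Hence [p] lies almost everywhere below [M] divided by the tilting factor, a continuous function,
    and the choice of [pt] turns this into a bound at every point. *)
Lemma tilted_le (theta M : R) (f : R -> R) : Theta mu theta ->
  is_density (tilt mu theta) (@zeta R discrete) f -> (forall x, f x <= M) ->
  forall x, tilted mu pt theta x <= M.
Proof.
rewrite -zetamE => Tt [mf f0 fE] fM x.
have M0 : 0 <= M by exact: le_trans (f0 x) (fM x).
have [mp p0 pE] := is_density_tilted hp theta.
have fae : ae_eq Z setT (fun x => (tilted mu p theta x)%:E) (fun x => (f x)%:E).
  apply: integral_ae_eq => //.
  - apply/integrableP; split; first exact/measurable_EFinP.
    rewrite (eq_integral (fun x => (tilted mu p theta x)%:E)); last first.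
      by move=> y _; rewrite gee0_abs// lee_fin.
    by rewrite -pE//; apply: le_lt_trans (tilt_setT_le1 Tt) (ltry _).
  - exact/measurable_EFinP.
  - by move=> E _ mE; rewrite -pE// -fE.
pose G (y : R) := M * expR (psi mu theta - theta * y).
have cG : continuous G.
  move=> y; apply: cvgM; first exact: cvg_cst.
  apply: continuous_comp; last exact: continuous_expR.
  apply: cvgB; first exact: cvg_cst.
  by apply: cvgM; [exact: cvg_cst|exact: cvg_id].
have Gexp (y : R) (a : R) : (a <= G y) = (a * etilt mu theta y <= M).
  rewrite /G /etilt -[theta * y - _]opprB expRN.
  by rewrite ler_pdivrMr ?expR_gt0.
rewrite /tilted -Gexp; apply: pt_le => // [y|].
  by rewrite mulr_ge0// expR_ge0.
apply: filterS fae => y /(_ I) [fy]; rewrite Gexp.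
by move: (fM y); rewrite -fy.
Qed.

(** Where [pt] is nonzero, [x] is an integer, of [zeta]-mass one, so the density there is the mass
    of a point under a measure of total mass at most one. *)
Lemma tilted_le1 (theta : R) : discrete -> Theta mu theta ->
  forall x, tilted mu pt theta x <= 1.
Proof.
move=> d Tt x; have [e|[_ Lx]] := ptp x; first by rewrite /tilted e mul0r.
have [mt t0 tE] := is_density_tilted hpt theta.
have m1 : measurable ([set x] : set RR) by exact: measurable_set1.
rewrite -lee_fin; apply: le_trans (tilt_setT_le1 Tt).
apply: (@le_trans _ _ (tiltm mu theta [set x])); last first.
  by rewrite -tiltmE; apply: le_measure; rewrite ?inE.
rewrite tE// (eq_integral (fun=> (tilted mu pt theta x)%:E)); last by move=> y; rewrite inE => ->.
rewrite integral_cst//.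
have Z1 : Z ([set x] : set RR) = 1%E.
  by move: d Lx; case: (discrete) => // _; exact: zetam_set1.
by rewrite [X in (_ * X)%E]Z1 mule1.
Qed.

End tilted_bounds.

Section comparison.
Context (R : realType) (m n : nat).
Local Notation RR := (measurableTypeR R).
Local Notation blk := 'M[R]_(m, n).
Local Notation mat := 'M[R]_(m.+1, n.+1).
Local Notation marg := ('rV[R]_m.+1 * 'rV[R]_n.+1)%type.
Variables (mu : {sigma_finite_measure set RR -> \bar R}) (discrete : bool) (p pt : R -> R).
Hypothesis hp : is_density mu (@zeta R discrete) p.
Hypothesis hopen : ~~ discrete -> open [set x | 0 < p x].
Hypothesis hpt : is_density mu (@zeta R discrete) pt.
Variable lam : R.-ker marg ~> mat.
Variables (t ab : marg).
Hypotheses (reg : regular discrete p pt t) (hab : admissible mu ab).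
Hypothesis mu0 : (mu setT != 0)%E.
Hypothesis Ht : forall A, measurable A ->
  lam t (@block R m n @^-1` A) = block_law hpt (reduced t) A.

Lemma block_comparison_pdens :
  block_comparison mu (lam t) ab (fun yb => pdens mu discrete pt ab yb t).
Proof.
have ge0E (h : blk -> R) : measurable_fun setT h -> (forall yb, 0 <= h yb) ->
    (\int[lam t]_x (h (block x))%:E =
     \int[law_Y mu ab]_y (pdens mu discrete pt ab (block y) t * h (block y))%:E)%E.
  move=> mh h0; have mhE : measurable_fun setT (fun yb => (h yb)%:E) by exact/measurable_EFinP.
  rewrite (integral_lam_block_law Ht mhE)//.
  have := integral_pdens_law hpt reg hab mu0 mhE h0.
  by rewrite lawmE => <-; apply: eq_integral => y _; rewrite EFinM.
move=> h mh _; split => [|h0].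
  have mP : measurable_fun setT (fun yb => Num.max (h yb) 0).
    exact: measurable_maxr.
  have mN : measurable_fun setT (fun yb => Num.max (- h yb) 0).
    by apply: measurable_maxr => //; exact: measurableT_comp.
  have P0 yb : 0 <= Num.max (h yb) 0 by rewrite le_max lexx orbT.
  have N0 yb : 0 <= Num.max (- h yb) 0 by rewrite le_max lexx orbT.
  have pge0 := pdens_ge0 hpt (mu := mu) (discrete := discrete).
  (* As [pdens] is nonnegative, it factors out of the positive and the negative part, and the
     identity for nonnegative functions applies to each. *)
  rewrite lawmE integralE [RHS]integralE; congr (_ - _)%E.
    rewrite (eq_integral (fun x : mat => (Num.max (h (block x)) 0)%:E)).
      rewrite (ge0E _ mP P0) lawmE; apply: eq_integral => y _.
      by rewrite funeposE -EFin_max maxr_pMr// mulr0.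
    by move=> x _; rewrite funeposE -EFin_max.
  rewrite (eq_integral (fun x : mat => (Num.max (- h (block x)) 0)%:E)).
    rewrite (ge0E _ mN N0) lawmE; apply: eq_integral => y _.
    by rewrite funenegE -EFinN -EFin_max maxr_pMr// mulr0 mulrN.
  by move=> x _; rewrite funenegE -EFinN -EFin_max.
have mhE : measurable_fun setT (fun yb => (h yb)%:E) by exact/measurable_EFinP.
have := integral_pdens_law_le hp hopen hpt t ab mu0 mhE h0.
rewrite lawmE; apply: le_trans; rewrite le_eqVlt; apply/orP; left; apply/eqP.
by apply: eq_integral => y _; rewrite EFinM.
Qed.

End comparison.

(** Common frame of the three conclusions: [T] carries what must hold almost everywhere beyond
    regularity, and [Q] is then proved for all admissible [ab] at once, so the MLE may depend on
    [t]. If no parameter is admissible, there is no MLE. *)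
Lemma ae_nu_MLE (R : realType) (m n : nat)
    (mu : {sigma_finite_measure set (measurableTypeR R) -> \bar R})
    (discrete : bool) (p pt : R -> R) (rho : R)
    (hp : is_density mu (@zeta R discrete) p) (hpt : is_density mu (@zeta R discrete) pt)
    (pt_ae : {ae zetam R discrete, forall x, pt x = p x})
    (T : 'rV[R]_m.+1 * 'rV[R]_n.+1 -> Prop)
    (Q : 'rV[R]_m.+1 * 'rV[R]_n.+1 -> 'rV[R]_m.+1 * 'rV[R]_n.+1 -> Prop) :
  ((exists ab : 'rV[R]_m.+1 * 'rV[R]_n.+1, admissible mu ab) ->
    {ae nu mu, forall t, T t}) ->
  (mu setT != 0%E -> forall t ab, regular discrete p pt t -> T t -> admissible mu ab -> Q t ab) ->
  {ae nu mu, forall t, rho = 0 \/ mu_mx mu (Trho rho t) = 0%E ->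
    forall ab, is_MLE mu t ab -> Q t ab}.
Proof.
move=> HT HQ; apply: mu_neq0_ae => mu0.
have [hab|nab] := pselect (exists ab : 'rV[R]_m.+1 * 'rV[R]_n.+1, admissible mu ab).
  have := HT hab; have := ae_nu_regular m n hp hpt pt_ae; rewrite nu_measureE.
  apply: filterS2 => t reg Tt _ ab [adm _].
  by apply: HQ => //; exact: reg.
rewrite nu_measureE; apply: aeW => t _ ab [adm _].
by exfalso; apply: nab; exists ab.
Qed.

Theorem corollary1p12 (R : realType) (m n : nat)
    (mu : {sigma_finite_measure set (measurableTypeR R) -> \bar R})
    (discrete : bool) (p : R -> R) (rho : R)
    (hTheta0 : Theta mu !=set0)
    (hTheta1 : forall theta, Theta mu <> [set theta])
    (hrho : 0 <= rho)
    (hnu : sigma_finite setT (@nu R m n mu))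
    (hp : is_density mu (@zeta R discrete) p)
    (hopen : ~~ discrete -> open [set x | 0 < p x]) :
  exists (q : 'rV[R]_m.+1 * 'rV[R]_n.+1 -> 'M[R]_(m, n) ->
              'rV[R]_m * 'rV[R]_n.+1 -> R)
         (pbar : 'rV[R]_m.+1 * 'rV[R]_n.+1 -> 'M[R]_(m, n) ->
                 'rV[R]_m.+1 * 'rV[R]_n.+1 -> R),
    [/\ is_q_family mu discrete q,
        is_p_family mu pbar,
        {ae @nu R m n mu, forall t,
          rho = 0 \/ mu_mx mu (Trho rho t) = 0%E ->
          forall ab, is_MLE mu t ab ->
          (sup_block mu (fun yb => pbar ab yb t) =
             sup_block mu (fun yb => q ab yb (reduced t)) *
             (\int[law_Y mu ab]_y (q ab (block y) (reduced t))%:E)^-1)%E}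
      & forall lam : R.-ker ('rV[R]_m.+1 * 'rV[R]_n.+1)%type
                       ~> 'M[R]_(m.+1, n.+1),
        is_disintegration mu lam ->
        (forall delta M : R, 0 < delta -> 0 < M ->
           (forall theta, tame_interval mu delta theta ->
              exists f, is_density (tilt mu theta) (@zeta R discrete) f /\
                        forall x, f x <= M) ->
           {ae @nu R m n mu, forall t,
             rho = 0 \/ mu_mx mu (Trho rho t) = 0%E ->
             forall ab, is_MLE mu t ab ->
             block_comparison mu (lam t) ab (fun yb => pbar ab yb t) /\
             ((forall i j, tame_interval mu delta (ab.1 0 i + ab.2 0 j)) ->
              (sup_block mu (fun yb => pbar ab yb t) <=
                 sup_bound mu discrete p M t ab)%E)})
        /\
        (discrete ->
           {ae @nu R m n mu, forall t,
             rho = 0 \/ mu_mx mu (Trho rho t) = 0%E ->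
             forall ab, is_MLE mu t ab ->
             block_comparison mu (lam t) ab (fun yb => pbar ab yb t) /\
             (sup_block mu (fun yb => pbar ab yb t) <=
                sup_bound mu discrete p 1 t ab)%E})].
Proof.
have [pt [mpt ptp pt_ae pt_le]] := good_version hp.
have pt0 x : 0 <= pt x.
  by have [-> //|[-> _]] := ptp x; have [_ + _] := hp; exact.
have hpt : is_density mu (@zeta R discrete) pt.
  have hpZ : is_density mu (zetam R discrete) p by rewrite zetamE.
  by rewrite -zetamE; exact: (is_density_ae mpt pt0 pt_ae hpZ).
have Th ab i j : admissible mu ab -> Theta mu (@theta_at R m n ab i j).
  by move=> hab; apply: interior_subset; exact: hab.
(* Both families use the version [pt], for which the bounds on tilted densities hold at every
   point. *)
exists (qdens mu pt), (pdens mu discrete pt); split.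
- exact: is_q_family_qdens.
- exact: (is_p_family_pdens m n hp hopen hpt ptp pt_ae).
- apply: (@ae_nu_MLE R m n mu discrete p pt rho hp hpt pt_ae (fun=> True)) => [_|mu0 t ab reg _ hab].
    by rewrite nu_measureE; exact: aeW.
  exact: (sup_block_pdens hpt reg hab mu0).
- move=> lam hlam; split=> [delta M _ _ hM|d];
    apply: (@ae_nu_MLE R m n mu discrete p pt rho hp hpt pt_ae _ _ (ae_lam_block_law hpt hnu hlam)) => mu0 t ab reg Ht hab.
  + split; first exact: (block_comparison_pdens hp hopen reg hab mu0 Ht).
    move=> tame; apply: (sup_block_pdens_le hpt reg) => i j.
    have [f [df fM]] := hM _ (tame i j).
    exact: (tilted_le hp pt_le (Th ab i j hab) df fM).
  + split; first exact: (block_comparison_pdens hp hopen reg hab mu0 Ht).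
    apply: (sup_block_pdens_le hpt reg) => i j.
    exact: (tilted_le1 hpt ptp d (Th ab i j hab)).
Qed.
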